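(* Let $\mathfrak{g}$ be an $H$-type Lie algebra with center $\mathfrak{z}$, and set $n:=\dim \mathfrak{z}$, $m:=\dim \mathfrak{z}^{\perp}$. Let $\mathbb{G}\cong\mathbb{R}^{m}\times\mathbb{R}^{n}$ be the corresponding $H$-type group, with sub-Laplacian $\Delta_{\mathbb{G}}$ and with the homogeneous norm $$\vert x\vert := \left( \vert \overline{x}\vert_{\mathbb{R}^{m}}^{4} + \vert \widehat{x}\vert_{\mathbb{R}^{n}}^{2}\right)^{1/4},\qquad x=(\overline{x},\widehat{x})\in\mathbb{R}^{m}\times\mathbb{R}^{n}.$$ Let $\lambda_{1}=\lambda_{1}(m,n)$ be the spectral gap (lowest Dirichlet eigenvalue) of $-\frac12\Delta_{\mathbb{G}}$ restricted to the unit ball $\{x\in\mathbb{G}:\vert x\vert<1\}$, and for $d\geqslant 1$ let $\lambda_{1}^{(d)}$ be the lowest Dirichlet eigenvalue of $-\frac12\Delta_{\mathbb{R}^{d}}$ on the Euclidean unit ball of $\mathbb{R}^{d}$. Then $$\lambda_{1}^{(m)}\leqslant \lambda_{1}\leqslant c\left(\lambda_{1}^{(m)},\lambda_{1}^{(n)}\right),$$ where $$c\left(\lambda_{1}^{(m)},\lambda_{1}^{(n)}\right):=f(x^{\ast})=\inf_{0<x<1}f(x),\qquad f(x)=\frac{\lambda_{1}^{(m)}}{\sqrt{1-x}}+\frac{\lambda_{1}^{(n)}\sqrt{1-x}}{4x},$$ $$x^{\ast}=\frac{\sqrt{\left(\lambda_{1}^{(n)}\right)^{2}+32\,\lambda_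{1}^{(n)}\lambda_{1}^{(m)}}-3\lambda_{1}^{(n)}}{2\left(4\lambda_{1}^{(m)}-\lambda_{1}^{(n)}\right)}.$$
   Context: A finite-dimensional real Lie algebra $\mathfrak{g}$ with (nontrivial) center $\mathfrak{z}$ is an $H$-type Lie algebra if there is an inner product $\langle\cdot,\cdot\rangle$ on $\mathfrak{g}$ such that $[\mathfrak{z}^{\perp},\mathfrak{z}^{\perp}]=\mathfrak{z}$ and, for every $Z\in\mathfrak{z}$ with $\langle Z,Z\rangle=1$, the map $J_{Z}:\mathfrak{z}^{\perp}\to\mathfrak{z}^{\perp}$ defined by $\langle J_{Z}X,Y\rangle=\langle Z,[X,Y]\rangle$ is orthogonal. An $H$-type group is a connected, simply connected Lie group whose Lie algebra is of $H$-type. With $m=\dim\mathfrak{z}^{\perp}$ and $n=\dim\mathfrak{z}$, such a group is identified with $\mathbb{R}^{m+n}$ with group law $$x\cdot y=\left(\overline{x}+\overline{y},\ \widehat{x}_{1}+\widehat{y}_{1}+\tfrac12\langle U^{(1)}\overline{x},\overline{y}\rangle,\ \ldots,\ \widehat{x}_{n}+\widehat{y}_{n}+\tfrac12\langle U^{(n)}\overline{x},\overline{y}\rangle\right),$$ $x=(\overline{x},\widehat{x})$, $y=(\overline{y},\widehat{y})\in\mathbb{R}^{m}\times\mathbb{R}^{n}$, where $U^{(1)},\dots,U^{(n)}$ are $m\times m$ skew-symmetric orthogonal matrices with $U^{(i)}U^{(j)}+U^{(j)}U^{(i)}=0$ for $i\neq j$ (this is a known characterization of $H$-type groups). The sub-Laplacian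 is $\Delta_{\mathbb{G}}=\sum_{j=1}^{m}X_{j}^{2}$, where $X_{j}$ is the left-invariant vector field on $\mathbb{G}$ equal to $\partial/\partial\overline{x}_{j}$ at the identity $0$. The Dirichlet operator $-\frac12\Delta_{\mathbb{G}}$ restricted to a bounded open connected set $\Omega\subset\mathbb{G}$ is the self-adjoint operator on $L^{2}(\Omega,dx)$ ($dx$ Lebesgue measure) associated with the closure of the quadratic form $\varphi\mapsto\frac12\int_{\Omega}\sum_{j=1}^{m}(X_{j}\varphi)^{2}\,dx$ on $C_{c}^{\infty}(\Omega)$. It is known that its spectrum is discrete with strictly positive lowest eigenvalue; this lowest eigenvalue is called the spectral gap. *)

(* Defs.v *)
From HB Require Import structures.
From mathcomp Require Import all_boot all_order all_algebra.
From mathcomp Require Import all_classical all_reals all_analysis.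

Set Implicit Arguments.
Unset Strict Implicit.
Unset Printing Implicit Defensive.

Import Order.TTheory GRing.Theory Num.Theory.
Import numFieldNormedType.Exports.

Local Open Scope classical_set_scope.
Local Open Scope ring_scope.

(* The sigma-algebra generated by the coordinates, i.e. the Borel sets. *)
Definition rV_display : measure_display -> measure_display.
Proof. exact. Qed.

Section rV_measurable.
Context (R : realType) (d : nat).

Definition rV_coord : 'I_d -> 'rV[R]_d -> R := fun i x => x ord0 i.

Let rV_set0 : g_sigma_preimage rV_coord set0.
Proof. exact: sigma_algebra0. Qed.

Let rV_setC A : g_sigma_preimage rV_coord A ->
  g_sigma_preimage rV_coord (~` A).
Proof. exact: sigma_algebraC. Qed.

Let rV_bigcup (F : (set 'rV[R]_d)^nat) :
  (forall i, g_sigma_preimage rV_coord (F i)) ->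
  g_sigma_preimage rV_coord (\bigcup_i (F i)).
Proof. exact: sigma_algebra_bigcup. Qed.

HB.instance Definition _ := @isMeasurable.Build (rV_display default_measure_display)
  'rV[R]_d (g_sigma_preimage rV_coord) rV_set0 rV_setC rV_bigcup.

Lemma measurable_rV_coord (i : 'I_d) :
  measurable_fun [set: 'rV[R]_d] (fun x : 'rV[R]_d => x ord0 i).
Proof.
move=> _ Y mY; rewrite setTI; apply: sub_sigma_algebra => /=.
rewrite -bigcup_seq/=; exists i => /=; first by rewrite mem_index_enum.
by exists Y => //; rewrite setTI.
Qed.

Lemma measurable_fun_rV d0 (T : measurableType d0) (f : T -> 'rV[R]_d) :
  (forall i, measurable_fun [set: T] (fun x => f x ord0 i)) ->
  measurable_fun [set: T] f.
Proof.
move=> mf; apply: (@measurability _ _ _ _ _ _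
  (\big[setU/set0]_(i < d) preimage_set_system setT (rV_coord i) measurable)) => //.
move=> _ [B + <-].
rewrite -bigcup_seq => -[i _ [C mC <-]].
by rewrite !setTI -comp_preimage -[X in measurable X]setTI; exact: mf.
Qed.

End rV_measurable.

Section lebesgue_rV.
Context (R : realType).

Definition rV_cons d (p : R * 'rV[R]_d) : 'rV[R]_d.+1 :=
  \row_i (if unlift ord0 i is Some j then p.2 ord0 j else p.1).

Definition rV_uncons d (x : 'rV[R]_d.+1) : R * 'rV[R]_d :=
  (x ord0 ord0, \row_j x ord0 (lift ord0 j)).

Lemma rV_consK d : cancel (@rV_cons d) (@rV_uncons d).
Proof.
case=> t v; rewrite /rV_uncons /rV_cons mxE unlift_none /=; congr (_, _).
by apply/rowP => j; rewrite !mxE liftK.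
Qed.

Lemma rV_unconsK d : cancel (@rV_uncons d) (@rV_cons d).
Proof.
move=> x; apply/rowP => i; rewrite mxE.
by case: unliftP => [j ->|->] //=; rewrite mxE.
Qed.

Lemma measurable_rV_cons d : measurable_fun [set: R * 'rV[R]_d] (@rV_cons d).
Proof.
apply: measurable_fun_rV => i.
case: (unliftP ord0 i) => [j ->|->].
- under eq_fun do rewrite mxE liftK.
  apply: (measurableT_comp (measurable_rV_coord j)).
  exact: measurable_snd.
- under eq_fun do rewrite mxE unlift_none.
  exact: measurable_fst.
Qed.

Lemma measurable_rV_uncons d : measurable_fun [set: 'rV[R]_d.+1] (@rV_uncons d).
Proof.
apply: measurable_fun_pair; first exact: measurable_rV_coord.
apply: measurable_fun_rV => i; under eq_fun do rewrite mxE.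
exact: measurable_rV_coord.
Qed.

Section step.
Context (d : nat) (mu : {sigma_finite_measure set 'rV[R]_d -> \bar R}).
Local Notation leb := (@lebesgue_measure R).

Definition lebesgue_rV_step : set 'rV[R]_d.+1 -> \bar R :=
  pushforward (leb \x mu)%E (@rV_cons d).

Let step0 : lebesgue_rV_step set0 = 0%E.
Proof. by rewrite /lebesgue_rV_step /pushforward preimage_set0 measure0. Qed.

Let step_ge0 A : (0 <= lebesgue_rV_step A)%E.
Proof. by rewrite /lebesgue_rV_step /pushforward measure_ge0. Qed.

Let step_sigma_additive : semi_sigma_additive lebesgue_rV_step.
Proof.
move=> F mF tF mUF; rewrite /lebesgue_rV_step /pushforward preimage_bigcup.
have mpre A : measurable A -> measurable (@rV_cons d @^-1` A).
  by move=> mA; rewrite -[X in measurable X]setTI; exact: measurable_rV_cons.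
apply: measure_semi_sigma_additive.
- by move=> k; exact: mpre.
- apply/trivIsetP => /= i j _ _ ij; rewrite -preimage_setI.
  by move/trivIsetP : tF => /(_ _ _ _ _ ij) ->//; rewrite preimage_set0.
- by rewrite -preimage_bigcup; exact: mpre.
Qed.

HB.instance Definition _ := isMeasure.Build _ _ _ lebesgue_rV_step
  step0 step_ge0 step_sigma_additive.

Let step_sigma_finite : sigma_finite setT lebesgue_rV_step.
Proof.
have /sigma_finiteP[F [TF ndF Foo]] := sigma_finiteT leb.
have /sigma_finiteP[G [TG ndG Goo]] := sigma_finiteT mu.
exists (fun k => @rV_uncons d @^-1` (F k `*` G k)).
  apply/seteqP; split => // x _.
  have [k _ Fk] : (\bigcup_k F k) (rV_uncons x).1 by rewrite -TF.
  have [l _ Gl] : (\bigcup_k G k) (rV_uncons x).2 by rewrite -TG.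
  exists (maxn k l) => //; split.
  - by move: Fk; exact/subsetPset/ndF/leq_maxl.
  - by move: Gl; exact/subsetPset/ndG/leq_maxr.
move=> k; have [mF Fk] := Foo k; have [mG Gk] := Goo k; split.
  rewrite -[X in measurable X]setTI.
  by apply: measurable_rV_uncons => //; exact: measurableX.
rewrite /lebesgue_rV_step /pushforward -comp_preimage.
rewrite (_ : _ @^-1` (F k `*` G k) = F k `*` G k); last first.
  rewrite (_ : @rV_uncons d \o @rV_cons d = id) ?preimage_id//.
  by apply/funext => p; exact: rV_consK.
by rewrite product_measure1E// lte_mul_pinfty// ge0_fin_numE.
Qed.

HB.instance Definition _ := Measure_isSigmaFinite.Build _ _ _ lebesgue_rV_step
  step_sigma_finite.

End step.

Fixpoint lebesgue_rV d : {sigma_finite_measure set 'rV[R]_d -> \bar R} :=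
  if d is d'.+1 then lebesgue_rV_step (lebesgue_rV d') else \d_(0 : 'rV[R]_0).

Lemma lebesgue_rV_box d (B : 'I_d -> set (measurableTypeR R)) :
  (forall i, measurable (B i)) ->
  lebesgue_rV d [set x | forall i, B i (x ord0 i)] =
  (\prod_(i < d) @lebesgue_measure R (B i))%E.
Proof.
elim: d B => [|d IH] B mB /=.
  by rewrite big_ord0 diracE mem_set//= => -[].
rewrite big_ord_recl -IH//.
rewrite /lebesgue_rV_step /pushforward -product_measure1E//; last first.
  rewrite [X in measurable X](_ : _ =
      \bigcap_(i in [set: 'I_d]) [set x : 'rV[R]_d | B (lift ord0 i) (x ord0 i)]).
    apply: fin_bigcap_measurable => // i _.
    rewrite -[X in measurable X]setTI.
    by apply: (measurable_rV_coord i) => //; exact: mB.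
  by apply/seteqP; split => [x xB i _|x xB i] /=; [exact: xB|exact: (xB i I)].
congr (product_measure1 _ _ _); apply/seteqP; split => -[t v] /=.
  move=> tvB; split => [|i].
    by have := tvB ord0; rewrite /rV_cons mxE unlift_none.
  by have := tvB (lift ord0 i); rewrite /rV_cons mxE liftK.
move=> [tB vB] i; rewrite /rV_cons mxE.
by case: unliftP => [j ->|->].
Qed.

End lebesgue_rV.

Section calculus.
Context (R : realType) (d : nat).
Implicit Types (Om : set 'rV[R]_d) (u v w phi psi : 'rV[R]_d -> R).

Definition partial (i : 'I_d) phi : 'rV[R]_d -> R :=
  fun x => 'D_(delta_mx 0 i) phi x.

Fixpoint Ck (k : nat) phi : Prop :=
  continuous phi /\
  if k is k'.+1 then
    forall i : 'I_d,
      (forall x, derivable phi x (delta_mx 0 i)) /\ Ck k' (partial i phi)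
  else True.

Definition smooth phi := forall k, Ck k phi.

(* The elements of C_c^oo(Om) are extended by zero to the whole space. *)
Definition Cc_smooth Om phi :=
  [/\ smooth phi, compact (closure [set x | phi x != 0]) &
      closure [set x | phi x != 0] `<=` Om].

(* Elements of L^2 are plain functions: they are not identified up to null
   sets, see L2null. *)
Definition L2 Om u :=
  measurable_fun Om u /\
  (\int[lebesgue_rV R d]_(x in Om) ((u x) ^+ 2)%:E < +oo)%E.

Definition L2dot Om u v : R := \int[lebesgue_rV R d]_(x in Om) (u x * v x).

Definition L2null Om u :=
  {ae lebesgue_rV R d, forall x, Om x -> u x = 0}.

End calculus.

Section dirichlet.
Context (R : realType) (d p : nat).
Variables (X : 'I_p -> ('rV[R]_d -> R) -> 'rV[R]_d -> R) (Om : set 'rV[R]_d).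
Implicit Types (u v w phi psi : 'rV[R]_d -> R).

Definition energy phi psi : R :=
  2^-1 * \int[lebesgue_rV R d]_(x in Om) (\sum_(j < p) X j phi x * X j psi x).

(* phi k converges to u in L^2 and is Cauchy for the energy, so that u is in
   the domain of the closure of the form. *)
Definition form_approx u (phi : nat -> 'rV[R]_d -> R) : Prop :=
  [/\ forall k, Cc_smooth Om (phi k),
      L2dot Om (phi k \- u) (phi k \- u) @[k --> \oo] --> (0 : R) &
      forall eps : R, 0 < eps -> exists N : nat, forall k l : nat,
        (N <= k)%N -> (N <= l)%N ->
        energy (phi k \- phi l) (phi k \- phi l) < eps].

Definition form_dom u :=
  L2 Om u /\ exists phi : nat -> 'rV[R]_d -> R, form_approx u phi.

Definition closed_form u v (c : R) :=
  exists phi psi : nat -> 'rV[R]_d -> R,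
    [/\ form_approx u phi, form_approx v psi &
        energy (phi k) (psi k) @[k --> \oo] --> c].

(* The graph of the self-adjoint operator A associated with the closed form q:
   A u = w iff q(u, v) = <w, v> for all v in the domain of q. *)
Definition dirichlet_op u w :=
  [/\ form_dom u, L2 Om w &
      forall v, form_dom v -> closed_form u v (L2dot Om w v)].

Definition dirichlet_eigenvalue (lam : R) :=
  exists u, ~ L2null Om u /\ dirichlet_op u (lam \*o u).

(* A - lam has an everywhere defined bounded inverse; (A - lam) u = w is
   written A u = lam u + w. *)
Definition dirichlet_resolvent (lam : R) :=
  (forall w, L2 Om w -> exists u, dirichlet_op u (fun x => lam * u x + w x)) /\
  (exists C : R, forall u w, L2 Om w ->
     dirichlet_op u (fun x => lam * u x + w x) ->
     L2dot Om u u <= C * L2dot Om w w).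

Definition dirichlet_spectrum (lam : R) := ~ dirichlet_resolvent lam.

(* The lowest eigenvalue of an operator with discrete spectrum is the minimum
   of the spectrum. As A is self-adjoint, real spectral parameters suffice. *)
Definition is_lowest_dirichlet_eigenvalue (lam : R) :=
  dirichlet_eigenvalue lam /\ forall mu, dirichlet_spectrum mu -> lam <= mu.

End dirichlet.

Section euclidean.
Context (R : realType) (d : nat).

Definition enorm (x : 'rV[R]_d) : R := Num.sqrt (\sum_(i < d) x 0 i ^+ 2).

Definition euclidean_ball : set 'rV[R]_d := [set x | enorm x < 1].

End euclidean.

Section lie_algebra.
Context (R : realType) (g : vectType R).
Implicit Types (br : g -> g -> g) (ip : g -> g -> R) (z v : {vspace g}).

Record is_lie_bracket br : Prop := IsLieBracket {
  lie_linearl : forall y a x1 x2, br (a *: x1 + x2) y = a *: br x1 y + br x2 y;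
  lie_linearr : forall x a y1 y2, br x (a *: y1 + y2) = a *: br x y1 + br x y2;
  lie_alt : forall x, br x x = 0;
  lie_jacobi : forall x y w, br x (br y w) + br y (br w x) + br w (br x y) = 0
}.

Record is_inner_product ip : Prop := IsInnerProduct {
  ip_linearl : forall y a x1 x2, ip (a *: x1 + x2) y = a * ip x1 y + ip x2 y;
  ip_sym : forall x y, ip x y = ip y x;
  ip_posdef : forall x, x != 0 -> 0 < ip x x
}.

Definition is_center br z := forall x, x \in z <-> forall y, br x y = 0.

Definition is_orthogonal ip z v :=
  forall x, x \in v <-> forall y, y \in z -> ip x y = 0.

(* z is the center and v its orthogonal complement *)
Record is_H_type br ip z v : Prop := IsHType {
  H_lie : is_lie_bracket br;
  H_ip : is_inner_product ip;
  H_center : is_center br z;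
  H_orth : is_orthogonal ip z v;
  H_nontrivial : z != 0%VS;
  (* z is the smallest subspace containing all brackets from v *)
  H_bracket : forall W : {vspace g},
    (z <= W)%VS <-> forall x y, x \in v -> y \in v -> br x y \in W;
  H_orthogonal : forall w, w \in z -> ip w w = 1 ->
    exists J : g -> g,
      [/\ forall x, x \in v -> J x \in v,
          forall x y, x \in v -> y \in v -> ip (J x) y = ip w (br x y) &
          forall x y, x \in v -> y \in v -> ip (J x) (J y) = ip x y]
}.

Definition is_orthonormal_basis ip v k (e : k.-tuple g) :=
  basis_of v e /\
  forall i j : 'I_k, ip (tnth e i) (tnth e j) = (i == j)%:R.

(* The matrix of J_Z in an orthonormal basis e of the complement of the center:
   its (i, j) entry is <J_Z e_j, e_i> = <Z, [e_j, e_i]>. *)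
Definition J_mx br ip m (e : m.-tuple g) (Z : g) : 'M[R]_m :=
  \matrix_(i, j) ip Z (br (tnth e j) (tnth e i)).

End lie_algebra.

Section H_type_group.
Context (R : realType) (m n : nat) (U : 'I_n -> 'M[R]_m).
Implicit Types x y : 'rV[R]_(m + n).

(* Vectors are rows, so that <U x, y> is x *m U^T *m y^T. With U k = J_mx of the
   k-th vector of an orthonormal basis of the center, this is the group law
   x + y + [x, y] / 2 in exponential coordinates. *)
Definition H_mul x y : 'rV[R]_(m + n) :=
  row_mx (lsubmx x + lsubmx y)
    (\row_k (rsubmx x 0 k + rsubmx y 0 k +
       2^-1 * (lsubmx x *m (U k)^T *m (lsubmx y)^T) 0 0)).

(* The value at x of the left-invariant vector field equal to the j-th
   horizontal partial derivative at 0 is the derivative of phi along the left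
   translate by x of the curve t |-> t e_j. *)
Definition H_field (j : 'I_m) (phi : 'rV[R]_(m + n) -> R) : 'rV[R]_(m + n) -> R :=
  fun x => derive1 (fun t : R => phi (H_mul x (t *: row_mx (delta_mx 0 j) 0))) 0.

Definition H_norm x : R :=
  (enorm (lsubmx x) ^+ 4 + enorm (rsubmx x) ^+ 2) `^ 4^-1.

Definition H_ball : set 'rV[R]_(m + n) := [set x | H_norm x < 1].

End H_type_group.

Section bound.
Context (R : realType) (lm ln : R).

Definition gap_bound (x : R) : R :=
  lm / Num.sqrt (1 - x) + ln * Num.sqrt (1 - x) / (4 * x).

Definition gap_argmin : R :=
  (Num.sqrt (ln ^+ 2 + 32 * ln * lm) - 3 * ln) / (2 * (4 * lm - ln)).

End bound.

(* Main.v *)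
Require Import Defs.
From mathcomp Require Import all_boot all_order all_algebra.
From mathcomp Require Import all_classical all_reals all_analysis.
From mathcomp Require Import measurable_realfun ring lra.

Set Implicit Arguments.
Unset Strict Implicit.
Unset Printing Implicit Defensive.

Import Order.TTheory GRing.Theory Num.Theory.
Import numFieldNormedType.Exports.

Local Open Scope classical_set_scope.
Local Open Scope ring_scope.

(* Each lowest eigenvalue is the infimum of the Rayleigh quotient over test
   functions. If mu is that infimum and A - mu had a bounded inverse, solving
   (A - mu) v = phi for nearly minimizing phi would contradict the
   Cauchy-Schwarz inequality for the form q - mu, so mu is in the spectrum.
   The form is closable because the fields X_j are divergence free.

   Lower bound: for a test function phi on the ball of the group, let F(x) be
   the L^2 norm of phi(x, .). As phi d_z phi has zero integral over the fibers,
   |d_j F| <= |X_j phi(x, .)|, and F (regularized where it vanishes) is a test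
   function on the m-dimensional ball.

   Upper bound: for a^4 + b^2 = 1 the functions f(x / a) g(z / b) are test
   functions on the ball of the group. The cross terms of their energy integrate
   to zero and |sum_k c_k U_k x| = |c| |x|, so that near minimizers f and g give
   lambda_1 <= lambda^(m) / a^2 + a^2 lambda^(n) / (4 b^2).

   The minimizer of this bound lies in ]0, 1[ because
   0 < lambda^(n) <= lambda^(m): slicing the m-dimensional ball by n-dimensional
   balls is possible as the vectors U_k y are orthonormal for a unit y. *)

(** * Functions with continuous partial derivatives *)

(** Both halves of [is_lowest_dirichlet_eigenvalue] enter: minimality in the spectrum bounds the
    eigenvalue above by every Rayleigh quotient, and an eigenfunction, approximated in the form,
    bounds it below. A ground state is not a test function, so all comparisons run over arbitrary
    test functions or near minimizers, and an error is sent to zero at the end.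

    [Ck] controls derivatives along the coordinate axes only, whereas [H_field] differentiates along
    an oblique line; the chain rule for it has to come from the continuity of the partial
    derivatives.

    The supremum of the gauge over the product of balls of radii [a] and [b] is [a ^+ 4 + b ^+ 2],
    whence the constraint on the radii. With [b ^+ 2 = x] and [a ^+ 2 = Num.sqrt (1 - x)] the upper
    bound becomes [gap_bound] at [x]; its factor 4 is the square of the 2 in the group law. *)

Section Ck_calculus.
Context (R : realType).

(** Restriction to a line through [x] makes the one-variable chain rule and mean value theorem
    available for directional derivatives. *)
Lemma is_derive_lineE (V : normedModType R) (f : V -> R) x v df :
  is_derive x v f df <-> is_derive (0 : R) 1 (fun h => f (h *: v + x)) df.
Proof.
have E : 'D_v f x = 'D_1 (fun h : R => f (h *: v + x)) 0.
  rewrite /derive; set g1 := fun h => h^-1 *: _; set g2 := fun h => h^-1 *: _.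
  suff -> : g1 = g2 by [].
  by apply/funext => h; rewrite /g1 /g2 /= addr0 scale0r add0r [_%:A]mulr1.
split => -[d e]; apply: DeriveDef.
- exact: (derivable1P f x v).1.
- by rewrite -E.
- exact: (derivable1P f x v).2.
- by rewrite E.
Qed.

Lemma is_derive_comp1 (V : normedModType R) (g : R -> R) (f : V -> R) x v
    dg df :
  is_derive (f x) 1 g dg -> is_derive x v f df ->
  is_derive x v (g \o f) (df * dg).
Proof.
move=> dg' /is_derive_lineE df'; apply/is_derive_lineE.
rewrite mulrC.
have := @is_derive1_comp R g (fun h => f (h *: v + x)) 0 dg df _ df'.
by rewrite scale0r add0r; apply.
Qed.

Lemma is_derive_scaleb (V : normedModType R) (f : V -> R) x v df (c : R) :
  is_derive x v f df -> is_derive x (c *: v) f (c * df).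
Proof.
move=> /is_derive_lineE d; apply/is_derive_lineE.
rewrite mulrC.
have E : (fun h : R => f (h *: (c *: v) + x)) =
   (fun h : R => f (h *: v + x)) \o (fun h => h * c).
  by apply/funext => h /=; rewrite scalerA.
rewrite E.
have dc : is_derive (0 : R) 1 (fun h : R => h * c) c.
  have -> : (fun h : R => h * c) = c \*: (id : R -> R).
    by apply/funext => h; rewrite /= /GRing.scale /= mulrC.
  have := @is_deriveZ _ _ _ (id : R -> R) c 0 1 _ _.
  by move=> /(_ 1 (is_derive_id _ _)); rewrite /GRing.scale /= mulr1.
have := @is_derive1_comp R (fun h => f (h *: v + x)) (fun h => h * c) 0 df c _ dc.
by rewrite mul0r; apply.
Qed.

Lemma continuous_rV (T : topologicalType) d (f : T -> 'rV[R]_d) :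
  (forall i, continuous (fun x => f x 0 i)) -> continuous f.
Proof.
move=> cf x; apply/cvg_ballP => e e0.
have H i : \forall y \near x, ball (f x 0 i) e (f y 0 i).
  by have /cvg_ballP := cf i x; apply.
rewrite near_map; apply: filterS (filter_forall _ H) => y Hy.
by split => // j i; rewrite (ord1 j).
Qed.

Lemma continuous_rV_coord d (i : 'I_d) : continuous (fun x : 'rV[R]_d => x 0 i).
Proof. exact: coord_continuous. Qed.

Context (d : nat).
Implicit Types (phi psi : 'rV[R]_d -> R) (i : 'I_d).

Lemma Ck_continuous k phi : Ck k phi -> continuous phi.
Proof. by case: k => [|k] []. Qed.

Lemma CkW k phi : Ck k.+1 phi -> Ck k phi.
Proof.
elim: k phi => [|k IH] phi [c H]; first by split.
by split => // i; have [d1 d2] := H i; split => //; exact: IH.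
Qed.

Lemma Ck_derivable k phi i x : Ck k.+1 phi -> derivable phi x (delta_mx 0 i).
Proof. by case=> _ /(_ i)[]. Qed.

Lemma Ck_is_derive k phi i x : Ck k.+1 phi ->
  is_derive x (delta_mx 0 i) phi (partial i phi x).
Proof. by move=> C; exact/derivableP/(Ck_derivable (k := k)). Qed.

Lemma Ck_partial k phi i : Ck k.+1 phi -> Ck k (partial i phi).
Proof. by case=> _ /(_ i)[]. Qed.

Lemma CkS k phi (dphi : 'I_d -> 'rV[R]_d -> R) : continuous phi ->
  (forall i x, is_derive x (delta_mx 0 i) phi (dphi i x)) ->
  (forall i, Ck k (dphi i)) -> Ck k.+1 phi.
Proof.
move=> c D H; split => // i; split => [x|]; first by have [] := D i x.
rewrite (_ : partial i phi = dphi i)//; apply/funext => x.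
by have [] := D i x.
Qed.

Lemma partialE phi i (x : 'rV[R]_d) (a : R) :
  is_derive x (delta_mx 0 i) phi a -> partial i phi x = a.
Proof. by case. Qed.

Lemma Ck_cst k (c : R) : Ck k (fun=> c : R) (d := d).
Proof.
elim: k c => [|k IH] c; first by split => //; exact: cst_continuous.
apply: (@CkS _ _ (fun _ _ => 0)) => [|i]; [exact: cst_continuous|exact: IH].
Qed.

Lemma CkD k phi psi : Ck k phi -> Ck k psi -> Ck k (fun x => phi x + psi x).
Proof.
elim: k phi psi => [|k IH] phi psi C1 C2.
  by split => // x; apply: continuousD; exact: (Ck_continuous (k := 0)).
apply: (@CkS _ _ (fun i x => partial i phi x + partial i psi x)).
- by move=> x; apply: continuousD; exact: (Ck_continuous (k := k.+1)).
- by move=> i x; apply: is_deriveD; exact: (Ck_is_derive (k := k)).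
- by move=> i; apply: IH; exact: Ck_partial.
Qed.

Lemma CkM k phi psi : Ck k phi -> Ck k psi -> Ck k (fun x => phi x * psi x).
Proof.
elim: k phi psi => [|k IH] phi psi C1 C2.
  by split => // x; apply: continuousM; exact: (Ck_continuous (k := 0)).
apply: (@CkS _ _ (fun i x => phi x * partial i psi x + psi x * partial i phi x)).
- by move=> x; apply: continuousM; exact: (Ck_continuous (k := k.+1)).
- by move=> i x; apply: is_deriveM; exact: (Ck_is_derive (k := k)).
- move=> i; apply: CkD; apply: IH; try exact: CkW; exact: Ck_partial.
Qed.

Lemma CkZ k (c : R) phi : Ck k phi -> Ck k (fun x => c * phi x).
Proof. by move=> C; apply: CkM => //; exact: Ck_cst. Qed.

Lemma Ck_sum k (I : Type) (s : seq I) (F : I -> 'rV[R]_d -> R) :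
  (forall j, Ck k (F j)) -> Ck k (fun x => \sum_(j <- s) F j x).
Proof.
move=> C; elim: s => [|j s IH].
  by under eq_fun do rewrite big_nil; exact: Ck_cst.
by under eq_fun do rewrite big_cons; exact: CkD.
Qed.

Lemma CkV k phi : (forall x, phi x != 0) -> Ck k phi ->
  Ck k (fun x => (phi x)^-1).
Proof.
move=> p0; elim: k => [|k IH] C.
  by split => // x; apply: continuousV => //; exact: (Ck_continuous C).
have Ck' := CkW C.
apply: (@CkS _ _ (fun i x => (-1) *  ((phi x)^-1 * (phi x)^-1 * partial i phi x))).
- by move=> x; apply: continuousV => //; exact: (Ck_continuous C).
- move=> i x; have D := @Ck_derivable k phi i x C.
  apply: DeriveDef; first exact: derivableV.
  rewrite deriveV//.
  by rewrite /GRing.scale /= -exprVn expr2 mulN1r mulNr.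
- move=> i; apply: CkZ; apply: CkM; last exact: Ck_partial.
  by apply: CkM; exact: IH.
Qed.

(** Strict positivity keeps the argument away from the singularity of the root at 0; the regularized
    fibre norm of the lower bound is built to satisfy it. *)
Lemma Ck_sqrt k phi : (forall x, 0 < phi x) -> Ck k phi ->
  Ck k (fun x => Num.sqrt (phi x)).
Proof.
move=> p0; elim: k => [|k IH] C.
  split => // x; apply: continuous_comp; last exact: sqrt_continuous.
  exact: (Ck_continuous C).
apply: (@CkS _ _ (fun i x => partial i phi x * (2 * Num.sqrt (phi x))^-1)).
- move=> x; apply: continuous_comp; last exact: sqrt_continuous.
  exact: (Ck_continuous C).
- move=> i x; apply: (@is_derive_comp1 _ Num.sqrt) => //.
    exact: is_derive1_sqrt.
  exact: (@Ck_is_derive k).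
- move=> i; apply: CkM; first exact: Ck_partial.
  apply: CkV; last by apply/CkZ/IH/CkW.
  by move=> x; rewrite mulf_neq0// gt_eqF// sqrtr_gt0.
Qed.

Lemma is_derive_coord (j : 'I_d) (x v : 'rV[R]_d) :
  is_derive x v (fun y : 'rV[R]_d => y 0 j) (v 0 j).
Proof.
apply/is_derive_lineE.
have -> : (fun h : R => (h *: v + x) 0 j) = (v 0 j \*: (id : R -> R)) + cst (x 0 j).
  by apply/funext => h; rewrite /= !mxE /GRing.scale /= mulrC.
apply: (is_derive_eq (is_deriveD _ _)).
by rewrite addr0 /GRing.scale /= mulr1.
Qed.

Lemma Ck_coord k (j : 'I_d) : Ck k (fun x : 'rV[R]_d => x 0 j).
Proof.
case: k => [|k]; first by split => //; exact: continuous_rV_coord.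
apply: (@CkS _ _ (fun i x => (delta_mx 0 i : 'rV[R]_d) 0 j)).
- exact: continuous_rV_coord.
- by move=> i x; exact: is_derive_coord.
- by move=> i; exact: Ck_cst.
Qed.

End Ck_calculus.

(** * Composition with affine maps that respect the coordinate axes *)

Section Ck_affine.
Context (R : realType) (p q : nat) (L : 'rV[R]_p -> 'rV[R]_q).
Context (c : 'I_p -> R) (s : 'I_p -> 'I_q).
Hypothesis cL : continuous L.
(** [L] is affine and sends the axis [i] to [c i] times the axis [s i]. This covers slices,
    dilations and, with [c i = 0] on the forgotten axes, projections. *)
Hypothesis LE : forall i x (h : R),
  L (h *: delta_mx 0 i + x) = h *: (c i *: delta_mx 0 (s i)) + L x.

Lemma is_derive_affine k phi i x : Ck k.+1 phi ->
  is_derive x (delta_mx 0 i) (phi \o L) (c i * partial (s i) phi (L x)).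
Proof.
move=> C; apply/is_derive_lineE.
under eq_fun do rewrite /= LE.
have D := is_derive_scaleb (c i) (@Ck_is_derive _ _ k phi (s i) (L x) C).
by move/is_derive_lineE: D.
Qed.

Lemma Ck_affine k phi : Ck k phi -> Ck k (phi \o L).
Proof.
elim: k phi => [|k IH] phi C.
  split => // x; apply: continuous_comp; first exact: cL.
  exact: (Ck_continuous C).
apply: (@CkS _ _ _ _ (fun i x => c i * partial (s i) phi (L x))).
- move=> x; apply: continuous_comp; first exact: cL.
  exact: (Ck_continuous C).
- by move=> i x; exact: (is_derive_affine (k := k)).
- by move=> i; apply/CkZ/(IH (partial (s i) phi)); exact: Ck_partial.
Qed.

End Ck_affine.

(** * Directional derivatives of continuously differentiable functions *)

Section C1_chain_rule.
Context (R : realType) (d : nat).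
Implicit Types (phi : 'rV[R]_d -> R).

Lemma is_derive_cvg (V : normedModType R) (f : V -> R) x v a :
  is_derive x v f a <->
  h^-1 *: (f (h *: v + x) - f x) @[h --> (0:R)^'] --> a.
Proof.
split => [[dx <-]|H]; first exact: dx.
by apply: DeriveDef; [apply/cvg_ex; exists a|exact/cvg_lim].
Qed.

Lemma MVT_line (V : normedModType R) (f : V -> R) (u y : V) (Du : V -> R) h :
  (forall z, is_derive z u f (Du z)) ->
  exists2 s, `|s| <= `|h| & f (h *: u + y) - f y = Du (s *: u + y) * h.
Proof.
move=> dU; pose g s := f (s *: u + y).
have dg s : is_derive (s : R) (1 : R) g (Du (s *: u + y)).
  apply/is_derive_lineE.
  have -> : (fun h : R => g (h *: (1 : R) + s)) = (fun h => f (h *: u + (s *: u + y))).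
    by apply/funext => t; rewrite /g addrA -scalerDl [_ *: 1]mulr1.
  by have /is_derive_lineE := dU (s *: u + y).
have cg a b : {within `[a, b], continuous g}.
  apply: continuous_subspaceT => s.
  apply/differentiable_continuous/derivable1_diffP.
  by have [] := dg s.
have g0 : g 0 = f y by rewrite /g scale0r add0r.
have [h0|h0] := leP 0 h.
  have [s + E] := MVT_segment h0 (fun s _ => dg s) (cg _ _).
  rewrite in_itv /= => /andP[s0 sh]; exists s; first by rewrite !ger0_norm.
  by rewrite -g0 -[f _]/(g h) E subr0.
have [s + E] := MVT_segment (ltW h0) (fun s _ => dg s) (cg _ _).
rewrite in_itv /= => /andP[s0 sh]; exists s; first by rewrite !ler0_norm ?lerN2// ltW.
by rewrite -g0 -[f _]/(g h) -opprB E sub0r mulrN opprK.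
Qed.

(* Along a direction with continuous derivative, the mean value theorem allows
   the base point to move while the difference quotient is formed. *)
Lemma is_derive_add_continuous phi (u w : 'rV[R]_d) (Du : 'rV[R]_d -> R) x a :
  (forall y, is_derive y u phi (Du y)) -> {for x, continuous Du} ->
  is_derive x w phi a -> is_derive x (u + w) phi (Du x + a).
Proof.
move=> dU cU /is_derive_cvg dW; apply/is_derive_cvg.
have -> : (fun h : R => h^-1 *: (phi (h *: (u + w) + x) - phi x)) =
    (fun h => h^-1 *: (phi (h *: u + (h *: w + x)) - phi (h *: w + x))) +
    (fun h => h^-1 *: (phi (h *: w + x) - phi x)).
  by apply/funext => h /=; rewrite -[RHS]scalerDr; congr (_ *: _); rewrite scalerDr -addrA; ring.
apply: cvgD; last exact: dW.
pose m (q : R * R) := q.1 *: u + (q.2 *: w + x).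
have cm : {for (0, 0), continuous m}.
  apply: continuousD; first by apply: cvgZr_tmp; exact: cvg_fst.
  apply: continuousD; last exact: cvg_cst.
  by apply: cvgZr_tmp; exact: cvg_snd.
have m0 : m (0, 0) = x by rewrite /m /= !scale0r !add0r.
have cDm : {for (0, 0), continuous (Du \o m)}.
  apply: continuous_comp => //.
  by rewrite m0.
apply/cvgrPdist_lt => e e0.
have : \forall q \near (0 : R, 0 : R), `|Du x - Du (m q)| < e.
  by move/cvgrPdist_lt : cDm => /(_ e e0); rewrite [(Du \o m) _]/= m0.
move=> /nbhs_ballP[del /= del0 H].
near=> h.
have h0 : h != 0 by near: h; exact: nbhs_dnbhs_neq.
have [s sh E] := MVT_line (h *: w + x) h dU.
have h_del : `|h| < del by near: h; exact: dnbhs0_lt.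
rewrite E [_ *: _]mulrC mulfK//; apply: (H (s, h)).
split; rewrite /ball /= sub0r normrN //.
exact: le_lt_trans h_del.
Unshelve. all: by end_near. Qed.

(** The coordinate directions are added one at a time, each with a continuous partial derivative.
    This is what makes [H_field] a first-order operator in the partial derivatives. *)
Lemma is_derive_direction phi (v x : 'rV[R]_d) : Ck 1 phi ->
  is_derive x v phi (\sum_i v 0 i * partial i phi x).
Proof.
move=> C; rewrite [X in is_derive _ X](row_sum_delta v).
elim: (index_enum _) => [|i s IH]; first by rewrite !big_nil; exact: is_derive0.
rewrite !big_cons.
apply: (@is_derive_add_continuous _ _ _ (fun y => v 0 i * partial i phi y)) => //.
- by move=> y; exact: is_derive_scaleb (Ck_is_derive i y C).
- by apply: (Ck_continuous (k := 0)); exact/CkZ/Ck_partial.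
Qed.

End C1_chain_rule.
(** * Integrals of compactly supported continuous functions *)

Section measurable_continuous.
Context (R : realType) (d : nat).

Lemma mx_norm_lt (x : 'rV[R]_d) e : 0 < e -> (forall i, `|x 0 i| < e) -> `|x| < e.
Proof.
move=> e0 H; rewrite [`|x|]mx_normrE; apply/bigmax_ltP => /=; split => //.
by move=> [i j] _ /=; rewrite (ord1 i).
Qed.

Lemma measurable_rV_preimage i (B : set R) : measurable B ->
  measurable [set x : 'rV[R]_d | B (x 0 i)].
Proof.
move=> mB; rewrite -[X in measurable X]setTI.
exact: (measurable_rV_coord i measurableT mB).
Qed.

(** The sigma-algebra is generated by the coordinates, so open sets have to be recovered from it: an
    open set is the countable union of the boxes with rational centre and radius that it
    contains. *)
Lemma open_measurable_rV (U : set 'rV[R]_d) : open U -> measurable U.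
Proof.
move=> oU.
pose box (q : 'rV[rat]_d * rat) : set 'rV[R]_d :=
  [set x | forall i, ratr (q.1 0 i) - ratr q.2 < x 0 i < ratr (q.1 0 i) + ratr q.2].
have mbox q : measurable (box q).
  rewrite [X in measurable X](_ : _ = \bigcap_(i in [set: 'I_d])
     [set x : 'rV[R]_d | x 0 i \in `]ratr (q.1 0 i) - ratr q.2, ratr (q.1 0 i) + ratr q.2[]).
    apply: fin_bigcap_measurable => // i _.
    by apply: (@measurable_rV_preimage i `]_, _[%classic); exact: measurable_itv.
  apply/seteqP; split => x H i.
    by move=> _; have := H i; rewrite /= in_itv.
  by have := H i I; rewrite /= in_itv.
pose F q := if `[< box q `<=` U >] then box q else set0.
suff -> : U = \bigcup_q F q.
  apply: countable_bigcupT_measurable => [|q]; first exact: countableP.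
  by rewrite /F; case: ifP.
apply/seteqP; split => [x Ux|x [q _]]; last first.
  by rewrite /F; case: ifPn => // /asboolP; apply.
have /nbhs_ballP[e /= e0 eU] : nbhs x U by exact: open_nbhs_nbhs.
(* A rational radius [r < e / 2] and a rational centre within [r] of [x]: the box contains [x], and
   its points are at distance less than [2 * r < e] from [x]. *)
have e20 : 0 < e / 2 by rewrite divr_gt0.
have [r /andP[]] := rat_in_itvoo e20; rewrite !bnd_simp => r0 re.
have exq i : exists q : rat, ratr q \in `](x 0 i - ratr r), (x 0 i + ratr r)[.
  by apply: rat_in_itvoo; rewrite ltrD2l gtrN.
pose q : 'rV[rat]_d := \row_i xchoose (exq i).
have qP i : x 0 i - ratr r < ratr (q 0 i) < x 0 i + ratr r.
  by rewrite mxE; have := xchooseP (exq i); rewrite in_itv.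
exists (q, r) => //; rewrite /F ifT.
  move=> i /=; have /andP[h1 h2] := qP i.
  by rewrite ltrBlDr h2/= -ltrBlDr.
apply/asboolP => y yq; apply: eU; rewrite -ball_normE /=.
apply: mx_norm_lt => // i; rewrite !mxE.
have /andP[h1 h2] := qP i; have /andP[h3 h4] := yq i.
rewrite /= in h3 h4.
by rewrite ltr_norml; apply/andP; split; lra.
Qed.

Lemma continuous_measurable_rV (h : 'rV[R]_d -> R) :
  continuous h -> measurable_fun setT h.
Proof.
move=> /continuousP cf; apply: (measurability _ (RGenOpens.measurableE R)).
move=> _ [_ [a [b ->] <-]]; rewrite setTI; apply: open_measurable_rV.
exact/cf/interval_open.
Qed.

End measurable_continuous.

Definition rV_box (R : realType) d (M : R) : set 'rV[R]_d :=
  [set x | forall i, `|x 0 i| <= M].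
Arguments rV_box {R} d M _.

Section compactly_supported_continuous.
Context (R : realType).
Local Notation leb := (lebesgue_rV R).

(** Compact support is expressed by a bound on the coordinates, which slices, fibre integrals and
    dilations inherit at once. *)
Definition Cc d (h : 'rV[R]_d -> R) :=
  continuous h /\ exists M, forall x, h x != 0 -> forall i, `|x 0 i| <= M.

Lemma rV_boxE d (M : R) : rV_box d M = [set x | forall i, `[-M, M]%classic (x 0 i)].
Proof.
by apply/seteqP; split => x H i; have := H i; rewrite /= in_itv /= -ler_norml.
Qed.

Lemma compact_rV_box d (M : R) : compact (rV_box d M).
Proof.
rewrite rV_boxE; apply: (@rV_compact R d (fun=> `[-M, M]%classic)) => i.
exact: segment_compact.
Qed.

Lemma measurable_rV_box d (M : R) : measurable (rV_box d M).
Proof.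
rewrite rV_boxE [X in measurable X](_ : _ = \bigcap_(i in [set: 'I_d])
     [set x : 'rV[R]_d | x 0 i \in `[-M, M]]).
  apply: fin_bigcap_measurable => // i _.
  by apply: (@measurable_rV_preimage _ _ i `[_, _]%classic); exact: measurable_itv.
by apply/seteqP; split => x /= H i; [move=> _|]; exact: H.
Qed.

Lemma rV_box_lty d (M : R) : (leb d (rV_box d M) < +oo)%E.
Proof.
rewrite rV_boxE (@lebesgue_rV_box _ _ (fun=> `[-M, M]%classic))//.
have /fin_numPlt/andP[] // :
  (\prod_(i < d) @lebesgue_measure R `[(- M)%R, M]%classic \is a fin_num)%E.
by apply: (big_ind (fun x : \bar R => x \is a fin_num)) => [//|x y|i _]; [exact: fin_numM|
  rewrite lebesgue_measure_itv/=; case: ifP].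
Qed.

Lemma continuous_box_bounded d (h : 'rV[R]_d -> R) M : continuous h ->
  exists2 B, 0 <= B & forall x, rV_box d M x -> `|h x| <= B.
Proof.
move=> ch.
have [E|/set0P[x0 Kx0]] := eqVneq (rV_box d M) set0.
  by exists 0 => // x; rewrite E.
have cN : {within rV_box d M, continuous (fun x => `|h x|)}.
  apply: continuous_subspaceT => x; apply: continuous_comp; first exact: ch.
  exact: norm_continuous.
have [|c _ H] := compact_EVT_max _ (@compact_rV_box d M) cN; first by exists x0.
by exists `|h c| => // x xK; apply: H; rewrite inE.
Qed.

Lemma Cc_integrable d (h : 'rV[R]_d -> R) : Cc h ->
  (leb d).-integrable setT (EFin \o h).
Proof.
move=> [ch [M HM]].
have -> : EFin \o h = (EFin \o h) \_ (rV_box d M).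
  apply/funext => x; rewrite patchE; case: ifPn => // xK.
  rewrite /=; have [->//|hx] := eqVneq (h x) 0.
  by move: xK; rewrite notin_setE; have := HM x hx.
apply: (integrable_mkcond _ (@measurable_rV_box d M)).1.
apply: measurable_bounded_integrable.
- exact: measurable_rV_box.
- exact: rV_box_lty.
- by apply: measurable_funTS; exact: continuous_measurable_rV.
- have [B B0 HB] := continuous_box_bounded M ch.
  exists B; split; first exact: num_real.
  move=> N BN x xK /=.
  by apply: le_trans (ltW BN); exact: HB.
Qed.

Definition rVint d (h : 'rV[R]_d -> R) : R := \int[leb d]_x h x.

Lemma Cc_continuous d (h : 'rV[R]_d -> R) : Cc h -> continuous h.
Proof. by case. Qed.

Lemma CcD d (g h : 'rV[R]_d -> R) : Cc g -> Cc h -> Cc (fun x => g x + h x).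
Proof.
move=> [cg [M HM]] [ch [N HN]]; split.
  by move=> x; apply: continuousD; [exact: cg|exact: ch].
exists (Num.max M N) => x ghx i; rewrite le_max.
have [g0|/HM ->//] := eqVneq (g x) 0.
by rewrite HN ?orbT//; move: ghx; rewrite g0 add0r.
Qed.

Lemma CcMl d (g h : 'rV[R]_d -> R) : continuous g -> Cc h -> Cc (fun x => g x * h x).
Proof.
move=> cg [ch [N HN]]; split.
  by move=> x; apply: continuousM; [exact: cg|exact: ch].
by exists N => x; rewrite mulf_eq0 negb_or => /andP[_ /HN].
Qed.

Lemma CcMr d (g h : 'rV[R]_d -> R) : Cc g -> continuous h -> Cc (fun x => g x * h x).
Proof.
by move=> Cg ch; under eq_fun do rewrite mulrC; exact: CcMl.
Qed.

Lemma CcZ d (c : R) (h : 'rV[R]_d -> R) : Cc h -> Cc (fun x => c * h x).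
Proof. by move=> Ch; apply: CcMl => //; exact: cst_continuous. Qed.

Lemma CcM d (g h : 'rV[R]_d -> R) : Cc g -> Cc h -> Cc (fun x => g x * h x).
Proof. by move=> /Cc_continuous; exact: CcMl. Qed.

Lemma CcX2 d (h : 'rV[R]_d -> R) : Cc h -> Cc (fun x => h x ^+ 2).
Proof. by move=> Ch; under eq_fun do rewrite expr2; exact: CcM. Qed.

Lemma Cc_sum d (I : Type) (s : seq I) (F : I -> 'rV[R]_d -> R) :
  (forall j, Cc (F j)) -> Cc (fun x => \sum_(j <- s) F j x).
Proof.
move=> C; elim: s => [|j s IH].
  under eq_fun do rewrite big_nil; split; first exact: cst_continuous.
  by exists 0 => x; rewrite eqxx.
by under eq_fun do rewrite big_cons; exact: CcD.
Qed.

Lemma rVintD d (g h : 'rV[R]_d -> R) : Cc g -> Cc h ->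
  rVint (fun x => g x + h x) = rVint g + rVint h.
Proof. by move=> /Cc_integrable ig /Cc_integrable ih; exact: RintegralD. Qed.

Lemma rVintZ d (c : R) (h : 'rV[R]_d -> R) : Cc h ->
  rVint (fun x => c * h x) = c * rVint h.
Proof. by move=> /Cc_integrable ih; exact: RintegralZl. Qed.

Lemma rVint0 d : rVint (fun _ : 'rV[R]_d => 0) = 0.
Proof. by rewrite /rVint /Rintegral integral0. Qed.

Lemma rVint_sum d (I : Type) (s : seq I) (F : I -> 'rV[R]_d -> R) :
  (forall j, Cc (F j)) ->
  rVint (fun x => \sum_(j <- s) F j x) = \sum_(j <- s) rVint (F j).
Proof.
move=> C; elim: s => [|j s IH].
  by rewrite big_nil -[RHS](rVint0 d); under eq_fun do rewrite big_nil.
rewrite big_cons -IH -rVintD//; last exact: Cc_sum.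
by under eq_fun do rewrite big_cons.
Qed.

Lemma rVint_ge0 d (h : 'rV[R]_d -> R) : (forall x, 0 <= h x) -> 0 <= rVint h.
Proof. by move=> h0; apply: Rintegral_ge0 => x _. Qed.

Lemma le_rVint d (g h : 'rV[R]_d -> R) : Cc g -> Cc h ->
  (forall x, g x <= h x) -> rVint g <= rVint h.
Proof.
by move=> /Cc_integrable ig /Cc_integrable ih gh; apply: le_Rintegral => // x _.
Qed.

Lemma eq_rVint d (g h : 'rV[R]_d -> R) : g =1 h -> rVint g = rVint h.
Proof. by move=> /funext ->. Qed.

Lemma rV_cons_continuousr d t : continuous (fun v : 'rV[R]_d => rV_cons (t, v)).
Proof.
apply: continuous_rV => i; case: (unliftP ord0 i) => [j ->|->].
  by under eq_fun do rewrite mxE liftK; exact: continuous_rV_coord.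
by under eq_fun do rewrite mxE unlift_none; exact: cst_continuous.
Qed.

Lemma rV_cons_continuousl d (v : 'rV[R]_d) : continuous (fun t : R => rV_cons (t, v)).
Proof.
apply: continuous_rV => i; case: (unliftP ord0 i) => [j ->|->].
  by under eq_fun do rewrite mxE liftK; exact: cst_continuous.
by under eq_fun do rewrite mxE unlift_none; move=> t; exact: cvg_id.
Qed.

Lemma Cc_cons d (h : 'rV[R]_d.+1 -> R) t : Cc h -> Cc (fun v => h (rV_cons (t, v))).
Proof.
move=> [ch [M HM]]; split.
  by move=> v; apply: continuous_comp; [exact: rV_cons_continuousr|exact: ch].
exists M => v /HM H i; have := H (lift ord0 i).
by rewrite mxE liftK.
Qed.

Lemma Cc_line_integrable (f : R -> R) M : continuous f ->
  (forall t, f t != 0 -> `|t| <= M) ->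
  lebesgue_measure.-integrable setT (EFin \o f).
Proof.
move=> cf HM.
have -> : EFin \o f = (EFin \o f) \_ `[-M, M].
  apply/funext => x; rewrite patchE; case: ifPn => // xK.
  rewrite /=; have [->//|hx] := eqVneq (f x) 0.
  move: xK; rewrite notin_setE /= in_itv /= -ler_norml => xK.
  by have := HM x hx.
have : lebesgue_measure.-integrable `[-M, M] (EFin \o f).
  apply: continuous_compact_integrable; first exact: segment_compact.
  exact: continuous_subspaceT.
by move/integrable_mkcond; apply.
Qed.

(** The fundamental theorem of calculus on an interval at whose ends [F] vanishes. *)
Lemma Rintegral_derive0 (F f : R -> R) M : continuous f ->
  (forall t : R, is_derive t (1 : R) F (f t)) -> (forall t, F t != 0 -> `|t| <= M) ->
  \int[lebesgue_measure]_t f t = 0.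
Proof.
move=> cf dF HM.
have cF : continuous F.
  move=> t; apply/differentiable_continuous/derivable1_diffP.
  by have [] := dF t.
(* [M] may be negative, hence the absolute value; the margin 1 makes [F] vanish at [N] and [- N]
   too. *)
pose N := `|M| + 1.
have FN t : N <= `|t| -> F t = 0.
  move=> Nt; apply/eqP; apply: contraTT (Nt) => /HM tM.
  rewrite -ltNge; apply: le_lt_trans tM _.
  by apply: le_lt_trans (ler_norm _) _; rewrite ltrDl.
have N0 : 0 < N by rewrite ltr_pwDr.
have fN t : N < `|t| -> f t = 0.
  move=> Nt; have [d <-] := dF t.
  have : \forall s \near t, F s = cst 0 s.
    have : \forall s \near t, N < `|s|.
      have /cvgr_gt := @norm_continuous R R t; exact.
    by apply: filterS => s /ltW /FN.
  by move=> /near_eq_derive -> //; rewrite derive_cst.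
rewrite (_ : \int[_]_t _ = \int[lebesgue_measure]_(t in `[-N, N]) f t).
  rewrite /Rintegral (@continuous_FTC2 _ f F).
  - have NN : N <= `|N| by rewrite ger0_norm// ltW.
    by rewrite (FN _ NN) (FN (- N)) ?normrN//= subrr.
  - by rewrite gtrN.
  - exact: continuous_subspaceT.
  - split => [t _||]; first by have [] := dF t.
    + exact/cvg_at_right_filter/cF.
    + exact/cvg_at_left_filter/cF.
  - by move=> t _; rewrite derive1E; have [] := dF t.
rewrite [RHS]Rintegral_mkcond; apply: eq_Rintegral => t _.
rewrite patchE; case: ifPn => //.
by rewrite notin_setE /= in_itv /= -ler_norml => /negP; rewrite -ltNge => /fN.
Qed.

(** * Fubini for the first coordinate, in both orders *)

Section fubini_cons.
Context (d : nat) (h : 'rV[R]_d.+1 -> R).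
Hypothesis Ch : Cc h.
Local Notation prodm := (@lebesgue_measure R \x leb d)%E.

Let mh : measurable_fun [set: 'rV[R]_d.+1] (EFin \o h).
Proof.
apply/measurable_EFinP; apply: continuous_measurable_rV.
exact: Cc_continuous Ch.
Qed.

(* The Borel structures of [R] and of [measurableTypeR R] are convertible but
   are not identified by unification. *)
Let mcons : measurable_fun [set: measurableTypeR R * 'rV[R]_d] (@rV_cons R d).
Proof. exact: measurable_rV_cons. Qed.

Let int_prod : prodm.-integrable setT (EFin \o h \o @rV_cons R d).
Proof.
apply/integrableP; split; first by apply: measurableT_comp => //; exact: measurable_rV_cons.
have /integrableP[_] := Cc_integrable Ch.
have E : (\int[pushforward prodm (@rV_cons R d)]_y (abse \o (EFin \o h)) y
    = \int[prodm]_x ((abse \o (EFin \o h)) \o @rV_cons R d) x)%E.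
  apply: ge0_integral_pushforward => //.
    exact: measurableT_comp.
  by move=> y _ /=.
by move=> hoo; exact: (eq_ind _ (fun z => (z < +oo)%E) hoo _ E).
Qed.

Let intE : (\int[leb d.+1]_x (h x)%:E = \int[prodm]_p (h (rV_cons p))%:E)%E.
Proof.
exact: (@integral_pushforward _ _ _ _ _ _ mcons prodm setT _ mh int_prod
  measurableT).
Qed.

Let intF t : (\int[leb d]_v (h (rV_cons (t, v)))%:E)%E =
  (rVint (fun v => h (rV_cons (t, v))))%:E.
Proof.
rewrite /rVint /Rintegral fineK//.
by apply: integrable_fin_num => //; exact/Cc_integrable/Cc_cons.
Qed.

Lemma rVint_cons : rVint h = \int[lebesgue_measure]_t rVint (fun v => h (rV_cons (t, v))).
Proof.
rewrite {1}/rVint /Rintegral intE -(integral12_prod_meas1 int_prod); congr fine.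
by apply: eq_integral => t _; rewrite /fubini_F /= intF.
Qed.

Lemma rVint_cons_swap : rVint h = rVint (fun v => \int[lebesgue_measure]_t h (rV_cons (t, v))).
Proof.
rewrite {1}/rVint /Rintegral intE -(integral21_prod_meas1 int_prod); congr fine.
apply: eq_integral => v _; rewrite /fubini_G /= /Rintegral fineK//.
have [ch [M HM]] := Ch.
apply: integrable_fin_num => //.
apply: (@Cc_line_integrable _ M) => [t|t /HM /(_ ord0)]; last by rewrite mxE unlift_none.
by apply: continuous_comp; [exact: rV_cons_continuousl|exact: ch].
Qed.

End fubini_cons.

End compactly_supported_continuous.

(** * Integrals of partial derivatives *)

Section integration_by_parts.
Context (R : realType).

Lemma partial_locally0 d (h : 'rV[R]_d -> R) i x :
  (\forall y \near x, h y = 0) -> partial i h x = 0.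
Proof.
move=> h0; rewrite /partial (_ : 'D__ h x = 'D_(delta_mx 0 i) (cst 0) x).
  by rewrite derive_cst.
exact: near_eq_derive.
Qed.

Lemma Cc_partial d (h : 'rV[R]_d -> R) i : Ck 1 h -> Cc h -> Cc (partial i h).
Proof.
move=> C1 [ch [M HM]]; split; first exact/(Ck_continuous (k := 0))/Ck_partial.
exists M => x + j; apply: contraNT; rewrite -ltNge => Mx.
apply/eqP; apply: partial_locally0.
have : \forall y \near x, M < `|(y : 'rV[R]_d) 0 j|.
  have c : {for x, continuous (fun y : 'rV[R]_d => `|y 0 j|)}.
    apply: continuous_comp; first exact: continuous_rV_coord.
    exact: norm_continuous.
  by have /cvgr_gt := c; apply.
apply: filterS => y My; apply/eqP; apply: contraTT My => /HM/(_ j).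
by rewrite leNgt.
Qed.

Lemma rV_cons_addl d (s t : R) (v : 'rV[R]_d) :
  s *: delta_mx 0 ord0 + rV_cons (t, v) = rV_cons (s + t, v).
Proof.
apply/rowP => i; rewrite !mxE; case: (unliftP ord0 i) => [j ->|->] /=.
  by rewrite mulr0 add0r.
by rewrite mulr1.
Qed.

Lemma rV_cons_addr d (s t : R) (v : 'rV[R]_d) j :
  rV_cons (t, s *: delta_mx 0 j + v) = s *: delta_mx 0 (lift ord0 j) + rV_cons (t, v).
Proof.
apply/rowP => i; rewrite !mxE; case: (unliftP ord0 i) => [k ->|->] /=.
  by rewrite !mxE /= (inj_eq lift_inj).
by rewrite mulr0 add0r.
Qed.

(** For the first coordinate, [rVint_cons_swap] puts the integral along the line inside, where the
    fundamental theorem applies; a later coordinate is treated by induction on the slices given by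
    [rVint_cons]. *)
Lemma rVint_partial0 d (h : 'rV[R]_d -> R) i : Ck 1 h -> Cc h ->
  rVint (partial i h) = 0.
Proof.
elim: d h i => [|d IH] h i C1 Ch; first by case: i.
have Cp := Cc_partial i C1 Ch.
case: (unliftP ord0 i) Cp => [j ->|->] Cp.
  rewrite rVint_cons// [LHS](_ : _ = \int[lebesgue_measure]_t (0 : R)); last first.
    apply: eq_Rintegral => t _.
    have LE (k : 'I_d) (x : 'rV[R]_d) (s : R) : rV_cons (t, s *: delta_mx 0 k + x) =
       s *: (1 *: delta_mx 0 (lift ord0 k)) + rV_cons (t, x).
      by rewrite scale1r rV_cons_addr.
    have := IH (fun v => h (rV_cons (t, v))) j
      (Ck_affine (@rV_cons_continuousr _ _ t) LE C1) (Cc_cons t Ch).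
    rewrite [X in rVint X](_ : _ = fun v => partial (lift ord0 j) h (rV_cons (t, v)))//.
    apply/funext => v; apply: partialE.
    have := is_derive_affine LE j v C1.
    by rewrite mul1r.
  by rewrite /Rintegral integral0_eq.
rewrite rVint_cons_swap// -[RHS](rVint0 R d); apply: eq_rVint => v.
have [ch [M HM]] := Ch.
apply: (@Rintegral_derive0 _ (fun t => h (rV_cons (t, v))) _ M).
- move=> t; apply: continuous_comp; first exact: rV_cons_continuousl.
  exact: (Cc_continuous Cp).
- move=> t; have := Ck_is_derive ord0 (rV_cons (t, v)) C1.
  move=> /is_derive_lineE D; apply/is_derive_lineE.
  rewrite [X in is_derive _ _ X](_ : _ = fun s => h (s *: delta_mx 0 ord0 + rV_cons (t, v)))//.
  by apply/funext => s; rewrite rV_cons_addl [_ *: 1]mulr1.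
- by move=> t /HM/(_ ord0); rewrite mxE unlift_none.
Qed.

End integration_by_parts.

(** * Integrals over the vertical fibres, as functions of the base point *)

Section parameter_integrals.
Context (R : realType).

Lemma rVint_bound d (u : 'rV[R]_d -> R) M e : Cc u ->
  (forall x, u x != 0 -> rV_box d M x) -> (forall x, `|u x| <= e) ->
  `|rVint u| <= e * fine (lebesgue_rV R d (rV_box d M)).
Proof.
move=> Cu uM ue; have iu := Cc_integrable Cu.
have mK := @measurable_rV_box R d M.
have iuK : (lebesgue_rV R d).-integrable (rV_box d M) (EFin \o u).
  exact: integrableS iu.
have -> : rVint u = \int[lebesgue_rV R d]_(x in rV_box d M) u x.
  rewrite [RHS]Rintegral_mkcond; apply: eq_Rintegral => x _.
  rewrite patchE; case: ifPn => //; rewrite notin_setE.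
  by have [//|/uM] := eqVneq (u x) 0.
apply: le_trans (le_normr_Rintegral mK iuK) _.
rewrite -Rintegral_cst//; apply: le_Rintegral => //.
  exact: integrable_norm.
apply: measurable_bounded_integrable => //; first exact: rV_box_lty.
by exists `|e|; split; [exact: num_real|move=> N eN x _ /=; exact: ltW].
Qed.

Context (m n : nat).
Implicit Types (h : 'rV[R]_(m + n) -> R) (x : 'rV[R]_m) (z : 'rV[R]_n).

Lemma row_mx_continuous (T : topologicalType) (f : T -> 'rV[R]_m) (g : T -> 'rV[R]_n) :
  continuous f -> continuous g -> continuous (fun t => row_mx (f t) (g t)).
Proof.
move=> cf cg; apply: continuous_rV => i.
case: (split_ordP i) => j ->.
  under eq_fun do rewrite row_mxEl.
  by move=> t; exact: (continuous_comp (cf t) (@continuous_rV_coord _ _ j (f t))).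
under eq_fun do rewrite row_mxEr.
by move=> t; exact: (continuous_comp (cg t) (@continuous_rV_coord _ _ j (g t))).
Qed.

Lemma row_mx_addl x z (s : R) i :
  row_mx (s *: delta_mx 0 i + x) z = s *: delta_mx 0 (lshift n i) + row_mx x z.
Proof.
apply/rowP => k; rewrite !mxE; case: split_ordP => j -> /=.
  by rewrite !mxE eq_shift.
by rewrite eq_shift mulr0 add0r.
Qed.

Lemma row_mx_addr x z (s : R) i :
  row_mx x (s *: delta_mx 0 i + z) = s *: delta_mx 0 (rshift m i) + row_mx x z.
Proof.
apply/rowP => k; rewrite !mxE; case: split_ordP => j -> /=.
  by rewrite eq_shift mulr0 add0r.
by rewrite !mxE eq_shift.
Qed.

Lemma Cc_row h x : Cc h -> Cc (fun z => h (row_mx x z)).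
Proof.
move=> [ch [M HM]]; split.
  move=> z; apply: continuous_comp; last exact: ch.
  by apply: row_mx_continuous => [|y]; [exact: cst_continuous|exact: cvg_id].
by exists M => z /HM H i; have := H (rshift m i); rewrite row_mxEr.
Qed.

Definition rVint_fiber h x := rVint (fun z => h (row_mx x z)).

(** Uniformity in [z] comes from the compactness of the box, as in the tube lemma. *)
Lemma near_fiber h M x e : continuous h -> 0 < e ->
  \forall y \near x, forall z, rV_box n M z ->
    `|h (row_mx y z) - h (row_mx x z)| < e.
Proof.
move=> ch e0.
have /compact_near_coveringP cK := @compact_rV_box R n M.
apply: (cK _ (nbhs x) (fun y z => `|h (row_mx y z) - h (row_mx x z)| < e)) => z _.
pose F (q : 'rV[R]_n * 'rV[R]_m) := `|h (row_mx q.2 q.1) - h (row_mx x q.1)|.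
have cF : continuous F.
  move=> q; apply: cvg_norm; apply: cvgB.
    apply: (continuous_comp (f := fun q => row_mx q.2 q.1)); last exact: ch.
    by apply: row_mx_continuous => p; [exact: cvg_snd|exact: cvg_fst].
  apply: (continuous_comp (f := fun q => row_mx x q.1)); last exact: ch.
  by apply: row_mx_continuous => [|p]; [exact: cst_continuous|exact: cvg_fst].
have := cF (z, x); rewrite /continuous_at {2}/F /= subrr normr0 => /cvgr_lt.
exact.
Qed.

Lemma continuous_rVint_fiber h : Cc h -> continuous (rVint_fiber h).
Proof.
move=> Ch x; have [ch [M HM]] := Ch.
apply/(@cvgrPdist_le _ _ _ (nbhs x) (nbhs_filter x)) => e e0.
set V := fine (lebesgue_rV R n (rV_box n M)).
have V0 : 0 <= V by rewrite fine_ge0.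
(* [V + 1] replaces [V] because the box may have measure zero. *)
have d0 : 0 < e / (V + 1) by rewrite divr_gt0// ltr_wpDl.
have := near_fiber M x ch d0; apply: filterS => y Hy.
have -> : rVint_fiber h x - rVint_fiber h y =
    rVint (fun z => h (row_mx x z) + (-1) * h (row_mx y z)).
  by rewrite rVintD ?rVintZ ?mulN1r//; [exact: Cc_row|exact: Cc_row|exact/CcZ/Cc_row].
apply: (@le_trans _ _ (e / (V + 1) * V)); last first.
  by rewrite mulrAC ler_pdivrMr ?ltr_wpDl// ler_pM2l// lerDl.
apply: rVint_bound; first by apply: CcD; [exact: Cc_row|exact/CcZ/Cc_row].
  move=> z; rewrite mulN1r subr_eq0 => xy i.
  have [hx|/HM/(_ (rshift m i))] := eqVneq (h (row_mx x z)) 0; last by rewrite row_mxEr.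
  have [hy|/HM/(_ (rshift m i))] := eqVneq (h (row_mx y z)) 0; last by rewrite row_mxEr.
  by move: xy; rewrite hx hy eqxx.
move=> z; rewrite mulN1r distrC.
have [zK|zK] := pselect (rV_box n M z); first exact/ltW/Hy.
have z0 y' : h (row_mx y' z) = 0.
  apply/eqP; apply: contra_notT zK => /HM H i.
  by have := H (rshift m i); rewrite row_mxEr.
by rewrite !z0 subrr normr0 ltW.
Qed.

Lemma Cc_rVint_fiber h : Cc h -> Cc (rVint_fiber h).
Proof.
move=> Ch; split; first exact: continuous_rVint_fiber.
have [ch [M HM]] := Ch; exists M => x + i; apply: contraNT.
rewrite -ltNge => Mx; rewrite /rVint_fiber (_ : (fun z => _) = fun=> 0) ?rVint0//.
apply/funext => z; apply/eqP; apply: contraTT Mx => /HM/(_ (lshift n i)).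
by rewrite row_mxEl leNgt.
Qed.

(** Differentiation under the integral sign: the mean value theorem turns the difference quotient
    into the partial derivative at a shifted point, and [near_fiber] controls the effect of the
    shift uniformly in [z]. *)
Lemma is_derive_rVint_fiber h x i : Ck 1 h -> Cc h ->
  is_derive x (delta_mx 0 i) (rVint_fiber h)
    (rVint_fiber (partial (lshift n i) h) x).
Proof.
move=> C1 Ch; apply/is_derive_cvg.
have Cp := Cc_partial (lshift n i) C1 Ch.
have [cp [M HM]] := Cp.
apply/cvgrPdist_le => e e0.
set V := fine (lebesgue_rV R n (rV_box n M)).
have V0 : 0 <= V by rewrite fine_ge0.
have d0 : 0 < e / (V + 1) by rewrite divr_gt0// ltr_wpDl.
have : \forall y \near (0 : R), forall z, rV_box n M z ->
    `|partial (lshift n i) h (row_mx (y *: delta_mx 0 i + x) z) -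
      partial (lshift n i) h (row_mx x z)| < e / (V + 1).
  have c : {for (0 : R), continuous (fun y : R => y *: (delta_mx 0 i : 'rV[R]_m) + x)}.
    apply: continuousD; last exact: cvg_cst.
    by apply: cvgZr_tmp; exact: cvg_id.
  have Hn := c _ (near_fiber M (0 *: delta_mx 0 i + x) cp d0).
  rewrite [0 *: _ + x](_ : _ = x) in Hn; last by rewrite scale0r add0r.
  exact: Hn.
move=> /nbhs_ballP[del /= del0 H].
near=> t.
have t0 : t != 0 by near: t; exact: nbhs_dnbhs_neq.
have t_del : `|t| < del by near: t; exact: dnbhs0_lt.
have Cr y := Cc_row y Ch.
have Cd := CcD (Cr (t *: delta_mx 0 i + x)) (CcZ (-1) (Cr x)).
have -> : rVint_fiber (partial (lshift n i) h) x -
    t^-1 *: (rVint_fiber h (t *: delta_mx 0 i + x) - rVint_fiber h x) =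
    rVint (fun z => partial (lshift n i) h (row_mx x z) +
       - t^-1 * (h (row_mx (t *: delta_mx 0 i + x) z) + (-1) * h (row_mx x z))).
  rewrite (rVintD (Cc_row x Cp) (CcZ _ Cd)) (rVintZ _ Cd).
  by rewrite (rVintD (Cr _) (CcZ _ (Cr _))) (rVintZ _ (Cr _)) mulN1r mulNr.
apply: (@le_trans _ _ (e / (V + 1) * V)); last first.
  by rewrite mulrAC ler_pdivrMr ?ltr_wpDl// ler_pM2l// lerDl.
have E z : exists2 s, `|s| <= `|t| &
    - t^-1 * (h (row_mx (t *: delta_mx 0 i + x) z) + (-1) * h (row_mx x z)) =
    - partial (lshift n i) h (row_mx (s *: delta_mx 0 i + x) z).
  have [s st Es] := MVT_line (row_mx x z) t (fun y => Ck_is_derive (lshift n i) y C1).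
  exists s => //; rewrite !row_mx_addl mulN1r Es mulNr mulrCA mulVf//.
  by rewrite mulr1.
have z0 z y : ~ rV_box n M z -> partial (lshift n i) h (row_mx y z) = 0.
  move=> zK; apply/eqP; apply: contra_notT zK => /HM Hz j.
  by have := Hz (rshift m j); rewrite row_mxEr.
apply: rVint_bound.
- exact: CcD (Cc_row x Cp) (CcZ _ Cd).
- move=> z; have [s _ ->] := E z; apply: contra_neqP => zK.
  by rewrite !z0// subrr.
- move=> z; have [s st ->] := E z; rewrite distrC.
  have [zK|zK] := pselect (rV_box n M z); last by rewrite !z0// subrr normr0 ltW.
  apply/ltW/(H s) => //.
  rewrite /ball /= sub0r normrN; exact: le_lt_trans t_del.
Unshelve. all: by end_near. Qed.

Lemma Ck_rVint_fiber k h : (forall k, Ck k h) -> Cc h -> Ck k (rVint_fiber h).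
Proof.
elim: k h => [|k IH] h Coo Ch; first by split => //; exact: continuous_rVint_fiber.
apply: CkS; first exact: continuous_rVint_fiber.
  by move=> i x; apply: is_derive_rVint_fiber.
move=> i; apply: IH; last exact: Cc_partial.
by move=> l; exact: Ck_partial.
Qed.

End parameter_integrals.

Lemma rV_cons_row (R : realType) m n t (x : 'rV[R]_m) (z : 'rV[R]_n) :
  rV_cons (t, row_mx x z) = row_mx (rV_cons (t, x)) z :> 'rV[R]_(m.+1 + n).
Proof.
apply/rowP => i; case: (@split_ordP m.+1 n i) => k ->.
  rewrite row_mxEl; case: (unliftP ord0 k) => [j ->|->].
    rewrite (_ : lshift n (lift ord0 j) = lift ord0 (lshift n j)); last exact/val_inj.
    by rewrite !mxE !liftK row_mxEl.
  rewrite (_ : lshift n ord0 = ord0); last exact/val_inj.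
  by rewrite !mxE !unlift_none.
rewrite row_mxEr (_ : rshift m.+1 k = lift ord0 (rshift m k)); last exact/val_inj.
by rewrite mxE liftK row_mxEr.
Qed.

Lemma row_mx_rV0 (R : realType) n (x : 'rV[R]_0) (z : 'rV[R]_n) : row_mx x z = z.
Proof.
apply/rowP => i; rewrite [in LHS](_ : i = rshift 0 i); last exact/val_inj.
by rewrite row_mxEr.
Qed.

Lemma rVint_row (R : realType) m n (h : 'rV[R]_(m + n) -> R) : Cc h ->
  rVint h = rVint (rVint_fiber h).
Proof.
elim: m h => [|m IH] h Ch.
  (* On ['rV_0] the measure is the Dirac mass at the only point. *)
  rewrite [RHS]/rVint /Rintegral /= integral_dirac//; last first.
    apply/measurable_EFinP; apply: continuous_measurable_rV.
    exact: continuous_rVint_fiber.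
  by rewrite diracT mul1e /=; apply: eq_rVint => z; rewrite row_mx_rV0.
rewrite (@rVint_cons _ (m + n) h)// rVint_cons; last exact: Cc_rVint_fiber.
apply: eq_Rintegral => t _.
rewrite (IH (fun w => h (rV_cons (t, w)))); last exact: Cc_cons.
apply: eq_rVint => x; apply: eq_rVint => z.
by rewrite rV_cons_row.
Qed.

(** * Dilations *)

Section scaling.
Context (R : realType).

Lemma Rintegral_scale (G : R -> R) a M : 0 < a -> continuous G ->
  (forall t, 0 <= G t) -> (forall t, G t != 0 -> `|t| <= M) ->
  \int[lebesgue_measure]_t G (a * t) = a^-1 * \int[lebesgue_measure]_t G t.
Proof.
move=> a0 cG G0 HM.
pose F (t : R) := a * t.
have dF (t : R) : is_derive t (1 : R) F a.
  have -> : F = a \*: (id : R -> R) by apply/funext.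
  by apply: is_derive_eq; rewrite [_ *: _]mulr1.
have F' : derive1 F = cst a by apply/funext => t; rewrite derive1E; have [] := dF t.
have cGa : continuous (G \o F).
  move=> t; apply: continuous_comp; last exact: cG.
  by apply/differentiable_continuous/derivable1_diffP; have [] := dF t.
have int_Ga : lebesgue_measure.-integrable setT (EFin \o (G \o F)).
  apply: (@Cc_line_integrable _ _ (a^-1 * M)) => // t /HM.
  by rewrite /F normrM gtr0_norm// -ler_pdivlMl.
have E : (\int[lebesgue_measure]_x (G x)%:E =
    \int[lebesgue_measure]_x (((G \o F) * derive1 F)%R x)%:E)%E.
  apply: increasing_ge0_integration_by_substitutionT => //.
  - by move=> x y xy; rewrite /F ltr_pM2l.
  - by rewrite F'; exact: cst_continuous.
  - by rewrite F'; exact: is_cvg_cst.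
  - by rewrite F'; exact: is_cvg_cst.

  - exact: gt0_cvgMrNy.
  - exact: gt0_cvgMry.
rewrite {2}/Rintegral E F' -[fine _]/(\int[lebesgue_measure]_x ((G \o F) x * a)).
by rewrite RintegralZr// mulrCA mulVf ?mulr1// gt_eqF.
Qed.

Lemma rV_cons_scale d (a t : R) (v : 'rV[R]_d) :
  a *: rV_cons (t, v) = rV_cons (a * t, a *: v).
Proof.
apply/rowP => i; rewrite !mxE; case: (unliftP ord0 i) => [j _|_] //=.
by rewrite mxE.
Qed.

Lemma Cc_scale d (h : 'rV[R]_d -> R) a : 0 < a -> Cc h -> Cc (fun x => h (a *: x)).
Proof.
move=> a0 [ch [M HM]]; split.
  move=> x; apply: continuous_comp; last exact: ch.
  exact: scaler_continuous.
exists (a^-1 * M) => x /HM H i; have := H i.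
by rewrite mxE normrM gtr0_norm// -ler_pdivlMl.
Qed.

Lemma rVint_scale d (h : 'rV[R]_d -> R) a : 0 < a -> Cc h ->
  (forall x, 0 <= h x) -> rVint (fun x => h (a *: x)) = (a ^+ d)^-1 * rVint h.
Proof.
move=> a0; elim: d h => [|d IH] h Ch h0.
  rewrite expr0 invr1 mul1r; apply: eq_rVint => x; congr h.
  by apply/rowP => -[].
rewrite rVint_cons; last exact: Cc_scale.
rewrite (rVint_cons Ch) [LHS](_ : _ = \int[lebesgue_measure]_t ((a ^+ d)^-1 *
    rVint (fun v => h (rV_cons (a * t, v))))); last first.
  apply: eq_Rintegral => t _.
  rewrite -(IH (fun v => h (rV_cons (a * t, v))))//; last exact: Cc_cons.
  by apply: eq_rVint => v; rewrite rV_cons_scale.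
pose G t := rVint (fun v => h (rV_cons (t, v))).
have [ch [M HM]] := Ch.
have GM t : G t != 0 -> `|t| <= M.
  apply: contraNT; rewrite -ltNge => Mt.
  rewrite /G (_ : (fun v => _) = fun=> 0) ?rVint0//.
  apply/funext => v; apply/eqP; apply: contraTT Mt => /HM/(_ ord0).
  by rewrite mxE unlift_none leNgt.
have cG : continuous G.
  (* Slices over the first coordinate are fibres over ['rV_1], so [G] is continuous as a fibre
     integral. *)
  have -> : G = @rVint_fiber R 1 d h \o (fun t => rV_cons (t, 0)).
    by apply/funext => t; apply: eq_rVint => v; rewrite -rV_cons_row row_mx_rV0.
  move=> t; apply: continuous_comp; first exact: rV_cons_continuousl.
  exact: continuous_rVint_fiber.
have cGa : continuous (fun t => G (a * t)).
  move=> t; apply: continuous_comp; last exact: cG.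
  by apply: continuousM; [exact: cvg_cst|exact: cvg_id].
rewrite RintegralZl//; last first.
  apply: (@Cc_line_integrable _ _ (a^-1 * M)) => // t /GM.
  by rewrite normrM gtr0_norm// -ler_pdivlMl.
rewrite (@Rintegral_scale G a M)// => [|t]; last exact: rVint_ge0.
by rewrite mulrA exprS invfM [a^-1 * _]mulrC.
Qed.

End scaling.
(** * Rayleigh quotients and the spectrum *)

Section psd_form.
Context (R : realType) (V : lmodType R) (P : V -> Prop) (B : V -> V -> R).

(** The domain is a predicate because bilinearity is available only there, for instance on test
    functions for the energy. The record is instantiated by the L2 product, the energy, the energy
    minus a multiple of the L2 product, and the integral product on [Cc]. *)
Record is_psd_form : Prop := IsPsdForm {
  psd_dom : forall a u v, P u -> P v -> P (a *: u + v);
  psd_linear : forall a u v w, P u -> P v -> P w ->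
    B (a *: u + v) w = a * B u w + B v w;
  psd_sym : forall u v, P u -> P v -> B u v = B v u;
  psd_ge0 : forall u, P u -> 0 <= B u u
}.

Hypothesis HB : is_psd_form.

Lemma psd_domB u v : P u -> P v -> P (u - v).
Proof. by move=> Pu Pv; rewrite addrC -scaleN1r; exact: psd_dom HB _ _ _ Pv Pu. Qed.

Lemma psdBl u v w : P u -> P v -> P w -> B (u - v) w = B u w - B v w.
Proof.
by move=> Pu Pv Pw; rewrite addrC -scaleN1r (psd_linear HB)// mulN1r addrC.
Qed.

Lemma psdBr u v w : P u -> P v -> P w -> B w (u - v) = B w u - B w v.
Proof.
move=> Pu Pv Pw; rewrite (psd_sym HB)//; last exact: psd_domB.
by rewrite psdBl// !(psd_sym HB _ Pw).
Qed.

Lemma psdBB0 u : P u -> B (u - u) (u - u) = 0.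
Proof. by move=> Pu; have Puu := psd_domB Pu Pu; rewrite psdBl// subrr. Qed.

Lemma psd_quadratic t u v : P u -> P v ->
  B (t *: u + v) (t *: u + v) = t ^+ 2 * B u u + 2 * t * B u v + B v v.
Proof.
move=> Pu Pv; have Puv := psd_dom HB t Pu Pv.
rewrite (psd_linear HB)// (psd_sym HB Pu Puv) (psd_sym HB Pv Puv).
rewrite !(psd_linear HB)// (psd_sym HB Pv Pu); ring.
Qed.

Lemma psd_CS u v : P u -> P v -> B u v ^+ 2 <= B u u * B v v.
Proof.
move=> Pu Pv.
have H t : 0 <= t ^+ 2 * B u u + 2 * t * B u v + B v v.
  by rewrite -psd_quadratic//; apply: (psd_ge0 HB); exact: psd_dom HB _ _ _ _ _.
have := psd_ge0 HB Pu; rewrite le_eqVlt => /predU1P[E|u0].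
  have [->|uv0] := eqVneq (B u v) 0; first by rewrite -E mul0r expr0n.
  (* With [B u u = 0] the quadratic is affine in [t], and this [t] gives it the value -1. *)
  have := H (- (B v v + 1) / (2 * B u v)).
  rewrite -E mulr0 add0r.
  have -> : 2 * (- (B v v + 1) / (2 * B u v)) * B u v = - (B v v + 1) by field.
  lra.
have := H (- B u v / B u u).
have -> : (- B u v / B u u) ^+ 2 * B u u + 2 * (- B u v / B u u) * B u v + B v v =
  (B u u * B v v - B u v ^+ 2) / B u u by field; rewrite gt_eqF.
by rewrite pmulr_lge0 ?invr_gt0// subr_ge0.
Qed.

Lemma psd_norm_le u v : P u -> P v ->
  `|B u v| <= Num.sqrt (B u u) * Num.sqrt (B v v).
Proof.
move=> Pu Pv; rewrite -sqrtrM ?(psd_ge0 HB)// -sqrtr_sqr ler_wsqrtr//.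
exact: psd_CS.
Qed.

Lemma psd_le_split u v : P u -> P v ->
  B u u <= 2 * B (u - v) (u - v) + 2 * B v v.
Proof.
move=> Pu Pv; have Puv := psd_domB Pu Pv.
have E1 := psd_quadratic 1 Puv Pv; rewrite scale1r subrK in E1.
have E2 := psd_quadratic (-1) Puv Pv.
have := psd_ge0 HB (psd_dom HB (-1) Puv Pv); rewrite E1 E2; lra.
Qed.

Lemma psd_sub_le u v : P u -> P v ->
  B (u - v) (u - v) <= 2 * B u u + 2 * B v v.
Proof.
move=> Pu Pv; have := psd_ge0 HB (psd_dom HB 1 Pu Pv).
rewrite psd_quadratic// psdBl ?psdBr// ?(psd_sym HB Pv Pu); last exact: psd_domB.
lra.
Qed.

Lemma psdZl a u v : P u -> P v -> B (a *: u) v = a * B u v.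
Proof.
move=> Pu Pv; have -> : a *: u = (a - 1) *: u + u.
  by rewrite scalerBl scale1r subrK.
by rewrite (psd_linear HB)//; ring.
Qed.

Lemma cvg_psd_norm0 (x : nat -> R) (u v : nat -> V) (M : R) :
  (forall k, P (u k)) -> (forall k, P (v k)) ->
  (forall k, x k = B (u k) (v k)) ->
  B (u k) (u k) @[k --> \oo] --> (0 : R) -> (\forall k \near \oo, B (v k) (v k) <= M) ->
  x k @[k --> \oo] --> (0 : R).
Proof.
move=> Pu Pv xE u0 vM.
apply/norm_cvg0P.
have cs : Num.sqrt (B (u k) (u k)) * Num.sqrt M @[k --> \oo] --> (0 : R).
  rewrite -[X in _ --> X](mul0r (Num.sqrt M)); apply: cvgM; last exact: cvg_cst.
  rewrite -[X in _ --> X]sqrtr0; apply: (continuous_cvg _ _ u0).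
  exact: sqrt_continuous.
apply: (squeeze_cvgr _ (cvg_cst 0) cs); near=> k.
rewrite normr_ge0 xE /=; apply: le_trans (psd_norm_le (Pu k) (Pv k)) _.
rewrite ler_wpM2l ?sqrtr_ge0// ler_wsqrtr//.
by near: k.
Unshelve. all: by end_near. Qed.

(** [B u' v' - B u v] equals [B (u' - u) v' + B (v' - v) u], and Cauchy-Schwarz sends both terms to
    zero given bounds on [v'] and [u]. *)
Lemma cvg_psd_swap (u u' v v' : nat -> V) (Mu Mv : R) (c : R) :
  (forall k, P (u k)) -> (forall k, P (v k)) ->
  (forall k, P (u' k)) -> (forall k, P (v' k)) ->
  B (u' k - u k) (u' k - u k) @[k --> \oo] --> (0 : R) ->
  B (v' k - v k) (v' k - v k) @[k --> \oo] --> (0 : R) ->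
  (\forall k \near \oo, B (u k) (u k) <= Mu) ->
  (\forall k \near \oo, B (v' k) (v' k) <= Mv) ->
  B (u k) (v k) @[k --> \oo] --> c ->
  B (u' k) (v' k) @[k --> \oo] --> c.
Proof.
move=> Pu Pv Pu' Pv' du dv bu bv cuv.
have c1 : B (u' k - u k) (v' k) @[k --> \oo] --> (0 : R).
  by apply: cvg_psd_norm0 du bv => // k; exact: psd_domB.
have c2 : B (v' k - v k) (u k) @[k --> \oo] --> (0 : R).
  by apply: cvg_psd_norm0 dv bu => // k; exact: psd_domB.
rewrite [X in X @ _ --> _](_ : _ = fun k => B (u k) (v k) + (B (u' k - u k) (v' k) +
    B (v' k - v k) (u k))); last first.
  apply/funext => k; rewrite !psdBl// (psd_sym HB (Pv' k) (Pu k)).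
  by rewrite (psd_sym HB (Pv k) (Pu k)); ring.
rewrite -[X in _ --> X]addr0; apply: cvgD => //.
by rewrite -[X in _ --> X]addr0; exact: cvgD.
Qed.

Lemma cvg_psd (u v : nat -> V) (u' v' : V) :
  (forall k, P (u k)) -> (forall k, P (v k)) -> P u' -> P v' ->
  B (u k - u') (u k - u') @[k --> \oo] --> (0 : R) ->
  B (v k - v') (v k - v') @[k --> \oo] --> (0 : R) ->
  B (u k) (v k) @[k --> \oo] --> B u' v'.
Proof.
move=> Pu Pv Pu' Pv' du dv.
have bv : \forall k \near \oo, B (v k) (v k) <= 2 + 2 * B v' v'.
  have : \forall k \near \oo, B (v k - v') (v k - v') < 1.
    by have /cvgr_lt := dv; apply.
  apply: filterS => k h1; apply: le_trans (psd_le_split (Pv k) Pv') _.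
  lra.
have bu : \forall k \near \oo, B u' u' <= B u' u' by near=> k.
exact: (@cvg_psd_swap (fun=> u') u (fun=> v') v _ _ _ _ _ _ _ du dv bu bv (cvg_cst _)).
Unshelve. all: by end_near. Qed.

End psd_form.

(** * Square integrable functions *)

Section L2_form.
Context (R : realType) (d : nat) (Om : set 'rV[R]_d) (mOm : measurable Om).
Implicit Types u v w : 'rV[R]_d -> R.
Local Notation mu := (lebesgue_rV R d).

Lemma L2_integrable_sqr u : L2 Om u -> mu.-integrable Om (fun x => (u x ^+ 2)%:E).
Proof.
move=> [mu' ioo]; apply/integrableP; split.
  by apply/measurable_EFinP; exact: measurable_funX.
rewrite (eq_integral (fun x => (u x ^+ 2)%:E))// => x _.
by rewrite /= ger0_norm// sqr_ge0.
Qed.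

Lemma L2_integrableM u v : L2 Om u -> L2 Om v ->
  mu.-integrable Om (fun x => (u x * v x)%:E).
Proof.
move=> Lu Lv.
apply: (@le_integrable _ _ _ _ _ mOm _ (fun x => ((u x ^+ 2)%:E + (v x ^+ 2)%:E)%E)).
- by apply/measurable_EFinP; apply: measurable_funM; [case: Lu|case: Lv].
- move=> x _; rewrite /= lee_fin.
  rewrite [leRHS]ger0_norm ?addr_ge0 ?sqr_ge0//.
  rewrite normrM -[u x ^+ 2]real_normK ?num_real// -[v x ^+ 2]real_normK ?num_real//.
  have := sqr_ge0 (`|u x| - `|v x|); nra.
- by apply: integrableD => //; exact: L2_integrable_sqr.
Qed.

Lemma L2_psd : is_psd_form (L2 Om) (L2dot Om).
Proof.
split.
- move=> a u v Lu Lv; split.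
    apply: measurable_funD; last by case: Lv.
    by apply: measurable_funM => //; case: Lu.
  have iuv := L2_integrableM Lu Lv.
  have I : mu.-integrable Om (fun x => ((a ^+ 2)%:E * (u x ^+ 2)%:E +
      ((2 * a)%:E * (u x * v x)%:E + (v x ^+ 2)%:E))%E).
    apply: integrableD => //; first by apply: integrableZl => //; exact: L2_integrable_sqr.
    apply: integrableD => //; first exact: integrableZl.
    exact: L2_integrable_sqr.
  have /integrableP[_] := I; apply: le_lt_trans.
  apply: ge0_le_integral => //.
  + by move=> x _; rewrite lee_fin sqr_ge0.
  + apply/measurable_EFinP; apply: measurable_funX.
    apply: measurable_funD; last by case: Lv.
    by apply: measurable_funM => //; case: Lu.
  + by apply: measurableT_comp => //; case/integrableP: I.
  + move=> x _; apply: le_trans (lee_abs _).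
    rewrite -!EFinM -!EFinD lee_fin /= le_eqVlt; apply/orP; left; apply/eqP.
    by rewrite -[(a *: u + v) x]/(a * u x + v x); ring.
- move=> a u v w Lu Lv Lw; rewrite /L2dot.
  have iu := L2_integrableM Lu Lw; have iv := L2_integrableM Lv Lw.
  rewrite -RintegralZl// -RintegralD//; last first.
    rewrite (_ : _ \o _ = fun x => (a%:E * (u x * w x)%:E)%E)//.
    exact: integrableZl.
  apply: eq_Rintegral => x _.
  by rewrite -[(a *: u + v) x]/(a * u x + v x) /=; ring.
- by move=> u v _ _; apply: eq_Rintegral => x _; rewrite mulrC.
- by move=> u _; apply: Rintegral_ge0 => x _; rewrite -expr2 sqr_ge0.
Qed.

Lemma L2dot_gt0 u : L2 Om u -> ~ L2null Om u -> 0 < L2dot Om u u.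
Proof.
move=> Lu u0; rewrite lt_neqAle (psd_ge0 L2_psd Lu) andbT.
apply: contra_notN u0 => /eqP E.
have iu := L2_integrableM Lu Lu.
have E0 : (\int[mu]_(x in Om) `|(u x * u x)%:E| = 0)%E.
  rewrite (eq_integral (fun x => (u x * u x)%:E)); last first.
    by move=> x _; rewrite /= ger0_norm// -expr2 sqr_ge0.
  rewrite -[LHS]fineK; first by rewrite -[fine _]/(L2dot Om u u) -E.
  exact: integrable_fin_num.
have mu2 : measurable_fun Om (fun x => (u x * u x)%:E).
  by case/integrableP: iu.
have /ae_eq_integral_abs := E0 => /(_ mOm mu2).
apply: filterS => x H Ox; have /= [/eqP] := H Ox.
by rewrite mulf_eq0 orbb => /eqP.
Qed.

End L2_form.

(** The arithmetic of the spectral argument. For [(A - mu) v = u], read [s = <u, u>], [t = <u, v>],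
    [r = <v, v>] and [q] for the value at [u] of the form of [A - mu]. The last two inequalities are
    Cauchy-Schwarz for the two forms; they give [s <= e * t] and then
    [s ^+ 2 <= e ^+ 2 * C * s ^+ 2]. *)
Lemma small_residual_absurd (R : realType) (s t r q e C : R) :
  0 <= q < e * s -> r <= C * s -> 0 < s -> e ^+ 2 * C < 1 -> 0 < e ->
  t ^+ 2 <= s * r -> s ^+ 2 <= t * q -> False.
Proof.
move=> /andP[q0 qe] rC s0 eC e0 tr st.
have t0 : 0 < t.
  rewrite ltNge; apply/negP => t0.
  have : t * q <= 0 by rewrite mulr_le0_ge0.
  have : 0 < s ^+ 2 by rewrite exprn_gt0.
  lra.
have st' : s <= e * t.
  rewrite -(ler_pM2l s0) -expr2; apply: le_trans st _.
  have -> : s * (e * t) = t * (e * s) by ring.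
  by rewrite ler_pM2l// ltW.
have : s ^+ 2 <= e ^+ 2 * (s * (C * s)).
  apply: (@le_trans _ _ ((e * t) ^+ 2)).
    by rewrite ler_sqr ?nnegrE// ltW// mulr_gt0.
  rewrite exprMn ler_wpM2l ?sqr_ge0//; apply: le_trans tr _.
  by rewrite ler_wpM2l// ltW.
have -> : e ^+ 2 * (s * (C * s)) = (e ^+ 2 * C) * s ^+ 2 by ring.
have s2 : 0 < s ^+ 2 by rewrite exprn_gt0.
by rewrite leNgt -[ltRHS]mul1r ltr_pM2r// eC.
Qed.

(** * The closure of an abstract energy form and its Rayleigh quotient *)

Section rayleigh.
Context (R : realType) (d p : nat)
  (X : 'I_p -> ('rV[R]_d -> R) -> 'rV[R]_d -> R) (Om : set 'rV[R]_d).
Hypothesis mOm : measurable Om.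
Hypothesis test_L2 : forall phi, Cc_smooth Om phi -> L2 Om phi.
Hypothesis energy_psd : is_psd_form (Cc_smooth Om) (energy X Om).
(** L2 continuity of the energy in its second argument, the abstract substitute for integration by
    parts; closability rests on it. *)
Hypothesis energy_L2_bounded : forall phi, Cc_smooth Om phi ->
  exists C, forall psi, Cc_smooth Om psi ->
    `|energy X Om phi psi| <= C * Num.sqrt (L2dot Om psi psi).

Let L2p := L2_psd mOm.
Local Notation E := (energy X Om).
Local Notation dot := (L2dot Om).
Implicit Types (phi psi : nat -> 'rV[R]_d -> R).

Definition energy_cauchy phi := forall eps : R, 0 < eps -> exists N : nat,
  forall k l : nat, (N <= k)%N -> (N <= l)%N ->
        E (phi k \- phi l) (phi k \- phi l) < eps.

(** Expanding the square gives [E (phi k) (phi k) <= E (phi k - phi l) (phi k - phi l) + 2 * E (phi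
    k) (phi l)]. The first term is small by the Cauchy property, and the second tends to 0 in [l]
    for fixed [k] by L2 continuity. *)
Lemma energy_closable phi : (forall k, Cc_smooth Om (phi k)) ->
  dot (phi k) (phi k) @[k --> \oo] --> (0 : R) -> energy_cauchy phi ->
  E (phi k) (phi k) @[k --> \oo] --> (0 : R).
Proof.
move=> Tp p0 cp; apply/cvgr0Pnorm_le => eps e0.
have [N HN] := cp _ e0; near=> k.
have Nk : (N <= k)%N by near: k; exact: nbhs_infty_ge.
rewrite ger0_norm ?(psd_ge0 energy_psd)//.
have [C HC] := energy_L2_bounded (Tp k).
have s0 : eps + 2 * (C * Num.sqrt (dot (phi l) (phi l))) @[l --> \oo] --> eps.
  rewrite -[X in _ --> X]addr0; apply: cvgD; first exact: cvg_cst.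
  rewrite -[X in _ --> X](mulr0 2); apply: cvgM; first exact: cvg_cst.
  rewrite -[X in _ --> X](mulr0 C); apply: cvgM; first exact: cvg_cst.
  rewrite -[X in _ --> X]sqrtr0; apply: (continuous_cvg _ _ p0).
  exact: sqrt_continuous.
apply: (cvgr_to_ge s0); near=> l.
have Nl : (N <= l)%N by near: l; exact: nbhs_infty_ge.
have := HN k l Nk Nl.
have := HC _ (Tp l).
have /= := psd_ge0 energy_psd (psd_dom energy_psd (-1) (Tp l) (Tp l)).
have Tkl := psd_domB energy_psd (Tp k) (Tp l).
rewrite -[phi k \- phi l]/(phi k - phi l).
rewrite (psdBl energy_psd)// !(psdBr energy_psd)//.
rewrite (psd_sym energy_psd (Tp l) (Tp k)) ler_norml => _ /andP[_ h].
have := psd_ge0 energy_psd (Tp l); lra.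
Unshelve. all: by end_near. Qed.

Lemma energy_cauchy_bounded phi : (forall k, Cc_smooth Om (phi k)) ->
  energy_cauchy phi -> exists M, \forall k \near \oo, E (phi k) (phi k) <= M.
Proof.
move=> Tp cp; have [N HN] := cp _ ltr01.
exists (2 + 2 * E (phi N) (phi N)); near=> k.
have Nk : (N <= k)%N by near: k; exact: nbhs_infty_ge.
apply: le_trans (psd_le_split energy_psd (Tp k) (Tp N)) _.
have := HN k N Nk (leqnn N).
rewrite -[phi k \- phi N]/(phi k - phi N); lra.
Unshelve. all: by end_near. Qed.

Lemma form_approx_diff u phi psi : L2 Om u ->
  form_approx X Om u phi -> form_approx X Om u psi ->
  E (psi k - phi k) (psi k - phi k) @[k --> \oo] --> (0 : R).
Proof.
move=> Lu [Tp p0 cp] [Tq q0 cq].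
apply: (energy_closable (phi := fun k => psi k - phi k)).
- by move=> k; exact: (psd_domB energy_psd).
- have s0 : 2 * dot (psi k - u) (psi k - u) + 2 * dot (phi k - u) (phi k - u)
      @[k --> \oo] --> (0 : R).
    rewrite -[X in _ --> X]addr0 -[X in X + _](mulr0 2) -[X in _ + X](mulr0 2).
    by apply: cvgD; apply: cvgM => //; exact: cvg_cst.
  apply: (squeeze_cvgr _ (cvg_cst 0) s0); apply: nearW => k.
  have Lp : L2 Om (phi k - u) by apply: (psd_domB L2p) => //; exact: test_L2.
  have Lq : L2 Om (psi k - u) by apply: (psd_domB L2p) => //; exact: test_L2.
  have -> : psi k - phi k = (psi k - u) - (phi k - u).
    by rewrite opprB addrA subrK.
  by rewrite (psd_ge0 L2p) ?(psd_sub_le L2p)//; exact: (psd_domB L2p).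
- move=> e e0; have e4 : 0 < e / 4 by rewrite divr_gt0.
  have [N HN] := cp _ e4; have [M HM] := cq _ e4.
  exists (maxn N M) => k l; rewrite !geq_max => /andP[Nk Mk] /andP[Nl Ml].
  have h1 := HN k l Nk Nl; have h2 := HM k l Mk Ml.
  rewrite -[_ \- _]/((psi k - phi k) - (psi l - phi l)).
  have -> : (psi k - phi k) - (psi l - phi l) = (psi k - psi l) - (phi k - phi l).
    by rewrite !opprB addrACA [RHS]addrACA [- _ + _]addrC.
  have Tpkl := psd_domB energy_psd (Tp k) (Tp l).
  have Tqkl := psd_domB energy_psd (Tq k) (Tq l).
  apply: le_lt_trans (psd_sub_le energy_psd Tqkl Tpkl) _.
  rewrite -[phi k - phi l]/(phi k \- phi l) -[psi k - psi l]/(psi k \- psi l).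
  by lra.
Qed.

(** [closed_form] only provides some pair of approximating sequences; by closability the limit is
    the same along every pair, in particular along the constant sequence of a test function. *)
Lemma energy_limit u v phi psi phi' psi' (c : R) : L2 Om u -> L2 Om v ->
  form_approx X Om u phi -> form_approx X Om v psi ->
  form_approx X Om u phi' -> form_approx X Om v psi' ->
  E (phi k) (psi k) @[k --> \oo] --> c ->
  E (phi' k) (psi' k) @[k --> \oo] --> c.
Proof.
move=> Lu Lv ap aq ap' aq'.
have [Tp _ cp] := ap; have [Tq _ _] := aq.
have [Tp' _ _] := ap'; have [Tq' _ cq'] := aq'.
have [Mp bp] := energy_cauchy_bounded Tp cp.
have [Mq bq] := energy_cauchy_bounded Tq' cq'.
apply: (cvg_psd_swap energy_psd Tp Tq Tp' Tq' _ _ bp bq).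
- exact: form_approx_diff Lu ap ap'.
- exact: form_approx_diff Lv aq aq'.
Qed.

Lemma form_approx_cst u : Cc_smooth Om u -> form_approx X Om u (fun=> u).
Proof.
move=> Tu; have Lu := test_L2 Tu; split => //.
  rewrite [X in X @ _ --> _](_ : _ = cst 0); first exact: cvg_cst.
  by apply/funext => k; exact: (psdBB0 L2p).
move=> e e0; exists 0%N => k l _ _.
by rewrite (psdBB0 energy_psd).
Qed.

Lemma dot_limit u v phi psi : L2 Om u -> L2 Om v ->
  form_approx X Om u phi -> form_approx X Om v psi ->
  dot (phi k) (psi k) @[k --> \oo] --> dot u v.
Proof.
move=> Lu Lv [Tp p0 _] [Tq q0 _].
by apply: (cvg_psd L2p) => // k; exact: test_L2.
Qed.

(** The inequality passes to the limit along an approximation of an eigenfunction [u], where the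
    energy tends to [lam * dot u u]. *)
Lemma dirichlet_eigenvalue_ge lam m :
  (forall u, Cc_smooth Om u -> m * dot u u <= E u u) ->
  dirichlet_eigenvalue X Om lam -> m <= lam.
Proof.
move=> Hm [u [u0 [[Lu [phi ap]] _ /(_ u)[|a [b [aa ab]]]]]]; first by split => //; exists phi.
have [Ta _ _] := aa.
move=> /(energy_limit Lu Lu aa ab aa aa) Eaa.
have daa := dot_limit Lu Lu aa aa.
have dm : m * dot (a k) (a k) @[k --> \oo] --> m * dot u u.
  by apply: cvgM => //; exact: cvg_cst.
have := ler_cvg_to dm Eaa.
rewrite -[lam \*o u]/(lam *: u) (psdZl L2p)// ler_pM2r; last exact: L2dot_gt0.
by apply; apply: nearW => k; exact: Hm.
Qed.

Lemma rayleigh_ge lam :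
  (forall mu, dirichlet_spectrum X Om mu -> lam <= mu) ->
  forall u, Cc_smooth Om u -> lam * dot u u <= E u u.
Proof.
move=> Hlam u0 Tu0; rewrite leNgt; apply/negP => Elt.
have dot_ge0 u : Cc_smooth Om u -> 0 <= dot u u.
  by move=> Tu; apply: (psd_ge0 L2p); exact: test_L2.
have d0 : 0 < dot u0 u0.
  rewrite lt_neqAle dot_ge0// andbT; apply/negP => /eqP d0.
  by move: Elt; rewrite -d0 mulr0 ltNge (psd_ge0 energy_psd).
(* [S] consists of the lower bounds of the Rayleigh quotient, and its supremum [m0] is the infimum
   of the quotient. The function [u0] forces [m0 < lam], so [m0] is outside the spectrum. *)
pose S := [set m | forall u, Cc_smooth Om u -> m * dot u u <= E u u].
have S0 : S 0 by move=> u Tu; rewrite mul0r (psd_ge0 energy_psd).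
have Sub u : Cc_smooth Om u -> 0 < dot u u -> ubound S (E u u / dot u u).
  by move=> Tu du m Sm; rewrite ler_pdivlMr//; exact: Sm.
have supS : has_sup S by split; [exists 0|exists (E u0 u0 / dot u0 u0); exact: Sub].
pose m0 := sup S.
have Sm0 : S m0.
  move=> u Tu; have := dot_ge0 _ Tu; rewrite le_eqVlt => /predU1P[<-|du].
    by rewrite mulr0 (psd_ge0 energy_psd).
  by rewrite -ler_pdivlMr//; apply: ge_sup; [exists 0|exact: Sub].
have m0lam : m0 < lam.
  apply: (@le_lt_trans _ _ (E u0 u0 / dot u0 u0)); last by rewrite ltr_pdivrMr.
  by apply: ge_sup; [exists 0|exact: Sub].
have [solve [C HC]] : dirichlet_resolvent X Om m0.
  by apply: contrapT => /Hlam; rewrite leNgt m0lam.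
(* Chosen so that [eps ^+ 2 * C < 1]; the absolute value covers a negative [C]. *)
pose eps := (1 + `|C|)^-1.
have eps0 : 0 < eps by rewrite invr_gt0 ltr_pwDl.
have epsC : eps ^+ 2 * C < 1.
  rewrite exprVn mulrC ltr_pdivrMr ?exprn_gt0 ?ltr_pwDl// mul1r.
  have := ler_norm C; have := normr_ge0 C; nra.
have [u Tu Eu] : exists2 u, Cc_smooth Om u & E u u < (m0 + eps) * dot u u.
  apply: contrapT => H; have : S (m0 + eps).
    by move=> u Tu; rewrite leNgt; apply/negP => Eu; apply: H; exists u.
  by move=> /(ub_le_sup supS.2); rewrite leNgt ltrDl eps0.
have Lu := test_L2 Tu.
have du : 0 < dot u u.
  rewrite lt_neqAle dot_ge0// andbT; apply/negP => /eqP d1.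
  by move: Eu; rewrite -d1 mulr0 ltNge (psd_ge0 energy_psd).
have [v Dv] := solve u Lu.
have := HC _ _ Lu Dv => dv.
have [[Lv [a aa]] Lw op] := Dv.
have au := form_approx_cst Tu.
have [Ta _ _] := aa.
have dom_u : form_dom X Om u by split => //; exists (fun=> u).
have dom_v : form_dom X Om v by split => //; exists a.
(* Testing the equation for [v] with [u] and with [v] shows that, along the approximation [a] of
   [v], the energy minus [m0] times the L2 product tends to [<u, u>] on [(a k, u)] and to [<u, v>]
   on [(a k, a k)]. *)
have [a1 [b1 [aa1 ab1 /(energy_limit Lv Lu aa1 ab1 aa au) Eau]]] := op _ dom_u.
have [a2 [b2 [aa2 ab2 /(energy_limit Lv Lv aa2 ab2 aa aa) Eaa]]] := op _ dom_v.
rewrite -[X in L2dot Om X u]/(m0 *: v + u) (psd_linear L2p)// in Eau.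
rewrite -[X in L2dot Om X v]/(m0 *: v + u) (psd_linear L2p)// in Eaa.
have dau := dot_limit Lv Lu aa au.
have daa := dot_limit Lv Lv aa aa.
pose Q f g := E f g - m0 * dot f g.
have Qpsd : is_psd_form (Cc_smooth Om) Q.
  split => [c f g Tf Tg|c f g h Tf Tg Th|f g Tf Tg|f Tf]; rewrite /Q.
  - exact: (psd_dom energy_psd).
  - rewrite (psd_linear energy_psd)//
      (psd_linear L2p _ (test_L2 Tf) (test_L2 Tg) (test_L2 Th)); ring.
  - by rewrite (psd_sym energy_psd)// (psd_sym L2p (test_L2 Tf) (test_L2 Tg)).
  - by rewrite subr_ge0; exact: Sm0.
have Qau : Q (a k) u ^+ 2 @[k --> \oo] --> dot u u ^+ 2.
  have : Q (a k) u @[k --> \oo] --> m0 * dot v u + dot u u - m0 * dot v u.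
    by apply: cvgB => //; apply: cvgM => //; exact: cvg_cst.
  by rewrite addrC addrA addNr add0r => q; apply: cvgM.
have Qaa : Q (a k) (a k) * Q u u @[k --> \oo] --> dot u v * Q u u.
  apply: cvgM; last exact: cvg_cst.
  have : Q (a k) (a k) @[k --> \oo] --> m0 * dot v v + dot u v - m0 * dot v v.
    by apply: cvgB => //; apply: cvgM => //; exact: cvg_cst.
  by rewrite addrC addrA addNr add0r.
have := ler_cvg_to Qau Qaa (nearW _ (fun k => psd_CS Qpsd (Ta k) Tu)).
have Qu : 0 <= Q u u < eps * dot u u.
  by rewrite (psd_ge0 Qpsd)//= /Q ltrBlDl -mulrDl.
have := psd_CS L2p Lu Lv.
move=> tr st; apply: (small_residual_absurd Qu dv du epsC eps0 tr); exact: st.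
Qed.

End rayleigh.
(** * First-order operators on sublevel sets *)

Section sublevel_domain.
Context (R : realType) (d : nat) (Q : 'rV[R]_d -> R).
Hypothesis cQ : continuous Q.
Hypothesis Qbounded : forall x, Q x < 1 -> forall i, `|x 0 i| <= 1.
Local Notation Om := [set x | Q x < 1].
Implicit Types phi psi : 'rV[R]_d -> R.

(** The continuous [Q] attains its maximum on the compact support, so containment in the open set
    amounts to a uniform margin [r < 1]. The margin is easier to follow through products, slices and
    fibre norms than the closure of a support. *)
Lemma Cc_smooth_sublevel phi : Cc_smooth Om phi <->
  smooth phi /\ exists2 r, r < 1 & forall x, phi x != 0 -> Q x <= r.
Proof.
split=> [[sphi cK KOm]|[sphi [r r1 Hr]]].
  split => //.
  have [E|/set0P K0] := eqVneq (closure [set x | phi x != 0]) set0.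
    exists 0 => // x phix; have : closure [set x | phi x != 0] x by exact: subset_closure.
    by rewrite E.
  have cQK : {within closure [set x | phi x != 0], continuous Q}.
    exact: continuous_subspaceT.
  have [c cc cmax] := compact_EVT_max K0 cK cQK.
  exists (Q c); first by apply: KOm; rewrite inE in cc.
  by move=> x phix; apply: cmax; rewrite inE; exact: subset_closure.
have sub : closure [set x | phi x != 0] `<=` [set x | Q x <= r].
  have -> : [set x | Q x <= r] = closure [set x | Q x <= r].
    apply/closure_id; have := @closed_le R r.
    by move/closed_comp; apply => x _; exact: cQ.
  by apply: closure_subset => x; exact: Hr.
split => //; last by move=> x /sub/= /le_lt_trans; apply.
apply: bounded_closed_compact; last exact: closed_closure.
exists 1; split; first exact: num_real.
move=> M M1 x /sub /= Qx; apply: ltW; apply: mx_norm_lt; first exact: lt_trans M1.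
move=> i; apply: le_lt_trans M1; apply: Qbounded; exact: le_lt_trans r1.
Qed.

Lemma measurable_sublevel : measurable Om.
Proof.
apply: open_measurable_rV.
have := @open_lt R 1; move/open_comp; apply => x _; exact: cQ.
Qed.

Lemma Cc_smooth_Cc phi : Cc_smooth Om phi -> Cc phi.
Proof.
move=> /Cc_smooth_sublevel[sphi [r r1 Hr]]; split; first exact: Ck_continuous (sphi 0%N).
by exists 1 => x /Hr Qx; apply: Qbounded; exact: le_lt_trans r1.
Qed.

Lemma Cc_smooth_out phi x : Cc_smooth Om phi -> ~ Om x -> phi x = 0.
Proof.
move=> /Cc_smooth_sublevel[_ [r r1 Hr]]; rewrite /= => Qx; apply/eqP.
by apply: contra_notT Qx => /Hr /le_lt_trans; apply.
Qed.

Lemma Cc_smooth_lin a phi psi : Cc_smooth Om phi -> Cc_smooth Om psi ->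
  Cc_smooth Om (fun x => a * phi x + psi x).
Proof.
move=> /Cc_smooth_sublevel[sp [r r1 Hr]] /Cc_smooth_sublevel[sq [s s1 Hs]].
apply/Cc_smooth_sublevel; split.
  by move=> k; apply: CkD => //; exact: CkZ.
exists (Num.max r s) => [|x H]; first by rewrite gt_max r1.
rewrite le_max; have [p0|/Hr->//] := eqVneq (phi x) 0.
by rewrite Hs ?orbT//; move: H; rewrite p0 mulr0 add0r.
Qed.

Lemma Cc_smoothM_smooth (c : 'rV[R]_d -> R) phi : smooth c -> Cc_smooth Om phi ->
  Cc_smooth Om (fun x => c x * phi x).
Proof.
move=> sc /Cc_smooth_sublevel[sp [r r1 Hr]]; apply/Cc_smooth_sublevel; split.
  by move=> k; exact: CkM.
by exists r => // x; rewrite mulf_eq0 negb_or => /andP[_ /Hr].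
Qed.

Lemma Cc_smooth_partial phi i : Cc_smooth Om phi -> Cc_smooth Om (partial i phi).
Proof.
move=> /Cc_smooth_sublevel[sp [r r1 Hr]]; apply/Cc_smooth_sublevel; split.
  by move=> k; exact: Ck_partial (sp k.+1).
exists r => // x; apply: contraNT; rewrite -ltNge => Qx.
apply/eqP; apply: partial_locally0.
have : \forall y \near x, r < Q y by have /cvgr_gt := @cQ x; apply.
by apply: filterS => y Qy; apply/eqP; apply: contraTT Qy => /Hr; rewrite leNgt.
Qed.

Lemma Cc_smooth_sum (I : Type) (s : seq I) (F : I -> 'rV[R]_d -> R) :
  (forall j, Cc_smooth Om (F j)) -> Cc_smooth Om (fun x => \sum_(j <- s) F j x).
Proof.
move=> TF; elim: s => [|j s IH].
  rewrite [X in Cc_smooth _ X](_ : _ = fun=> 0); last first.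
    by apply/funext => x; rewrite big_nil.
  apply/Cc_smooth_sublevel; split; first by move=> k; exact: Ck_cst.
  by exists 0 => // x; rewrite eqxx.
rewrite [X in Cc_smooth _ X](_ : _ = fun x => 1 * F j x + \sum_(k <- s) F k x).
  exact: Cc_smooth_lin.
by apply/funext => x; rewrite big_cons mul1r.
Qed.

Lemma Rintegral_sublevel (h : 'rV[R]_d -> R) : (forall x, ~ Om x -> h x = 0) ->
  \int[lebesgue_rV R d]_(x in Om) h x = rVint h.
Proof.
move=> h0; rewrite Rintegral_mkcond; apply: eq_Rintegral => x _.
by rewrite patchE; case: ifPn => //; rewrite notin_setE => /h0.
Qed.

Lemma L2dot_sublevel phi psi : Cc_smooth Om phi ->
  L2dot Om phi psi = rVint (fun x => phi x * psi x).
Proof.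
move=> Tp; rewrite /L2dot Rintegral_sublevel// => x Ox.
by rewrite (Cc_smooth_out Tp Ox) mul0r.
Qed.

Lemma Cc_smooth_L2 phi : Cc_smooth Om phi -> L2 Om phi.
Proof.
move=> Tp; have Cp := Cc_smooth_Cc Tp; split.
  apply: measurable_funTS; apply: continuous_measurable_rV.
  exact: Cc_continuous.
have := Cc_integrable (CcX2 Cp).
move=> /(integrableS measurableT measurable_sublevel (@subsetT _ _))/integrableP[_].
rewrite (eq_integral (fun x => (phi x ^+ 2)%:E))// => x _.
by rewrite /= ger0_norm// sqr_ge0.
Qed.

Section first_order_operators.
Context (p : nat) (X : 'I_p -> ('rV[R]_d -> R) -> 'rV[R]_d -> R).
Context (c : 'I_p -> 'I_d -> 'rV[R]_d -> R).
Hypothesis smooth_c : forall j i, smooth (c j i).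
(** Imposed coefficient by coefficient, this makes each [X j] divergence free. For the group it
    holds because the vertical coefficients depend on the horizontal variables only. *)
Hypothesis div_c : forall j i x, partial i (c j i) x = 0.
Hypothesis XE : forall phi j x, Ck 1 phi ->
  X j phi x = \sum_i c j i x * partial i phi x.

Lemma Cc_smooth_X phi j : Cc_smooth Om phi -> Cc_smooth Om (X j phi).
Proof.
move=> Tp; rewrite (_ : X j phi = fun x => \sum_i c j i x * partial i phi x).
  apply: Cc_smooth_sum => i; apply: Cc_smoothM_smooth; first exact: smooth_c.
  exact: Cc_smooth_partial.
by apply/funext => x; rewrite XE//; case: Tp.
Qed.

Lemma X_linear j a phi psi : Cc_smooth Om phi -> Cc_smooth Om psi ->
  X j (fun x => a * phi x + psi x) = fun x => a * X j phi x + X j psi x.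
Proof.
move=> Tp Tq; have Tpq := Cc_smooth_lin a Tp Tq.
apply/funext => x; rewrite !XE; [|by case: Tq|by case: Tp|by case: Tpq].
rewrite mulr_sumr -big_split /=; apply: eq_bigr => i _.
have [[sp _ _] [sq _ _]] := (Tp, Tq).
have dp := Ck_is_derive i x (sp 1%N); have dq := Ck_is_derive i x (sq 1%N).
have -> : partial i (fun x => a * phi x + psi x) x =
    a * partial i phi x + partial i psi x.
  by apply: partialE; apply: is_deriveD; exact: is_deriveZ.
by ring.
Qed.

(** As the field is divergence free, [X j] applied to [phi * psi] is a sum of partial derivatives of
    test functions, whose integrals vanish. *)
Lemma rVint_X_parts j phi psi : Cc_smooth Om phi -> Cc_smooth Om psi ->
  rVint (fun x => X j phi x * psi x) = - rVint (fun x => X j psi x * phi x).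
Proof.
move=> Tp Tq; apply/eqP; rewrite -subr_eq0 opprK.
have Cp := Cc_smooth_Cc Tp; have Cq := Cc_smooth_Cc Tq.
have CXp := Cc_smooth_Cc (Cc_smooth_X j Tp); have CXq := Cc_smooth_Cc (Cc_smooth_X j Tq).
rewrite -rVintD; [|exact: CcM|exact: CcM].
have Tcpq i : Cc_smooth Om (fun x => c j i x * (phi x * psi x)).
  apply: Cc_smoothM_smooth; first exact: smooth_c.
  by apply: Cc_smoothM_smooth => //; case: Tp.
have [[sp _ _] [sq _ _]] := (Tp, Tq).
rewrite (_ : (fun x => _) = fun x => \sum_i partial i (fun x => c j i x * (phi x * psi x)) x).
  rewrite rVint_sum; last by move=> i; apply: Cc_smooth_Cc; exact: Cc_smooth_partial.
  rewrite big1// => i _; apply: rVint_partial0; last exact: Cc_smooth_Cc.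
  by case: (Tcpq i).
apply/funext => x; rewrite !XE// !mulr_suml -big_split /=; apply: eq_bigr => i _.
have dp := Ck_is_derive i x (sp 1%N); have dq := Ck_is_derive i x (sq 1%N).
have dc := Ck_is_derive i x (@smooth_c j i 1%N).
have -> : partial i (fun x => c j i x * (phi x * psi x)) x =
    c j i x * (phi x * partial i psi x + psi x * partial i phi x) +
    (phi x * psi x) * partial i (c j i) x.
  apply: partialE; apply: is_deriveM; exact: is_deriveM.
by rewrite div_c; ring.
Qed.

Lemma energy_sublevel phi psi : Cc_smooth Om phi -> Cc_smooth Om psi ->
  energy X Om phi psi = 2^-1 * \sum_j rVint (fun x => X j phi x * X j psi x).
Proof.
move=> Tp Tq; rewrite /energy Rintegral_sublevel.
  rewrite rVint_sum// => j; apply: CcM; apply: Cc_smooth_Cc; exact: Cc_smooth_X.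
move=> x Ox; rewrite big1// => j _.
by rewrite (Cc_smooth_out (Cc_smooth_X j Tp) Ox) mul0r.
Qed.

Lemma energy_sublevel_psd : is_psd_form (Cc_smooth Om) (energy X Om).
Proof.
split => [a f g Tf Tg|a f g h Tf Tg Th|f g Tf Tg|f Tf].
- exact: Cc_smooth_lin.
- have Tfg : Cc_smooth Om (a *: f + g) by exact: Cc_smooth_lin.
  rewrite !energy_sublevel// mulrCA -mulrDr; congr (_ * _).
  rewrite mulr_sumr -big_split /=; apply: eq_bigr => j _.
  have Cf := Cc_smooth_Cc (Cc_smooth_X j Tf).
  have Cg := Cc_smooth_Cc (Cc_smooth_X j Tg).
  have Ch := Cc_smooth_Cc (Cc_smooth_X j Th).
  have Cfh := CcM Cf Ch; have Cgh := CcM Cg Ch.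
  rewrite -(rVintZ _ Cfh) -(rVintD (CcZ _ Cfh) Cgh).
  apply: eq_rVint => x.
  by rewrite (X_linear j a Tf Tg); ring.
- by rewrite !energy_sublevel//; congr (_ * _); apply: eq_bigr => j _;
    apply: eq_rVint => x; rewrite mulrC.
- rewrite !energy_sublevel// mulr_ge0// sumr_ge0// => j _; apply: rVint_ge0 => x.
  by rewrite -expr2 sqr_ge0.
Qed.

(** Moving [X j] from [psi] to [phi] gives [E phi psi = - <w, psi> / 2], where [w], the sum of
    squares of the fields applied to [phi], is again a test function; Cauchy-Schwarz concludes. *)
Lemma energy_sublevel_L2_bounded phi : Cc_smooth Om phi ->
  exists C, forall psi, Cc_smooth Om psi ->
    `|energy X Om phi psi| <= C * Num.sqrt (L2dot Om psi psi).
Proof.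
move=> Tp; pose w x := \sum_j X j (X j phi) x.
have Tw : Cc_smooth Om w.
  by apply: Cc_smooth_sum => j; apply: Cc_smooth_X; exact: Cc_smooth_X.
exists (2^-1 * Num.sqrt (L2dot Om w w)) => psi Tq.
rewrite energy_sublevel// (_ : \sum_j _ = - L2dot Om w psi).
  rewrite mulrN normrN normrM ger0_norm// -mulrA ler_wpM2l//.
  exact: (psd_norm_le (L2_psd measurable_sublevel) (Cc_smooth_L2 Tw) (Cc_smooth_L2 Tq)).
rewrite L2dot_sublevel// -[RHS]mulN1r.
under [in RHS]eq_fun do rewrite mulr_suml.
rewrite rVint_sum; last first.
  move=> j; apply: CcM; apply: Cc_smooth_Cc => //.
  by apply: Cc_smooth_X; exact: Cc_smooth_X.
rewrite mulr_sumr; apply: eq_bigr => j _; rewrite mulN1r.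
rewrite -rVint_X_parts//; last exact: Cc_smooth_X.
by apply: eq_rVint => x; rewrite mulrC.
Qed.

(** With [lowest_eigenvalue_ge] this identifies [lam] as the infimum of the Rayleigh quotient over
    test functions, the only form in which eigenvalues are used from here on. *)
Lemma lowest_eigenvalue_le_energy lam :
  is_lowest_dirichlet_eigenvalue X Om lam ->
  forall phi, Cc_smooth Om phi ->
  lam * rVint (fun x => phi x ^+ 2) <= 2^-1 * \sum_j rVint (fun x => X j phi x ^+ 2).
Proof.
move=> [_ Hlam] phi Tp.
have := rayleigh_ge measurable_sublevel Cc_smooth_L2 energy_sublevel_psd
  energy_sublevel_L2_bounded Hlam Tp.
rewrite L2dot_sublevel// energy_sublevel//.
Qed.

Lemma lowest_eigenvalue_ge m lam :
  is_lowest_dirichlet_eigenvalue X Om lam ->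
  (forall phi, Cc_smooth Om phi ->
    m * rVint (fun x => phi x ^+ 2) <= 2^-1 * \sum_j rVint (fun x => X j phi x ^+ 2)) ->
  m <= lam.
Proof.
move=> [Heig _] Hm.
apply: (dirichlet_eigenvalue_ge measurable_sublevel Cc_smooth_L2 energy_sublevel_psd
  energy_sublevel_L2_bounded _ Heig) => u Tu.
by rewrite L2dot_sublevel// energy_sublevel//; exact: Hm.
Qed.

End first_order_operators.

End sublevel_domain.

(** * Both unit balls as sublevel sets of polynomials *)

Section balls.
Context (R : realType).

Definition sqn d (x : 'rV[R]_d) : R := \sum_(i < d) x 0 i ^+ 2.

Lemma sqn_ge0 d (x : 'rV[R]_d) : 0 <= sqn x.
Proof. by apply: sumr_ge0 => i _; exact: sqr_ge0. Qed.

Lemma coord_le_sqn d (x : 'rV[R]_d) i : x 0 i ^+ 2 <= sqn x.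
Proof.
by rewrite /sqn (bigD1 i)//= lerDl; apply: sumr_ge0 => j _; exact: sqr_ge0.
Qed.

Lemma smooth_sqn d : smooth (@sqn d).
Proof.
move=> k; apply: Ck_sum => i; under eq_fun do rewrite expr2.
by apply: CkM; exact: Ck_coord.
Qed.

Lemma sqnZ d (a : R) (x : 'rV[R]_d) : sqn (a *: x) = a ^+ 2 * sqn x.
Proof. by rewrite /sqn mulr_sumr; apply: eq_bigr => i _; rewrite mxE exprMn. Qed.

Lemma sqn_row m n (x : 'rV[R]_m) (z : 'rV[R]_n) : sqn (row_mx x z) = sqn x + sqn z.
Proof.
rewrite /sqn big_split_ord /=; congr (_ + _); apply: eq_bigr => i _.
  by rewrite row_mxEl.
by rewrite row_mxEr.
Qed.

Lemma sqn_bounded d (x : 'rV[R]_d) : sqn x < 1 -> forall i, `|x 0 i| <= 1.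
Proof.
move=> x1 i; rewrite -(ler_pXn2r (n := 2))// ?nnegrE// expr1n real_normK ?num_real//.
by apply: le_trans (ltW x1); exact: coord_le_sqn.
Qed.

Lemma enorm_sqr d (x : 'rV[R]_d) : enorm x ^+ 2 = sqn x.
Proof. by rewrite sqr_sqrtr// sqn_ge0. Qed.

Lemma euclidean_ballE d : @euclidean_ball R d = [set x | sqn x < 1].
Proof.
have E (x : 'rV[R]_d) : (enorm x < 1) = (sqn x < 1).
  by have := @ltr_sqrt R (sqn x) 1 ltr01; rewrite sqrtr1.
by rewrite /euclidean_ball; apply/seteqP; split => x /=; rewrite E.
Qed.

(** The fourth power of [H_norm]: a polynomial with the same unit ball. *)
Definition H_gauge m n (x : 'rV[R]_(m + n)) : R :=
  sqn (lsubmx x) ^+ 2 + sqn (rsubmx x).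

Lemma H_gauge_row m n (x : 'rV[R]_m) (z : 'rV[R]_n) :
  H_gauge (row_mx x z) = sqn x ^+ 2 + sqn z.
Proof. by rewrite /H_gauge row_mxKl row_mxKr. Qed.

Lemma H_gauge_ge0 m n (x : 'rV[R]_(m + n)) : 0 <= H_gauge x.
Proof. by rewrite addr_ge0 ?sqr_ge0 ?sqn_ge0. Qed.

Lemma H_ballE m n : @H_ball R m n = [set x | H_gauge x < 1].
Proof.
have E (x : 'rV[R]_(m + n)) : (H_norm x < 1) = (H_gauge x < 1).
  rewrite /H_norm (_ : enorm (lsubmx x) ^+ 4 = sqn (lsubmx x) ^+ 2); last first.
    by rewrite -enorm_sqr -exprM.
  rewrite enorm_sqr -/(H_gauge x).
  have q0 : (0 : R) < 4^-1 by rewrite invr_gt0.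
  have G0 := H_gauge_ge0 x.
  apply/idP/idP; last first.
    by move=> G1; have := gt0_ltr_powR q0 G0 ler01 G1; rewrite powR1.
  apply: contraTT; rewrite -!leNgt => G1.
  by have := ge0_ler_powR (ltW q0) ler01 G0 G1; rewrite powR1.
by rewrite /H_ball; apply/seteqP; split => x /=; rewrite E.
Qed.

Lemma lsubmx_continuous m n : continuous (@lsubmx R 1 m n).
Proof.
apply: continuous_rV => i; under eq_fun do rewrite mxE.
exact: continuous_rV_coord.
Qed.

Lemma rsubmx_continuous m n : continuous (@rsubmx R 1 m n).
Proof.
apply: continuous_rV => i; under eq_fun do rewrite mxE.
exact: continuous_rV_coord.
Qed.

Lemma sqn_continuous d : continuous (@sqn d).
Proof. exact: Ck_continuous (@smooth_sqn d 0%N). Qed.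

Lemma H_gauge_continuous m n : continuous (@H_gauge m n).
Proof.
move=> x; have c2 : {for x, continuous (@sqn n \o @rsubmx R 1 m n)}.
  apply: continuous_comp; first exact: rsubmx_continuous.
  exact: sqn_continuous.
have c : {for x, continuous (@sqn m \o @lsubmx R 1 m n)}.
  apply: continuous_comp; first exact: lsubmx_continuous.
  exact: sqn_continuous.
exact: (cvgD (cvgM c c) c2).
Qed.

Lemma H_gauge_bounded m n (x : 'rV[R]_(m + n)) : H_gauge x < 1 ->
  forall i, `|x 0 i| <= 1.
Proof.
rewrite -[x]hsubmxK H_gauge_row => x1 i.
have l0 := sqn_ge0 (lsubmx x); have r0 := sqn_ge0 (rsubmx x).
case: (split_ordP i) => j ->.
  rewrite row_mxEl; apply: sqn_bounded; nra.
rewrite row_mxEr; apply: sqn_bounded; nra.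
Qed.

End balls.

(** * The lowest eigenvalue of a Euclidean ball *)

Section euclidean_eigenvalue.
Context (R : realType) (d : nat).
Local Notation ball := [set x : 'rV[R]_d | sqn x < 1].

Lemma partial_first_order phi (j : 'I_d) (x : 'rV[R]_d) : Ck 1 phi ->
  partial j phi x = \sum_i (i == j)%:R * partial i phi x.
Proof.
move=> _; rewrite (bigD1 j)//= eqxx mul1r big1 ?addr0// => i /negPf ->.
by rewrite mul0r.
Qed.

Let smooth_c (j i : 'I_d) : smooth (fun=> (i == j)%:R : R) (d := d).
Proof. by move=> k; exact: Ck_cst. Qed.

Let div_c (j i : 'I_d) (x : 'rV[R]_d) : partial i (fun=> (i == j)%:R : R) x = 0.
Proof. by apply: partialE; exact: is_derive_cst. Qed.

Lemma euclidean_eigenvalue_le lam phi :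
  is_lowest_dirichlet_eigenvalue (@partial R d) (@euclidean_ball R d) lam ->
  Cc_smooth ball phi -> lam * rVint (fun x => phi x ^+ 2) <=
  2^-1 * \sum_j rVint (fun x => partial j phi x ^+ 2).
Proof.
rewrite euclidean_ballE => H.
exact: (lowest_eigenvalue_le_energy (@sqn_continuous R d) (@sqn_bounded R d)
  smooth_c div_c partial_first_order H).
Qed.

Lemma euclidean_eigenvalue_ge m lam :
  is_lowest_dirichlet_eigenvalue (@partial R d) (@euclidean_ball R d) lam ->
  (forall phi, Cc_smooth ball phi -> m * rVint (fun x => phi x ^+ 2) <=
    2^-1 * \sum_j rVint (fun x => partial j phi x ^+ 2)) -> m <= lam.
Proof.
rewrite euclidean_ballE => H.
exact: (lowest_eigenvalue_ge (@sqn_continuous R d) (@sqn_bounded R d)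
  smooth_c div_c partial_first_order H).
Qed.

Lemma Cc_smooth_ball_Cc phi : Cc_smooth ball phi -> Cc phi.
Proof. exact: (Cc_smooth_Cc (@sqn_continuous R d) (@sqn_bounded R d)). Qed.

Lemma Cc_smooth_ball phi : Cc_smooth ball phi <->
  smooth phi /\ exists2 r, r < 1 & forall x, phi x != 0 -> sqn x <= r.
Proof. exact: (Cc_smooth_sublevel (@sqn_continuous R d) (@sqn_bounded R d)). Qed.

Lemma Cc_smooth_ball_partial phi i : Cc_smooth ball phi -> Cc_smooth ball (partial i phi).
Proof. exact: (Cc_smooth_partial (@sqn_continuous R d) (@sqn_bounded R d)). Qed.

(* Integrating the derivative of [x_i * phi ^ 2] gives a Poincare inequality. *)
Lemma poincare_ball (i : 'I_d) phi : Cc_smooth ball phi ->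
  8^-1 * rVint (fun x => phi x ^+ 2) <=
  2^-1 * \sum_j rVint (fun x => partial j phi x ^+ 2).
Proof.
move=> Tp; have Cp := Cc_smooth_ball_Cc Tp.
have Cdp j := Cc_smooth_ball_Cc (Cc_smooth_ball_partial j Tp).
have [sp [r r1 Hr]] := (Cc_smooth_ball phi).1 Tp.
have [sdp [r' r1' Hr']] := (Cc_smooth_ball _).1 (Cc_smooth_ball_partial i Tp).
have S1 : Ck 1 (fun x => x 0 i * (phi x * phi x)).
  by apply: CkM; [exact: Ck_coord|apply: CkM; exact: sp].
have C1 : Cc (fun x => x 0 i * (phi x * phi x)).
  by apply: CcMl; [exact: continuous_rV_coord|exact: CcM].
have H0 := rVint_partial0 i S1 C1.
have CD := Cc_partial i S1 C1.
have Cd2 j := CcX2 (Cdp j).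
have C2 := CcX2 Cp.
have dE x : partial i (fun x => x 0 i * (phi x * phi x)) x =
    2 * (x 0 i * phi x * partial i phi x) + phi x ^+ 2.
  apply: partialE; have dp := Ck_is_derive i x (sp 1%N).
  have dx := @is_derive_coord R d i x (delta_mx 0 i).
  rewrite mxE !eqxx in dx.
  have := is_deriveM dx (is_deriveM dp dp).
  move=> D; apply: (is_derive_eq D).
  rewrite -[(phi * phi) x]/(phi x * phi x) /GRing.scale /= mulr1n.
  by ring.
(* Young's inequality [2 * t * p * q >= - p ^+ 2 / 2 - 2 * q ^+ 2] for [|t| <= 1]. The derivative
   integrates to zero, and comparing the factors [2^-1] and 2 yields the constant [8^-1]. *)
have le1 : rVint (fun x => 2^-1 * phi x ^+ 2) <=
    rVint (fun x => partial i (fun x => x 0 i * (phi x * phi x)) x + 2 * partial i phi x ^+ 2).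
  apply: le_rVint; [exact: CcZ|by apply: CcD => //; exact: CcZ|].
  move=> x; rewrite dE.
  have [->|/Hr' xr] := eqVneq (partial i phi x) 0.
    by have := sqr_ge0 (phi x); lra.
  have : x 0 i ^+ 2 <= 1.
    by apply: le_trans (coord_le_sqn x i) _; apply: le_trans xr (ltW r1').
  move: (x 0 i) (phi x) (partial i phi x) => t p q t1.
  have := sqr_ge0 (p + 2 * t * q); have := sqr_ge0 q; nra.

rewrite (rVintD CD (CcZ 2 (Cd2 i))) (rVintZ _ C2) (rVintZ _ (Cd2 i)) H0 in le1.
have : rVint (fun x => partial i phi x ^+ 2) <= \sum_j rVint (fun x => partial j phi x ^+ 2).
  rewrite (bigD1 i)//= lerDl; apply: sumr_ge0 => j _; apply: rVint_ge0 => x.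
  exact: sqr_ge0.
lra.
Qed.

Lemma euclidean_eigenvalue_gt0 lam : (0 < d)%N ->
  is_lowest_dirichlet_eigenvalue (@partial R d) (@euclidean_ball R d) lam -> 0 < lam.
Proof.
move=> d0 H; apply: (@lt_le_trans _ _ 8^-1); first by rewrite invr_gt0.
by apply: euclidean_eigenvalue_ge H _ => phi; exact: (poincare_ball (Ordinal d0)).
Qed.

(** Otherwise [lam + e] would bound all Rayleigh quotients from below. A function of zero L2 norm
    cannot be the failing one, since its energy is nonnegative. *)
Lemma near_minimizer lam e : 0 < e ->
  is_lowest_dirichlet_eigenvalue (@partial R d) (@euclidean_ball R d) lam ->
  exists phi, [/\ Cc_smooth ball phi, 0 < rVint (fun x => phi x ^+ 2) &
    2^-1 * \sum_j rVint (fun x => partial j phi x ^+ 2) <=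
    (lam + e) * rVint (fun x => phi x ^+ 2)].
Proof.
move=> e0 H; apply: contrapT => Hn.
suff : lam + e <= lam by rewrite gerDl leNgt e0.
apply: euclidean_eigenvalue_ge H _ => phi Tp; rewrite leNgt; apply/negP => lt.
apply: Hn; exists phi; split => //; last exact: ltW.
have : 0 <= rVint (fun x => phi x ^+ 2) by apply: rVint_ge0 => x; exact: sqr_ge0.
rewrite le_eqVlt => /predU1P[E|//]; move: lt; rewrite -E mulr0 ltNge.
rewrite mulr_ge0// sumr_ge0// => j _; apply: rVint_ge0 => x; exact: sqr_ge0.
Qed.

End euclidean_eigenvalue.

Lemma Cc_fiber_smooth (R : realType) m n (h : 'rV[R]_(m + n) -> R) x k :
  Ck k h -> Ck k (fun z => h (row_mx x z)).
Proof.
have LE i (z : 'rV[R]_n) (s : R) : row_mx x (s *: delta_mx 0 i + z) =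
    s *: (1 *: delta_mx 0 (rshift m i)) + row_mx x z.
  by rewrite scale1r row_mx_addr.
apply: (Ck_affine _ LE).
by apply: row_mx_continuous => [|z]; [exact: cst_continuous|exact: cvg_id].
Qed.

Lemma partial_fiber (R : realType) m n (h : 'rV[R]_(m + n) -> R) x i z : Ck 1 h ->
  partial i (fun z => h (row_mx x z)) z = partial (rshift m i) h (row_mx x z).
Proof.
have LE j (y : 'rV[R]_n) (s : R) : row_mx x (s *: delta_mx 0 j + y) =
    s *: (1 *: delta_mx 0 (rshift m j)) + row_mx x y.
  by rewrite scale1r row_mx_addr.
move=> C1; apply: partialE.
by have := is_derive_affine LE i z C1; rewrite mul1r.
Qed.

(** For fixed [x] the slice [phi (row_mx x z)] is a test function of [z]. Its Rayleigh inequality is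
    integrated over [x], and the derivatives along [x] only increase the energy. *)
Lemma euclidean_eigenvalue_monotone (R : realType) m n (lm ln : R) :
  is_lowest_dirichlet_eigenvalue (@partial R (m + n)) (@euclidean_ball R (m + n)) lm ->
  is_lowest_dirichlet_eigenvalue (@partial R n) (@euclidean_ball R n) ln ->
  ln <= lm.
Proof.
move=> Hm Hn; apply: euclidean_eigenvalue_ge Hm _ => phi Tp.
have [sp [r r1 Hr]] := (Cc_smooth_ball phi).1 Tp.
have Cp := Cc_smooth_ball_Cc Tp.
have Cdp j := Cc_smooth_ball_Cc (Cc_smooth_ball_partial j Tp).
have Cdp2 j := CcX2 (Cdp j).
have Hfib x : ln * rVint_fiber (fun w => phi w ^+ 2) x <=
    2^-1 * \sum_j rVint_fiber (fun w => partial (rshift m j) phi w ^+ 2) x.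
  have Tx : Cc_smooth [set z | sqn z < 1] (fun z => phi (row_mx x z)).
    apply/Cc_smooth_ball; split; first by move=> k; exact: Cc_fiber_smooth.
    exists r => // z /Hr; rewrite sqn_row; apply: le_trans.
    by rewrite lerDr sqn_ge0.
  have -> : \sum_j rVint_fiber (fun w => partial (rshift m j) phi w ^+ 2) x =
      \sum_j rVint (fun z => partial j (fun z => phi (row_mx x z)) z ^+ 2).
    apply: eq_bigr => j _; apply: eq_rVint => z.
    by rewrite (partial_fiber _ _ _ (sp 1%N)).
  exact: (euclidean_eigenvalue_le Hn Tx).
rewrite (rVint_row (CcX2 Cp)) -rVintZ; last exact: Cc_rVint_fiber (CcX2 Cp).
have CF j := Cc_rVint_fiber (Cdp2 (rshift m j)).
apply: (@le_trans _ _ (rVint (fun x => 2^-1 *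
    \sum_j rVint_fiber (fun w => partial (rshift m j) phi w ^+ 2) x))).
  apply: le_rVint => //; first by apply: CcZ; exact: Cc_rVint_fiber (CcX2 Cp).
  by apply: CcZ; exact: Cc_sum.
rewrite rVintZ; last exact: Cc_sum.
rewrite ler_wpM2l// rVint_sum// big_split_ord /=.
have -> : \sum_j rVint (rVint_fiber (fun w => partial (rshift m j) phi w ^+ 2)) =
    \sum_j rVint (fun w => partial (rshift m j) phi w ^+ 2).
  by apply: eq_bigr => j _; rewrite -rVint_row.
rewrite lerDr; apply: sumr_ge0 => j _; apply: rVint_ge0 => x; exact: sqr_ge0.
Qed.
(** * The H-type ball *)

Section H_fields.
Context (R : realType) (m n : nat) (U : 'I_n -> 'M[R]_m).
Local Notation ball := [set w : 'rV[R]_(m + n) | H_gauge w < 1].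

(** The coefficients of the field [X_j = d_j + 1/2 sum_k (U_k x)_j d_(z_k)]. *)
Definition H_coef (j : 'I_m) (i : 'I_(m + n)) (w : 'rV[R]_(m + n)) : R :=
  match fintype.split i with
  | inl l => (l == j)%:R
  | inr k => 2^-1 * (lsubmx w *m (U k)^T) 0 j
  end.

Lemma H_coef_l j l w : H_coef j (lshift n l) w = (l == j)%:R.
Proof. by rewrite /H_coef (unsplitK (inl _ l)). Qed.

Lemma H_coef_r j k w :
  H_coef j (rshift m k) w = 2^-1 * (lsubmx w *m (U k)^T) 0 j.
Proof. by rewrite /H_coef (unsplitK (inr _ k)). Qed.

Lemma smooth_H_coef j i : smooth (H_coef j i).
Proof.
move=> k; case: (split_ordP i) => l ->.
  rewrite (_ : H_coef j _ = fun=> (l == j)%:R); first exact: Ck_cst.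
  by apply/funext => w; rewrite H_coef_l.
rewrite (_ : H_coef j _ = fun w => 2^-1 * \sum_s w 0 (lshift n s) * (U l)^T s j).
  by apply: CkZ; apply: Ck_sum => s; apply: CkM; [exact: Ck_coord|exact: Ck_cst].
apply/funext => w; rewrite H_coef_r mxE; congr (_ * _).
by apply: eq_bigr => s _; rewrite [lsubmx _ _ _]mxE.
Qed.

Lemma div_H_coef j i w : partial i (H_coef j i) w = 0.
Proof.
apply: partialE; case: (split_ordP i) => l ->.
  rewrite (_ : H_coef j _ = cst (l == j)%:R); first exact: is_derive_cst.
  by apply/funext => w'; rewrite H_coef_l.
apply/is_derive_lineE.
rewrite [X in is_derive _ _ X](_ : _ = cst (H_coef j (rshift m l) w)).
  exact: is_derive_cst.
apply/funext => h; rewrite /= !H_coef_r; congr (_ * (_ *m _) _ _).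
by apply/rowP => s; rewrite !mxE eq_shift mulr0 add0r.
Qed.

(** The group law is affine in its second argument, so the left translate of a horizontal line is a
    straight line and [H_field] is a directional derivative. *)
Lemma H_mul_line j (w : 'rV[R]_(m + n)) t :
  H_mul U w (t *: row_mx (delta_mx 0 j) 0) = t *: (\row_i H_coef j i w) + w.
Proof.
rewrite /H_mul scale_row_mx row_mxKl row_mxKr scaler0.
apply/rowP => i; case: (split_ordP i) => l ->.
  by rewrite row_mxEl !mxE H_coef_l eqxx /= addrC.
have -> : (t *: (\row_i H_coef j i w) + w) 0 (rshift m l) =
    t * H_coef j (rshift m l) w + rsubmx w 0 l by rewrite !mxE.
rewrite row_mxEr H_coef_r mxE.
have -> : lsubmx w *m (U l)^T *m (t *: delta_mx 0 j)^T =
    t *: col j (lsubmx w *m (U l)^T).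
  by rewrite linearZ /= -scalemxAr trmx_delta -colE.
move: (lsubmx w *m (U l)^T) => v.
have -> : (t *: col j v) 0 0 = t * v 0 j by rewrite !mxE.
by rewrite [(0 : 'rV_n) 0 l]mxE; ring.
Qed.

Lemma H_field_first_order phi j (w : 'rV[R]_(m + n)) : Ck 1 phi ->
  H_field U j phi w = \sum_i H_coef j i w * partial i phi w.
Proof.
move=> C1; rewrite /H_field derive1E.
under eq_fun do rewrite H_mul_line.
have /is_derive_lineE[_ ->] := is_derive_direction (\row_i H_coef j i w) w C1.
by apply: eq_bigr => i _; rewrite mxE.
Qed.

Lemma H_field_row phi j (x : 'rV[R]_m) (z : 'rV[R]_n) : Ck 1 phi ->
  H_field U j phi (row_mx x z) = partial (lshift n j) phi (row_mx x z) +
    \sum_k 2^-1 * (x *m (U k)^T) 0 j * partial (rshift m k) phi (row_mx x z).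
Proof.
move=> C1; rewrite H_field_first_order// big_split_ord /=; congr (_ + _).
  rewrite (bigD1 j)//= H_coef_l eqxx mul1r big1 ?addr0// => i /negPf ij.
  by rewrite H_coef_l ij mul0r.
by apply: eq_bigr => k _; rewrite H_coef_r row_mxKl.
Qed.

Lemma H_eigenvalue_le lam phi :
  is_lowest_dirichlet_eigenvalue (H_field U) (@H_ball R m n) lam ->
  Cc_smooth ball phi -> lam * rVint (fun x => phi x ^+ 2) <=
  2^-1 * \sum_j rVint (fun x => H_field U j phi x ^+ 2).
Proof.
rewrite H_ballE => H.
exact: (lowest_eigenvalue_le_energy (@H_gauge_continuous R m n)
  (@H_gauge_bounded R m n) smooth_H_coef div_H_coef H_field_first_order H).
Qed.

Lemma H_eigenvalue_ge c lam :
  is_lowest_dirichlet_eigenvalue (H_field U) (@H_ball R m n) lam ->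
  (forall phi, Cc_smooth ball phi -> c * rVint (fun x => phi x ^+ 2) <=
    2^-1 * \sum_j rVint (fun x => H_field U j phi x ^+ 2)) -> c <= lam.
Proof.
rewrite H_ballE => H.
exact: (lowest_eigenvalue_ge (@H_gauge_continuous R m n)
  (@H_gauge_bounded R m n) smooth_H_coef div_H_coef H_field_first_order H).
Qed.

Lemma Cc_smooth_H_ball phi : Cc_smooth ball phi <->
  smooth phi /\ exists2 r, r < 1 & forall x, phi x != 0 -> H_gauge x <= r.
Proof. exact: (Cc_smooth_sublevel (@H_gauge_continuous R m n) (@H_gauge_bounded R m n)). Qed.

Lemma Cc_smooth_H_ball_Cc phi : Cc_smooth ball phi -> Cc phi.
Proof. exact: (Cc_smooth_Cc (@H_gauge_continuous R m n) (@H_gauge_bounded R m n)). Qed.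

Lemma Cc_smooth_H_ball_partial phi i : Cc_smooth ball phi -> Cc_smooth ball (partial i phi).
Proof. exact: (Cc_smooth_partial (@H_gauge_continuous R m n) (@H_gauge_bounded R m n)). Qed.

Lemma Cc_H_field phi j : Cc_smooth ball phi -> Cc (H_field U j phi).
Proof.
move=> Tp; apply: Cc_smooth_H_ball_Cc.
exact: (Cc_smooth_X (@H_gauge_continuous R m n)
  (@H_gauge_bounded R m n) smooth_H_coef H_field_first_order).
Qed.

End H_fields.

Section rVint_Cauchy_Schwarz.
Context (R : realType) (d : nat).

Lemma Cc_psd : is_psd_form (@Cc R d) (fun f g => rVint (fun x => f x * g x)).
Proof.
split => [a f g Cf Cg|a f g h Cf Cg Ch|f g _ _|f _].
- by apply: CcD => //; exact: CcZ.
- have Cfh := CcM Cf Ch; have Cgh := CcM Cg Ch.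
  rewrite -(rVintZ _ Cfh) -(rVintD (CcZ _ Cfh) Cgh); apply: eq_rVint => x.
  by rewrite -[(a *: f + g) x]/(a * f x + g x); ring.
- by apply: eq_rVint => x; rewrite mulrC.
- by apply: rVint_ge0 => x; rewrite -expr2 sqr_ge0.
Qed.

Lemma rVint_CS (f g : 'rV[R]_d -> R) : Cc f -> Cc g ->
  rVint (fun x => f x * g x) ^+ 2 <=
  rVint (fun x => f x ^+ 2) * rVint (fun x => g x ^+ 2).
Proof. exact: (psd_CS Cc_psd). Qed.

End rVint_Cauchy_Schwarz.

(** * Lower bound by the L2 norm on the vertical fibres *)

Section lower_bound.
Context (R : realType) (m n : nat) (U : 'I_n -> 'M[R]_m).
Variable phi : 'rV[R]_(m + n) -> R.
Hypothesis Tphi : Cc_smooth [set w : 'rV[R]_(m + n) | H_gauge w < 1] phi.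

Let G x := rVint_fiber (fun w => phi w ^+ 2) x.
Let Cphi := Cc_smooth_H_ball_Cc Tphi.
Let Cphi2 := CcX2 Cphi.

Let smooth_phi2 : smooth (fun w => phi w ^+ 2).
Proof.
by move=> k; under eq_fun do rewrite expr2; apply: CkM; case: Tphi.
Qed.

Let G_ge0 x : 0 <= G x.
Proof. by apply: rVint_ge0 => z; exact: sqr_ge0. Qed.

Let smooth_G : smooth G.
Proof. by move=> k; apply: Ck_rVint_fiber => //; exact: smooth_phi2. Qed.

(* The vertical part of the horizontal field does not contribute, since the
   integral of [phi * d_z phi] over a fiber vanishes. *)
Lemma fiber_norm_derive j x :
  is_derive x (delta_mx 0 j) G
    (2 * rVint (fun z => phi (row_mx x z) * H_field U j phi (row_mx x z))).
Proof.
have [sphi _ _] := Tphi.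
have D := is_derive_rVint_fiber x j (smooth_phi2 1%N) Cphi2.
apply: (is_derive_eq D).
have Cp i := Cc_smooth_H_ball_Cc (Cc_smooth_H_ball_partial i Tphi).
have p2 i w : partial i (fun w => phi w ^+ 2) w = 2 * (phi w * partial i phi w).
  apply: partialE; have dp := Ck_is_derive i w (sphi 1%N).
  have := is_deriveM dp dp => D2; apply: (is_derive_eq D2).
  by rewrite /GRing.scale /=; ring.
have Z k : rVint (fun z => phi (row_mx x z) * partial (rshift m k) phi (row_mx x z)) = 0.
  have := rVint_partial0 k (Cc_fiber_smooth x (smooth_phi2 1%N)) (Cc_row x Cphi2).
  have Ck := Cc_row x (CcM Cphi (Cp (rshift m k))).
  rewrite (_ : partial k _ = fun z => 2 * (phi (row_mx x z) *
      partial (rshift m k) phi (row_mx x z))); last first.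
    by apply/funext => z; rewrite (partial_fiber _ _ _ (smooth_phi2 1%N)) p2.
  by rewrite (rVintZ _ Ck); lra.
have Cl := Cc_row x (CcM Cphi (Cp (lshift n j))).
have Cr k := Cc_row x (CcM Cphi (Cp (rshift m k))).
have -> : rVint (fun z => phi (row_mx x z) * H_field U j phi (row_mx x z)) =
    rVint (fun z => phi (row_mx x z) * partial (lshift n j) phi (row_mx x z)).
  have -> : (fun z => phi (row_mx x z) * H_field U j phi (row_mx x z)) =
      fun z => phi (row_mx x z) * partial (lshift n j) phi (row_mx x z) +
      \sum_k 2^-1 * (x *m (U k)^T) 0 j * (phi (row_mx x z) *
        partial (rshift m k) phi (row_mx x z)).
    apply/funext => z; rewrite (H_field_row _ _ _ _ (sphi 1%N)) mulrDr mulr_sumr.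
    by congr (_ + _); apply: eq_bigr => k _; ring.
  have Ck k := CcZ (2^-1 * (x *m (U k)^T) 0 j) (Cr k).
  rewrite (rVintD Cl (Cc_sum _ Ck)) (rVint_sum _ Ck).
  by rewrite big1 ?addr0// => k _; rewrite (rVintZ _ (Cr k)) Z mulr0.
by rewrite -(rVintZ _ Cl); apply: eq_rVint => z; rewrite p2.
Qed.

Let Gj j x := rVint_fiber (fun w => H_field U j phi w ^+ 2) x.
Let CXphi j := Cc_H_field U j Tphi.

Let partial_G_le j x : partial j G x ^+ 2 <= 4 * (G x * Gj j x).
Proof.
rewrite (partialE (fiber_norm_derive j x)).
have := rVint_CS (Cc_row x Cphi) (Cc_row x (CXphi j)).
rewrite exprMn -/(G x) -/(Gj j x) => CS.
by rewrite (_ : 2 ^+ 2 = 4 :> R) ?ler_wpM2l//; ring.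
Qed.

Section regularization.
Variables (e : R) (e0 : 0 < e).
(** [Num.sqrt (G x)] may fail to be smooth at zeros of [G]. Adding [e ^+ 2] under the root repairs
    this, and subtracting [e] keeps [F] zero wherever [G] is, hence compactly supported. *)
Let S x := Num.sqrt (G x + e ^+ 2).
Let F x := S x - e.

Let Ge_gt0 x : 0 < G x + e ^+ 2.
Proof. by rewrite ltr_wpDl// exprn_gt0. Qed.

Let S_gt0 x : 0 < S x. Proof. by rewrite sqrtr_gt0. Qed.

Let S2 x : S x ^+ 2 = G x + e ^+ 2.
Proof. by rewrite sqr_sqrtr// ltW. Qed.

Let smooth_F : smooth F.
Proof.
move=> k; apply: CkD; last exact: Ck_cst.
apply: Ck_sqrt => //; apply: CkD; [exact: smooth_G|exact: Ck_cst].
Qed.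

Let F_neq0 x : F x != 0 -> G x != 0.
Proof.
apply: contra_neq => Gx.
by rewrite /F /S Gx add0r sqrtr_sqr gtr0_norm// subrr.
Qed.

Let test_F : Cc_smooth [set x : 'rV[R]_m | sqn x < 1] F.
Proof.
apply/Cc_smooth_ball; split; first exact: smooth_F.
have [_ [r r1 Hr]] := (Cc_smooth_H_ball phi).1 Tphi.
(* The gauge contains the square of [sqn x], so the margin becomes its root. *)
exists (Num.sqrt r) => [|x /F_neq0].
  by rewrite -[X in _ < X]sqrtr1 ltr_sqrt.
apply: contraNT; rewrite -ltNge => rx; apply/eqP.
rewrite /G /rVint_fiber (_ : (fun z => _) = fun=> 0) ?rVint0//.
apply/funext => z; apply/eqP; rewrite sqrf_eq0; apply: contraTT rx => /Hr.
rewrite H_gauge_row -leNgt => xr.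
rewrite -[sqn x]ger0_norm ?sqn_ge0// -sqrtr_sqr ler_wsqrtr//.
by apply: le_trans xr; rewrite lerDl sqn_ge0.
Qed.

(** The derivative of [F] is that of [G] divided by [2 * S], and [G <= S ^+ 2]; so the
    regularization costs nothing in the energy. *)
Let partial_F_le j x : partial j F x ^+ 2 <= Gj j x.
Proof.
have dG := Ck_is_derive j x (@smooth_G 1%N).
have -> : partial j F x = partial j G x * (2 * S x)^-1.
  apply: partialE.
  have dGe : is_derive x (delta_mx 0 j) (fun y => G y + e ^+ 2) (partial j G x).
    by rewrite -[X in is_derive _ _ _ X]addr0; apply: is_deriveD; exact: is_derive_cst.
  have dS := @is_derive_comp1 R _ Num.sqrt (fun y => G y + e ^+ 2) _ _ _ _
    (is_derive1_sqrt (Ge_gt0 x)) dGe.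
  rewrite -[X in is_derive _ _ _ X]addr0.
  have dc := is_derive_cst (- e) x (delta_mx 0 j).
  exact: is_deriveD dS dc.
rewrite exprMn exprVn ler_pdivrMr; last by rewrite exprn_gt0// mulr_gt0.
apply: le_trans (partial_G_le j x) _.
have Gj0 : 0 <= Gj j x by apply: rVint_ge0 => z; exact: sqr_ge0.
rewrite exprMn S2; have := sqr_ge0 e; nra.
Qed.

Let F_le x : F x <= Num.sqrt (G x).
Proof.
rewrite lerBlDr -(ler_pXn2r (n := 2))// ?nnegrE ?sqrtr_ge0//; last first.
  by rewrite addr_ge0 ?sqrtr_ge0// ltW.
rewrite S2 sqrrD sqr_sqrtr//.
have : 0 <= Num.sqrt (G x) * e by rewrite mulr_ge0 ?sqrtr_ge0// ltW.
lra.
Qed.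

Lemma regularized_fiber_norm lam : 0 <= lam ->
  is_lowest_dirichlet_eigenvalue (@partial R m) (@euclidean_ball R m) lam ->
  lam * rVint (fun w => phi w ^+ 2) <=
  2^-1 * \sum_j rVint (fun w => H_field U j phi w ^+ 2) +
    e * (2 * lam * rVint (fun x => Num.sqrt (G x))).
Proof.
move=> lam0 H; have := euclidean_eigenvalue_le H test_F.
have CG : Cc G by exact: Cc_rVint_fiber.
have CsG : Cc (fun x => Num.sqrt (G x)).
  case: CG => cG [M HM]; split.
    move=> x; apply: continuous_comp; [exact: cG|exact: sqrt_continuous].
  exists M => x sx; apply: HM; apply: contra_neq sx => ->; exact: sqrtr0.
have CF := Cc_smooth_ball_Cc test_F.
(* From [(F + e) ^+ 2 = G + e ^+ 2] follows [F ^+ 2 = G - 2 * e * F], and [F] is at most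
   [Num.sqrt G]. *)
have le1 : rVint G - 2 * e * rVint (fun x => Num.sqrt (G x)) <= rVint (fun x => F x ^+ 2).
  have -> : rVint G - 2 * e * rVint (fun x => Num.sqrt (G x)) =
      rVint (fun x => G x + (- (2 * e)) * Num.sqrt (G x)).
    by rewrite rVintD ?rVintZ ?mulNr//; exact: CcZ.
  apply: le_rVint; [by apply: CcD => //; exact: CcZ|exact: CcX2|] => x.
  have -> : F x ^+ 2 = G x - 2 * e * F x.
    by rewrite -[G x](addrK (e ^+ 2)) -S2 /F; ring.
  by rewrite mulNr lerD2l lerN2 ler_wpM2l// mulr_ge0// ltW.
have le2 : \sum_j rVint (fun x => partial j F x ^+ 2) <=
    \sum_j rVint (fun w => H_field U j phi w ^+ 2).
  apply: ler_sum => j _; rewrite [leRHS]rVint_row; last exact: CcX2.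
  apply: le_rVint => //.
    by apply: CcX2; apply: Cc_smooth_ball_Cc; exact: Cc_smooth_ball_partial.
  by apply: Cc_rVint_fiber; exact: CcX2.
have -> : rVint (fun w => phi w ^+ 2) = rVint G := rVint_row Cphi2.
have := ler_wpM2l lam0 le1; rewrite mulrBr; move: le2.
set b := rVint (fun x => Num.sqrt (G x)); set c := rVint (fun x => F x ^+ 2).
set s := \sum_j _; set t := \sum_j _; set a := rVint G => le2 le1' le3.
lra.
Qed.

End regularization.

Lemma H_rayleigh_ge lam : 0 <= lam ->
  is_lowest_dirichlet_eigenvalue (@partial R m) (@euclidean_ball R m) lam ->
  lam * rVint (fun w => phi w ^+ 2) <=
  2^-1 * \sum_j rVint (fun w => H_field U j phi w ^+ 2).
Proof.
move=> lam0 H; apply/ler_addgt0Pr => d d0.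
set K := 2 * lam * rVint (fun x => Num.sqrt (G x)).
have K0 : 0 <= K.
  by rewrite mulr_ge0 ?mulr_ge0//; apply: rVint_ge0 => x; exact: sqrtr_ge0.
have e0 : 0 < d / (K + 1) by rewrite divr_gt0// ltr_wpDl.
apply: le_trans (regularized_fiber_norm e0 lam0 H) _.
rewrite lerD2l -/K mulrAC ler_pdivrMr ?ltr_wpDl// ler_pM2l// lerDl//.
Qed.

End lower_bound.

(** * Products of a horizontal and a vertical function *)

Section tensor.
Context (R : realType) (m n : nat).

Lemma Cc_tensor (A : 'rV[R]_m -> R) (B : 'rV[R]_n -> R) : Cc A -> Cc B ->
  Cc (fun w : 'rV[R]_(m + n) => A (lsubmx w) * B (rsubmx w)).
Proof.
move=> [cA [M HM]] [cB [N HN]]; split.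
  have cl : continuous (A \o @lsubmx R 1 m n).
    by move=> w; apply: continuous_comp; [exact: lsubmx_continuous|exact: cA].
  have cr : continuous (B \o @rsubmx R 1 m n).
    by move=> w; apply: continuous_comp; [exact: rsubmx_continuous|exact: cB].
  by move=> w; exact: (cvgM (cl w) (cr w)).
exists (Num.max M N) => w; rewrite mulf_eq0 negb_or => /andP[/HM HA /HN HB] i.
rewrite -[w]hsubmxK le_max; case: (split_ordP i) => l ->.
  by rewrite row_mxEl HA.
by rewrite row_mxEr HB orbT.
Qed.

Lemma rVint_tensor (A : 'rV[R]_m -> R) (B : 'rV[R]_n -> R) : Cc A -> Cc B ->
  rVint (fun w : 'rV[R]_(m + n) => A (lsubmx w) * B (rsubmx w)) = rVint A * rVint B.
Proof.
move=> CA CB; rewrite rVint_row; last exact: Cc_tensor.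
rewrite mulrC -(rVintZ _ CA); apply: eq_rVint => x.
rewrite /rVint_fiber mulrC -(rVintZ _ CB); apply: eq_rVint => z.
by rewrite row_mxKl row_mxKr.
Qed.

Let cl (i : 'I_(m + n)) : R := if fintype.split i is inl _ then 1 else 0.
Let cr (i : 'I_(m + n)) : R := if fintype.split i is inr _ then 1 else 0.
(** On the axes that the projection forgets, the target axis is an arbitrary default, harmless
    because the factor [cl] or [cr] is 0 there. *)
Let sl (i0 : 'I_m) (i : 'I_(m + n)) := if fintype.split i is inl l then l else i0.
Let sr (i0 : 'I_n) (i : 'I_(m + n)) := if fintype.split i is inr l then l else i0.

Let lsubmx_line i0 i (w : 'rV[R]_(m + n)) h :
  lsubmx (h *: delta_mx 0 i + w) = h *: (cl i *: delta_mx 0 (sl i0 i)) + lsubmx w.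
Proof.
rewrite /cl /sl; case: (split_ordP i) => l ->; apply/rowP => s; rewrite !mxE.
  by rewrite eq_shift mul1r.
by rewrite eq_shift mul0r !mulr0.
Qed.

Let rsubmx_line i0 i (w : 'rV[R]_(m + n)) h :
  rsubmx (h *: delta_mx 0 i + w) = h *: (cr i *: delta_mx 0 (sr i0 i)) + rsubmx w.
Proof.
rewrite /cr /sr; case: (split_ordP i) => l ->; apply/rowP => s; rewrite !mxE.
  by rewrite eq_shift mul0r !mulr0.
by rewrite eq_shift mul1r.
Qed.

Context (i0 : 'I_m) (k0 : 'I_n).

Lemma smooth_tensor (A : 'rV[R]_m -> R) (B : 'rV[R]_n -> R) : smooth A -> smooth B ->
  smooth (fun w : 'rV[R]_(m + n) => A (lsubmx w) * B (rsubmx w)).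
Proof.
move=> sA sB k; apply: CkM.
  exact: (Ck_affine (@lsubmx_continuous R m n) (lsubmx_line i0) (sA k)).
exact: (Ck_affine (@rsubmx_continuous R m n) (rsubmx_line k0) (sB k)).
Qed.

Lemma partial_tensor_l (A : 'rV[R]_m -> R) (B : 'rV[R]_n -> R) j w :
  smooth A -> smooth B ->
  partial (lshift n j) (fun w : 'rV[R]_(m + n) => A (lsubmx w) * B (rsubmx w)) w =
  partial j A (lsubmx w) * B (rsubmx w).
Proof.
move=> sA sB; apply: partialE.
have dA := is_derive_affine (lsubmx_line i0) (lshift n j) w (sA 1%N).
have dB := is_derive_affine (rsubmx_line k0) (lshift n j) w (sB 1%N).
have := is_deriveM dA dB => D; apply: (is_derive_eq D).
rewrite /cl /cr /sl /sr (unsplitK (inl _ j)) /GRing.scale /=; ring.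
Qed.

Lemma partial_tensor_r (A : 'rV[R]_m -> R) (B : 'rV[R]_n -> R) k w :
  smooth A -> smooth B ->
  partial (rshift m k) (fun w : 'rV[R]_(m + n) => A (lsubmx w) * B (rsubmx w)) w =
  A (lsubmx w) * partial k B (rsubmx w).
Proof.
move=> sA sB; apply: partialE.
have dA := is_derive_affine (lsubmx_line i0) (rshift m k) w (sA 1%N).
have dB := is_derive_affine (rsubmx_line k0) (rshift m k) w (sB 1%N).
have := is_deriveM dA dB => D; apply: (is_derive_eq D).
rewrite /cl /cr /sl /sr (unsplitK (inr _ k)) /GRing.scale /=; ring.
Qed.

End tensor.

(** Under the dilation [x / a] both integrals gain the factor [a ^+ d], which cancels in the
    quotient, while the squared derivatives also gain [(a ^+ 2)^-1]. *)
Lemma near_minimizer_scaled (R : realType) d lam e (a : R) : 0 < e -> 0 < a ->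
  is_lowest_dirichlet_eigenvalue (@partial R d) (@euclidean_ball R d) lam ->
  exists F : 'rV[R]_d -> R, [/\ smooth F, Cc F,
    exists2 r, r < 1 & forall x, F x != 0 -> sqn x <= a ^+ 2 * r,
    0 < rVint (fun x => F x ^+ 2) &
    2^-1 * \sum_j rVint (fun x => partial j F x ^+ 2) <=
    (a ^+ 2)^-1 * (lam + e) * rVint (fun x => F x ^+ 2)].
Proof.
move=> e0 a0 H; have [f [Tf f0 fE]] := near_minimizer e0 H.
have [sf [r r1 Hr]] := (Cc_smooth_ball f).1 Tf.
have Cf := Cc_smooth_ball_Cc Tf.
have b0 : 0 < a^-1 by rewrite invr_gt0.
have LE i (x : 'rV[R]_d) (h : R) :
    a^-1 *: (h *: delta_mx 0 i + x) = h *: (a^-1 *: delta_mx 0 i) + a^-1 *: x.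
  by rewrite scalerDr !scalerA mulrC.
have cL : continuous (fun x : 'rV[R]_d => a^-1 *: x) by exact: scaler_continuous.
have V0 : 0 < (a^-1 ^+ d)^-1 by rewrite invr_gt0 exprn_gt0.
have F2 : rVint (fun x => f (a^-1 *: x) ^+ 2) =
    (a^-1 ^+ d)^-1 * rVint (fun x => f x ^+ 2).
  rewrite -(rVint_scale b0 (CcX2 Cf))// => x; exact: sqr_ge0.
exists (fun x => f (a^-1 *: x)); split.
- move=> k; exact: (Ck_affine cL LE (sf k)).
- exact: Cc_scale.
- exists r => // x /Hr; rewrite sqnZ exprVn.
  by rewrite ler_pdivrMl// exprn_gt0.
- by rewrite F2 mulr_gt0.
- have dF j : rVint (fun x => partial j (fun x => f (a^-1 *: x)) x ^+ 2) =
      (a ^+ 2)^-1 * ((a^-1 ^+ d)^-1 * rVint (fun x => partial j f x ^+ 2)).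
    have Cd := CcX2 (Cc_smooth_ball_Cc (Cc_smooth_ball_partial j Tf)).
    rewrite -(rVint_scale b0 Cd); last by move=> x; exact: sqr_ge0.
    rewrite -rVintZ; last exact: (Cc_scale b0 Cd).
    apply: eq_rVint => x; rewrite -exprVn -exprMn; congr (_ ^+ 2).
    exact/partialE/(is_derive_affine LE j x (sf 1%N)).
  rewrite (eq_bigr _ (fun j _ => dF j)) F2 -!mulr_sumr.
  rewrite [leLHS]mulrCA -[leRHS]mulrA ler_pM2l ?invr_gt0 ?exprn_gt0//.
  by rewrite [leLHS]mulrCA [leRHS]mulrCA ler_pM2l.
Qed.

(** * Upper bound by products of Euclidean near minimizers *)

Section upper_bound.
Context (R : realType) (m n : nat) (U : 'I_n -> 'M[R]_m) (i0 : 'I_m) (k0 : 'I_n).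
(** The identity [|J_Z Y| = |Z| |Y|], squared and written in coordinates. *)
Hypothesis hU : forall (y : 'rV[R]_m) (a : 'rV[R]_n),
  \sum_j (\sum_k a 0 k * (y *m (U k)^T) 0 j) ^+ 2 = sqn a * sqn y.

(** The field acts by [X_j (F K) = K d_j F + 1/2 F sum_k (U_k x)_j d_k K]. Squaring gives [T1],
    cross terms [T2] whose vertical factor [K d_k K] is half the derivative of [K ^+ 2] and
    integrates to zero, and a last square that [hU] evaluates after summation over [j]. There
    [|x| ^+ 2] is at most [a] on the support of [F]: here [a] bounds a squared radius. *)
Lemma H_energy_tensor_le (F : 'rV[R]_m -> R) (K : 'rV[R]_n -> R) (a : R) :
  smooth F -> smooth K -> Cc F -> Cc K -> (forall x, F x != 0 -> sqn x <= a) ->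
  \sum_j rVint (fun w => H_field U j (fun w => F (lsubmx w) * K (rsubmx w)) w ^+ 2) <=
  (\sum_j rVint (fun x => partial j F x ^+ 2)) * rVint (fun z => K z ^+ 2) +
  4^-1 * a * (rVint (fun x => F x ^+ 2) * \sum_k rVint (fun z => partial k K z ^+ 2)).
Proof.
move=> sF sK CF CK aF.
pose phi (w : 'rV[R]_(m + n)) := F (lsubmx w) * K (rsubmx w).
rewrite -[leLHS]/(\sum_j rVint (fun w => H_field U j phi w ^+ 2)).
have sphi : smooth phi by exact: (smooth_tensor i0 k0).
have CdF j : Cc (partial j F) by exact: Cc_partial (sF 1%N) CF.
have CdK k : Cc (partial k K) by exact: Cc_partial (sK 1%N) CK.
pose P j k (x : 'rV[R]_m) := (x *m (U k)^T) 0 j * (F x * partial j F x).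
pose N k (z : 'rV[R]_n) := K z * partial k K z.
have CP j k : Cc (P j k).
  apply: CcMl; last exact: CcM.
  apply: (Ck_continuous (k := 0)); under eq_fun do rewrite mxE.
  by apply: Ck_sum => i; apply: CkM; [exact: Ck_coord|exact: Ck_cst].
have CN k : Cc (N k) by exact: CcM.
have N0 k : rVint (N k) = 0.
  have K2 : Ck 1 (fun z => K z * K z) by exact: CkM.
  have := rVint_partial0 k K2 (CcM CK CK).
  rewrite (_ : partial k _ = fun z => 2 * N k z); first by rewrite (rVintZ _ (CN k)); lra.
  apply/funext => z; apply: partialE; have dK := Ck_is_derive k z (sK 1%N).
  have := is_deriveM dK dK => D; apply: (is_derive_eq D).
  by rewrite /N /GRing.scale /=; ring.
have XE j w : H_field U j phi w = partial j F (lsubmx w) * K (rsubmx w) +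
    F (lsubmx w) * (2^-1 * \sum_k partial k K (rsubmx w) * (lsubmx w *m (U k)^T) 0 j).
  rewrite -{1}[w]hsubmxK H_field_row; last exact: sphi.
  rewrite (partial_tensor_l i0 k0)// row_mxKl row_mxKr; congr (_ + _).
  rewrite mulrCA mulr_sumr mulr_sumr; apply: eq_bigr => k _.
  by rewrite (partial_tensor_r i0 k0)// row_mxKl row_mxKr; ring.
pose T1 j (w : 'rV[R]_(m + n)) := partial j F (lsubmx w) ^+ 2 * K (rsubmx w) ^+ 2.
pose T2 j k (w : 'rV[R]_(m + n)) := P j k (lsubmx w) * N k (rsubmx w).
pose T3 k (w : 'rV[R]_(m + n)) := F (lsubmx w) ^+ 2 * partial k K (rsubmx w) ^+ 2.
have CT1 j : Cc (T1 j).
  by apply: (Cc_tensor (A := fun x => partial j F x ^+ 2) (B := fun z => K z ^+ 2)); exact: CcX2.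
have CT2 j k : Cc (T2 j k) by exact: Cc_tensor.
have CT3 k : Cc (T3 k).
  by apply: (Cc_tensor (A := fun x => F x ^+ 2) (B := fun z => partial k K z ^+ 2)); exact: CcX2.
have pw w : \sum_j H_field U j phi w ^+ 2 <= \sum_j T1 j w +
    (\sum_j \sum_k T2 j k w + 4^-1 * a * \sum_k T3 k w).
  have hUw := hU (lsubmx w) (\row_k partial k K (rsubmx w)).
  have -> : \sum_j H_field U j phi w ^+ 2 = \sum_j T1 j w + (\sum_j \sum_k T2 j k w +
      4^-1 * F (lsubmx w) ^+ 2 *
      \sum_j (\sum_k partial k K (rsubmx w) * (lsubmx w *m (U k)^T) 0 j) ^+ 2).
    rewrite mulr_sumr -!big_split /=; apply: eq_bigr => j _.
    have -> : \sum_k T2 j k w = partial j F (lsubmx w) * K (rsubmx w) * F (lsubmx w) *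
        \sum_k partial k K (rsubmx w) * (lsubmx w *m (U k)^T) 0 j.
      by rewrite mulr_sumr; apply: eq_bigr => k _; rewrite /T2 /P /N; ring.
    by rewrite XE /T1; move: (\sum_k _) => s; field.
  rewrite !lerD2l.
  have -> : \sum_j (\sum_k partial k K (rsubmx w) * (lsubmx w *m (U k)^T) 0 j) ^+ 2 =
      (\sum_k partial k K (rsubmx w) ^+ 2) * sqn (lsubmx w).
    transitivity (sqn (\row_k partial k K (rsubmx w)) * sqn (lsubmx w)).
      by rewrite -hUw; apply: eq_bigr => j _; congr (_ ^+ 2); apply: eq_bigr => k _; rewrite mxE.
    by congr (_ * _); apply: eq_bigr => k _; rewrite mxE.
  rewrite /T3 -mulr_sumr.
  have s0 : 0 <= \sum_k partial k K (rsubmx w) ^+ 2 by apply: sumr_ge0 => k _; exact: sqr_ge0.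
  have [->|/aF xa] := eqVneq (F (lsubmx w)) 0; first by rewrite expr0n /= !(mulr0, mul0r).
  have -> (s q : R) : 4^-1 * F (lsubmx w) ^+ 2 * (s * q) = (4^-1 * F (lsubmx w) ^+ 2 * s) * q.
    by ring.
  have -> (s : R) : 4^-1 * a * (F (lsubmx w) ^+ 2 * s) = (4^-1 * F (lsubmx w) ^+ 2 * s) * a.
    by ring.
  by rewrite ler_wpM2l// mulr_ge0// mulr_ge0// sqr_ge0.
have CX j : Cc (fun w => H_field U j phi w ^+ 2).
  apply: CcX2; rewrite (_ : H_field U j phi = fun w => partial j F (lsubmx w) * K (rsubmx w) +
    2^-1 * \sum_k (F (lsubmx w) * (lsubmx w *m (U k)^T) 0 j) * partial k K (rsubmx w)).
    apply: CcD; first exact: Cc_tensor.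
    apply: CcZ; apply: Cc_sum => k.
    apply: (@Cc_tensor _ _ _ (fun x => F x * (x *m (U k)^T) 0 j)) => //.
    apply: CcMr => //; apply: (Ck_continuous (k := 0)); under eq_fun do rewrite mxE.
    by apply: Ck_sum => i; apply: CkM; [exact: Ck_coord|exact: Ck_cst].
  apply/funext => w; rewrite XE mulrCA mulr_sumr; congr (_ + _ * _).
  by apply: eq_bigr => k _; ring.
rewrite -rVint_sum//.
have CS1 := Cc_sum (index_enum 'I_m) CT1.
have CS2 := Cc_sum (index_enum 'I_m) (fun j => Cc_sum (index_enum 'I_n) (CT2 j)).
have CS3 := Cc_sum (index_enum 'I_n) CT3.
have CS3' := CcZ (4^-1 * a) CS3.
apply: le_trans (le_rVint (Cc_sum _ CX) (CcD CS1 (CcD CS2 CS3')) pw) _.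
rewrite (rVintD CS1 (CcD CS2 CS3')) (rVintD CS2 CS3') (rVintZ _ CS3).
rewrite (rVint_sum _ CT1) (rVint_sum _ CT3) rVint_sum; last by move=> j; exact: Cc_sum.
have -> : \sum_j rVint (fun w => \sum_k T2 j k w) = 0.
  apply: big1 => j _; rewrite (rVint_sum _ (CT2 j)); apply: big1 => k _.
  by rewrite (rVint_tensor (CP j k) (CN k)) N0 mulr0.
have E1 j : rVint (T1 j) = rVint (fun x => partial j F x ^+ 2) * rVint (fun z => K z ^+ 2).
  by rewrite -(rVint_tensor (CcX2 (CdF j)) (CcX2 CK)).
have E3 k : rVint (T3 k) = rVint (fun x => F x ^+ 2) * rVint (fun z => partial k K z ^+ 2).
  by rewrite -(rVint_tensor (CcX2 CF) (CcX2 (CdK k))).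
rewrite (eq_bigr _ (fun j _ => E1 j)) (eq_bigr _ (fun k _ => E3 k)).
by rewrite -mulr_suml -mulr_sumr add0r.
Qed.

Lemma H_eigenvalue_le_bound lam lm ln e a b : 0 < e -> 0 < a -> 0 < b ->
  a ^+ 4 + b ^+ 2 = 1 ->
  is_lowest_dirichlet_eigenvalue (H_field U) (@H_ball R m n) lam ->
  is_lowest_dirichlet_eigenvalue (@partial R m) (@euclidean_ball R m) lm ->
  is_lowest_dirichlet_eigenvalue (@partial R n) (@euclidean_ball R n) ln ->
  lam <= (lm + e) / a ^+ 2 + a ^+ 2 * (ln + e) / (4 * b ^+ 2).
Proof.
move=> e0 a0 b0 ab H Hm Hn.
have [F [sF CF [r r1 Fr] F0 FE]] := near_minimizer_scaled e0 a0 Hm.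
have [K [sK CK [s s1 Ks] K0 KE]] := near_minimizer_scaled e0 b0 Hn.
have a2 : 0 < a ^+ 2 by rewrite exprn_gt0.
have b2 : 0 < b ^+ 2 by rewrite exprn_gt0.
have T : Cc_smooth [set w : 'rV[R]_(m + n) | H_gauge w < 1]
    (fun w => F (lsubmx w) * K (rsubmx w)).
  apply/Cc_smooth_H_ball; split; first exact: (smooth_tensor i0 k0).
  (* A common margin in [[0, 1[]: then [t ^+ 2 <= t], and the gauge is at most
     [(a ^+ 4 + b ^+ 2) * t = t] on the support. *)
  pose t := Num.max 0 (Num.max r s).
  have [t0 rt st] : [/\ 0 <= t, r <= t & s <= t].
    by split; rewrite !le_max lexx ?orbT.
  have t1 : t < 1 by rewrite !gt_max ltr01 r1 s1.
  exists t => // w; rewrite mulf_eq0 negb_or => /andP[/Fr Fx /Ks Kz].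
  rewrite /H_gauge; have x0 := sqn_ge0 (lsubmx w).
  have h1 : sqn (lsubmx w) <= a ^+ 2 * t by apply: le_trans Fx _; rewrite ler_pM2l.
  have h2 : sqn (rsubmx w) <= b ^+ 2 * t by apply: le_trans Kz _; rewrite ler_pM2l.
  have h3 : sqn (lsubmx w) ^+ 2 <= a ^+ 4 * t.
    apply: (@le_trans _ _ ((a ^+ 2 * t) ^+ 2)).
      by rewrite ler_sqr ?nnegrE// mulr_ge0// ltW.
    rewrite exprMn -exprM; apply: ler_wpM2l; first by rewrite exprn_ge0// ltW.
    by nra.
  rewrite -[leRHS]mul1r -ab mulrDl; exact: lerD.
have aF x : F x != 0 -> sqn x <= a ^+ 2.
  move=> /Fr h; apply: le_trans h _; rewrite -[leRHS]mulr1 ler_pM2l//; exact: ltW.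
have := H_eigenvalue_le H T.
have F2 := CcX2 CF; have K2 := CcX2 CK.
have -> : rVint (fun w => (F (lsubmx w) * K (rsubmx w)) ^+ 2) =
    rVint (fun x => F x ^+ 2) * rVint (fun z => K z ^+ 2).
  rewrite -(rVint_tensor F2 K2); apply: eq_rVint => w; exact: exprMn.
have := H_energy_tensor_le sF sK CF CK aF.
move: F0 K0 FE KE.
move: (rVint (fun x => F x ^+ 2)) (rVint (fun z => K z ^+ 2)) => f k.
move: (\sum_j rVint (fun x => partial j F x ^+ 2)) => df.
move: (\sum_k rVint (fun x => partial k K x ^+ 2)) => dk.
move: (\sum_j _) => E f0 k0' FE KE Ele lamE.
have fk : 0 < f * k by rewrite mulr_gt0.
rewrite -(ler_pM2r fk); apply: le_trans lamE _.
have FE' : 2^-1 * (df * k) <= (a ^+ 2)^-1 * (lm + e) * (f * k).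
  by rewrite mulrA [leRHS]mulrA ler_pM2r.
have KE' : 4^-1 * a ^+ 2 * (2^-1 * (f * dk)) <= 4^-1 * a ^+ 2 * ((b ^+ 2)^-1 * (ln + e) * (f * k)).
  apply: ler_wpM2l; first by rewrite mulr_ge0// ltW.
  by rewrite [leLHS]mulrCA [leRHS]mulrCA ler_pM2l.
have -> : ((lm + e) / a ^+ 2 + a ^+ 2 * (ln + e) / (4 * b ^+ 2)) * (f * k) =
    (a ^+ 2)^-1 * (lm + e) * (f * k) + 4^-1 * a ^+ 2 * ((b ^+ 2)^-1 * (ln + e) * (f * k)).
  by field; rewrite !gt_eqF.
lra.
Qed.

End upper_bound.
(** * H-type algebras and the minimization of the bound *)

Section H_type_algebra.
Context (R : realType) (g : vectType R) (br : g -> g -> g) (ip : g -> g -> R).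

Section inner_product.
Hypothesis Hip : is_inner_product ip.

Lemma ip0l y : ip 0 y = 0.
Proof.
have := ip_linearl Hip y 1 0 0; rewrite scale1r addr0 mul1r => E.
lra.
Qed.

Lemma ipZl a x y : ip (a *: x) y = a * ip x y.
Proof. by have := ip_linearl Hip y a x 0; rewrite addr0 ip0l addr0. Qed.

Lemma ip_suml (I : Type) (s : seq I) (c : I -> R) (u : I -> g) y :
  ip (\sum_(i <- s) c i *: u i) y = \sum_(i <- s) c i * ip (u i) y.
Proof.
elim: s => [|i s IH]; first by rewrite !big_nil ip0l.
by rewrite !big_cons (ip_linearl Hip) IH.
Qed.

Lemma ip_sumr (I : Type) (s : seq I) (c : I -> R) (u : I -> g) y :
  ip y (\sum_(i <- s) c i *: u i) = \sum_(i <- s) c i * ip y (u i).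
Proof.
by rewrite (ip_sym Hip) ip_suml; apply: eq_bigr => i _; rewrite (ip_sym Hip).
Qed.

Lemma ip_orthonormal_coord v k (e : k.-tuple g) (c : 'I_k -> R) j :
  is_orthonormal_basis ip v e -> ip (\sum_i c i *: tnth e i) (tnth e j) = c j.
Proof.
move=> [_ He]; rewrite ip_suml (bigD1 j)//= He eqxx mulr1 big1 ?addr0// => i ij.
by rewrite He (negPf ij) mulr0.
Qed.

Lemma ip_orthonormal_sqn v k (e : k.-tuple g) (c : 'rV[R]_k) :
  is_orthonormal_basis ip v e ->
  ip (\sum_i c 0 i *: tnth e i) (\sum_i c 0 i *: tnth e i) = sqn c.
Proof.
move=> He; rewrite ip_sumr; apply: eq_bigr => j _.
by rewrite (ip_orthonormal_coord _ _ He) expr2.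
Qed.

Lemma parseval v k (e : k.-tuple g) u : is_orthonormal_basis ip v e -> u \in v ->
  \sum_j ip u (tnth e j) ^+ 2 = ip u u.
Proof.
move=> He uv; have [be _] := He.
have uE : u = \sum_i (\row_i coord e i u) 0 i *: tnth e i.
  rewrite {1}(coord_basis be uv); apply: eq_bigr => i _.
  by rewrite mxE (tnth_nth 0).
rewrite [in RHS]uE (ip_orthonormal_sqn _ He); apply: eq_bigr => j _; congr (_ ^+ 2).
by rewrite {1}uE (ip_orthonormal_coord _ _ He).
Qed.

End inner_product.

Section H_type.
Context (z v : {vspace g}) (m n : nat) (e : m.-tuple g) (f : n.-tuple g).
Hypothesis HH : is_H_type br ip z v.
Hypothesis He : is_orthonormal_basis ip v e.
Hypothesis Hf : is_orthonormal_basis ip z f.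

Let Hip := H_ip HH.
Let U k := J_mx br ip e (tnth f k).

Lemma br0l y : br 0 y = 0.
Proof.
have := lie_linearl (H_lie HH) y 1 0 0; rewrite !scale1r addr0 => E.
by apply: (@addrI _ (br 0 y)); rewrite addr0 -E.
Qed.

Lemma br_suml (I : Type) (s : seq I) (c : I -> R) (u : I -> g) y :
  br (\sum_(i <- s) c i *: u i) y = \sum_(i <- s) c i *: br (u i) y.
Proof.
elim: s => [|i s IH]; first by rewrite !big_nil br0l.
by rewrite !big_cons (lie_linearl (H_lie HH)) IH.
Qed.

Lemma onb_mem w k (t : k.-tuple g) (c : 'I_k -> R) : is_orthonormal_basis ip w t ->
  \sum_i c i *: tnth t i \in w.
Proof.
move=> [bt _]; apply: memv_suml => i _; apply: memvZ.
by apply: (basis_mem bt); exact: mem_tnth.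
Qed.

(** If [w] has norm [s > 0], then [<w, [Y, e_j]> = s <J Y, e_j>] for the orthogonal map [J] of the
    unit vector [w / s]. Parseval turns the sum into [s ^+ 2 |J Y| ^+ 2], which is
    [s ^+ 2 |Y| ^+ 2]. *)
Lemma bracket_norm w Y : w \in z -> Y \in v ->
  \sum_j ip w (br Y (tnth e j)) ^+ 2 = ip w w * ip Y Y.
Proof.
move=> wz Yv; have [->|w0] := eqVneq w 0.
  by rewrite (ip0l Hip) mul0r big1// => j _; rewrite (ip0l Hip) expr0n.
have c0 := ip_posdef Hip w0; set c := ip w w in c0 *.
pose s := Num.sqrt c.
have s0 : 0 < s by rewrite sqrtr_gt0.
have s2 : s ^+ 2 = c by rewrite sqr_sqrtr// ltW.
have w1 : ip (s^-1 *: w) (s^-1 *: w) = 1.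
  rewrite (ipZl Hip) (ip_sym Hip) (ipZl Hip) -/c -s2.
  by field; rewrite gt_eqF.
have [|J [Jv JE Jorth]] := H_orthogonal HH _ w1; first exact: memvZ.
have ev j : tnth e j \in v.
  by have [be _] := He; apply: (basis_mem be); exact: mem_tnth.
rewrite -(Jorth Y Y Yv Yv) -(parseval Hip He (Jv _ Yv)) -s2 mulr_sumr.
apply: eq_bigr => j _; rewrite JE// (ipZl Hip) exprMn exprVn mulrA mulfV ?mul1r//.
by rewrite expf_neq0// gt_eqF.
Qed.

Lemma J_mx_norm (y : 'rV[R]_m) (a : 'rV[R]_n) :
  \sum_j (\sum_k a 0 k * (y *m (U k)^T) 0 j) ^+ 2 = sqn a * sqn y.
Proof.
have wz := onb_mem (fun k => a 0 k) Hf; have Yv := onb_mem (fun i => y 0 i) He.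
have := bracket_norm wz Yv.
rewrite (ip_orthonormal_sqn Hip _ Hf) (ip_orthonormal_sqn Hip _ He) => <-.
apply: eq_bigr => j _; congr (_ ^+ 2).
rewrite (ip_suml Hip); apply: eq_bigr => k _; congr (_ * _).
rewrite br_suml (ip_sumr Hip) mxE; apply: eq_bigr => i _.
by rewrite !mxE.
Qed.

Lemma H_type_dim_center_gt0 : \dim z = n -> (0 < n)%N.
Proof. by move=> <-; rewrite lt0n dimv_eq0; exact: H_nontrivial HH. Qed.

Lemma H_type_dim_complement_gt0 : \dim v = m -> (0 < m)%N.
Proof.
move=> <-; rewrite lt0n dimv_eq0; apply/eqP => v0.
have : (z <= 0)%VS.
  apply/(H_bracket HH) => x y; rewrite v0 memv0 => /eqP -> _.
  by rewrite br0l mem0v.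
by rewrite subv0; apply/negP; exact: H_nontrivial HH.
Qed.

(* For a unit vector y, the vectors U_k y are orthonormal. *)
Lemma H_type_dim_center_le : \dim v = m -> (n <= m)%N.
Proof.
move=> /H_type_dim_complement_gt0 m0; pose i0 := Ordinal m0.
pose y : 'rV[R]_m := delta_mx 0 i0.
have y1 : sqn y = 1.
  rewrite /sqn (bigD1 i0)//= big1 ?addr0 => [|i /negPf ii0].
    by rewrite !mxE !eqxx expr1n.
  by rewrite !mxE ii0 andbF expr0n.
pose A : 'M[R]_(n, m) := \matrix_(k, j) (y *m (U k)^T) 0 j.
have : row_free A.
  apply: inj_row_free => a aA.
  have : sqn a = 0.
    rewrite -[sqn a]mulr1 -y1 -J_mx_norm big1// => j _.
    have : (a *m A) 0 j = 0 by rewrite aA mxE.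
    rewrite mxE => E; rewrite (eq_bigr (fun k => a 0 k * A k j)) ?E ?expr0n// => k _.
    by rewrite [A k j]mxE.
  move=> a0; apply/rowP => k; rewrite mxE; apply/eqP; rewrite -sqrf_eq0.
  by rewrite eq_le sqr_ge0 -a0 coord_le_sqn.
by rewrite /row_free => /eqP <-; exact: rank_leq_col.
Qed.

End H_type.

End H_type_algebra.

Lemma euclidean_eigenvalue_le_dim (R : realType) (m n : nat) (lm ln : R) : (n <= m)%N ->
  is_lowest_dirichlet_eigenvalue (@partial R m) (@euclidean_ball R m) lm ->
  is_lowest_dirichlet_eigenvalue (@partial R n) (@euclidean_ball R n) ln ->
  ln <= lm.
Proof. by move=> /subnK <-; exact: euclidean_eigenvalue_monotone. Qed.

(** * Minimization of the upper bound over the radii *)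

Section minimization.
Context (R : realType) (A B : R).
Hypothesis B0 : 0 < B.
(** This makes the denominator of [gap_argmin] positive. The bounds [0 < xs] and [xs < 1] then read
    [3 * B < D] and [D < 8 * A + B], and squaring reduces each of them to [B < 4 * A] again. *)
Hypothesis BA : B < 4 * A.
Let xs := gap_argmin A B.
Let D := Num.sqrt (B ^+ 2 + 32 * B * A).

Let A0 : 0 < A. Proof. by move: B0 BA; lra. Qed.
Let AB0 : 0 < B * A. Proof. exact: mulr_gt0. Qed.
Let BAB0 : 0 < B * (4 * A - B). Proof. by rewrite mulr_gt0// subr_gt0. Qed.
Let D_ge0 : 0 <= B ^+ 2 + 32 * B * A.
Proof. by have := AB0; have := sqr_ge0 B; lra. Qed.
Let D2 : D ^+ 2 = B ^+ 2 + 32 * B * A. Proof. by rewrite sqr_sqrtr. Qed.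
Let D_gt : 3 * B < D.
Proof.
rewrite -(ltr_pXn2r (n := 2))// ?nnegrE ?sqrtr_ge0//; last by rewrite mulr_ge0// ltW.
by rewrite D2; move: BAB0; lra.
Qed.
Let D_lt : D < 8 * A + B.
Proof.
rewrite -(ltr_pXn2r (n := 2))// ?nnegrE ?sqrtr_ge0//; last by move: A0 B0; lra.
have : 0 < A * (4 * A - B) by rewrite mulr_gt0// subr_gt0.
by rewrite D2; lra.
Qed.

Lemma gap_argmin_itv : 0 < xs < 1.
Proof.
rewrite /xs /gap_argmin -/D; have d0 : 0 < 2 * (4 * A - B) by rewrite mulr_gt0// subr_gt0.
rewrite divr_gt0//=; last by rewrite subr_gt0.
by rewrite ltr_pdivrMr//; move: D_lt; lra.
Qed.

(** The left side is the derivative of [gap_bound A B] at [xs], multiplied by [8 * xs ^+ 2] and the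
    cube of [Num.sqrt (1 - xs)]. *)
Let xs_root : (4 * A - B) * xs ^+ 2 + 3 * B * xs - 2 * B = 0.
Proof.
rewrite /xs /gap_argmin -/D; have d0 : 4 * A - B != 0 by rewrite gt_eqF// subr_gt0.
have -> : (4 * A - B) * ((D - 3 * B) / (2 * (4 * A - B))) ^+ 2 +
   3 * B * ((D - 3 * B) / (2 * (4 * A - B))) - 2 * B =
   (D ^+ 2 - 9 * B ^+ 2 - 8 * B * (4 * A - B)) / (4 * (4 * A - B)) by field.
by rewrite D2 (_ : _ - _ = 0) ?mul0r//; ring.
Qed.

(** In the variables [s] and [t] with [x = 1 - s ^+ 2] and [xs = 1 - t ^+ 2], the root equation
    expresses [A] through [B] and [t]. The difference of the two values is then an explicit
    nonnegative multiple of [(s - t) ^+ 2]. *)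
Lemma gap_bound_min x : 0 < x < 1 -> gap_bound A B xs <= gap_bound A B x.
Proof.
move=> /andP[x0 x1]; have /andP[xs0 xs1] := gap_argmin_itv; rewrite -/xs in xs0 xs1.
rewrite /gap_bound; set t := Num.sqrt (1 - xs); set s := Num.sqrt (1 - x).
have t0 : 0 < t by rewrite sqrtr_gt0 subr_gt0.
have s0 : 0 < s by rewrite sqrtr_gt0 subr_gt0.
have t2 : xs = 1 - t ^+ 2 by rewrite sqr_sqrtr ?subr_ge0 ?ltW//; ring.
have s2 : x = 1 - s ^+ 2 by rewrite sqr_sqrtr ?subr_ge0 ?ltW//; ring.
have root := xs_root; rewrite t2 in root xs0 *; rewrite s2 in x0 *.
have AE : A = B * t ^+ 2 * (1 + t ^+ 2) / (4 * (1 - t ^+ 2) ^+ 2).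
  apply: (canRL (mulfK _)); first by rewrite mulf_neq0// expf_neq0// gt_eqF.
  have -> : A * (4 * (1 - t ^+ 2) ^+ 2) = B * t ^+ 2 * (1 + t ^+ 2) +
     ((4 * A - B) * (1 - t ^+ 2) ^+ 2 + 3 * B * (1 - t ^+ 2) - 2 * B) by ring.
  by rewrite root addr0.
rewrite -subr_ge0.
have -> : A / s + B * s / (4 * (1 - s ^+ 2)) - (A / t + B * t / (4 * (1 - t ^+ 2))) =
   B * (s - t) ^+ 2 * (1 + 2 * s * t + t ^+ 2) /
     (4 * (s * (1 - s ^+ 2) * (1 - t ^+ 2) ^+ 2)).
  by rewrite AE; field; rewrite !gt_eqF.
apply: divr_ge0.
  rewrite mulr_ge0//; first by rewrite mulr_ge0 ?sqr_ge0// ltW.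
  have := mulr_gt0 s0 t0; have := sqr_ge0 t; lra.
apply: mulr_ge0 => //; apply: mulr_ge0; last exact: sqr_ge0.
by rewrite ltW// mulr_gt0.
Qed.

Lemma gap_bound_inf :
  gap_bound A B xs = inf [set gap_bound A B x | x in `]0, 1[ ].
Proof.
have xsI : `]0, 1[%classic xs by rewrite /= in_itv /= gap_argmin_itv.
have lbS : lbound [set gap_bound A B x | x in `]0, 1[ ] (gap_bound A B xs).
  by move=> _ [x + <-]; rewrite /= in_itv /=; exact: gap_bound_min.
apply/eqP; rewrite eq_le; apply/andP; split.
  by apply: lb_le_inf => //; exists (gap_bound A B xs); exists xs.
by apply: ge_inf; [exists (gap_bound A B xs)|exists xs].
Qed.

End minimization.

Theorem theorem3p2 (R : realType) (g : vectType R)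
    (br : g -> g -> g) (ip : g -> g -> R) (z v : {vspace g}) (m n : nat)
    (e : m.-tuple g) (f : n.-tuple g) (lam1 lam1m lam1n : R) :
  is_H_type br ip z v ->
  \dim v = m -> \dim z = n ->
  is_orthonormal_basis ip v e -> is_orthonormal_basis ip z f ->
  is_lowest_dirichlet_eigenvalue 
    (H_field (fun k => J_mx br ip e (tnth f k))) (@H_ball R m n) lam1 ->
  is_lowest_dirichlet_eigenvalue (@partial R m) (@euclidean_ball R m) lam1m ->
  is_lowest_dirichlet_eigenvalue (@partial R n) (@euclidean_ball R n) lam1n ->
  let c := gap_bound lam1m lam1n in
  let xstar := gap_argmin lam1m lam1n in
  [/\ lam1m <= lam1, lam1 <= c xstar, 0 < xstar < 1 &
      c xstar = inf [set c x | x in `]0, 1[ ] ].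
Proof.
move=> HH dv dz He Hf H1 Hm Hn c xstar.
have n0 := H_type_dim_center_gt0 HH dz.
have m0 := H_type_dim_complement_gt0 HH dv.
have nm := H_type_dim_center_le HH He Hf dv.
have lm0 := euclidean_eigenvalue_gt0 m0 Hm.
have ln0 := euclidean_eigenvalue_gt0 n0 Hn.
have ln_lm := euclidean_eigenvalue_le_dim nm Hm Hn.
have ln_4lm : lam1n < 4 * lam1m by lra.
have xI := gap_argmin_itv ln0 ln_4lm.
split => //; last exact: gap_bound_inf.
  apply: (H_eigenvalue_ge H1) => phi Tphi.
  exact: (H_rayleigh_ge _ Tphi (ltW lm0) Hm).
have /andP[x0 x1] := xI; rewrite -/xstar in x0 x1.
pose s := Num.sqrt (1 - xstar).
have s0 : 0 < s by rewrite sqrtr_gt0 subr_gt0.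
apply/ler_addgt0Pr => d d0.
(* Raising both Euclidean eigenvalues by [q] raises the bound by [q * w], so the error [d / w] costs
   exactly [d]. *)
pose w := s^-1 + s / (4 * xstar).
have w0 : 0 < w by rewrite addr_gt0//; [rewrite invr_gt0|rewrite divr_gt0// mulr_gt0].
have e0 : 0 < d / w by rewrite divr_gt0.
(* The radii are [a = Num.sqrt s] and [b = Num.sqrt xstar], so that [a ^+ 4 = 1 - xstar] and
   [b ^+ 2 = xstar]. *)
have a0 : 0 < Num.sqrt s by rewrite sqrtr_gt0.
have b0 : 0 < Num.sqrt xstar by rewrite sqrtr_gt0.
have ab : Num.sqrt s ^+ 4 + Num.sqrt xstar ^+ 2 = 1.
  rewrite (exprM _ 2 2) !sqr_sqrtr ?(ltW s0) ?(ltW x0)//; last first.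
    by rewrite subr_ge0 ltW.
  by rewrite subrK.
have := H_eigenvalue_le_bound (Ordinal m0) (Ordinal n0) (J_mx_norm HH He Hf)
  e0 a0 b0 ab H1 Hm Hn.
rewrite !sqr_sqrtr ?(ltW s0) ?(ltW x0)//; move=> /le_trans; apply.
have E q : (lam1m + q) / s + s * (lam1n + q) / (4 * xstar) =
    lam1m / s + lam1n * s / (4 * xstar) + q * w.
  by rewrite /w; field; rewrite !gt_eqF.
by rewrite E divfK// gt_eqF.
Qed.
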